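(* Let $E$ be a Banach space, $1\le p<\infty$, let $A_1,A_2$ be generators of strongly continuous semigroups $(T_1(t))_{t\ge0}$, $(T_2(t))_{t\ge0}$ on $E$, let $F=\mathrm{L}^p(\mathbb{R}_+;E)$, and on $\mathcal{E}=E\times F\times F$ let $$\mathcal{A}_1=\begin{pmatrix}A_1&\delta_0&0\\0&\frac{\mathrm d}{\mathrm ds}&0\\0&0&0\end{pmatrix},\ D(\mathcal{A}_1)=D(A_1)\times D(\tfrac{\mathrm d}{\mathrm ds})\times F,\qquad \mathcal{A}_2=\begin{pmatrix}A_2&0&\delta_0\\0&0&0\\0&0&\frac{\mathrm d}{\mathrm ds}\end{pmatrix},\ D(\mathcal{A}_2)=D(A_2)\times F\times D(\tfrac{\mathrm d}{\mathrm ds}),$$ with $D(\frac{\mathrm d}{\mathrm ds})=\mathrm{W}^{1,p}(\mathbb{R}_+;E)$, and let $(\mathcal{T}_1(t))_{t\ge0}$, $(\mathcal{T}_2(t))_{t\ge0}$ be the strongly continuous semigroups generated by $\mathcal{A}_1,\mathcal{A}_2$. Then the following hold. (1) Suppose that for some $M'\ge1$ and $\omega'\ge0$ one has $\|(T_2(\tfrac tn)T_1(\tfrac tn))^n\|\le M'\mathrm{e}^{t\omega'}$ for all $t\ge0$ and $n\in\mathbb{N}$. Then there exist $M\ge1$ and $\omega\in\mathbb{R}$ such that $$\bigl\|\bigl(\mathcal{T}_2(\tfrac tn)\mathcal{T}_1(\tfrac tn)\bigr)^n\bigr\|\le M\mathrm{e}^{t\omega}\quad\text{for all }t\ge0\text{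 and }n\in\mathbb{N}.$$ Moreover, if $\mathcal{A}:=\overline{\mathcal{A}_1+\mathcal{A}_2}$ is the generator of a strongly continuous semigroup $(\mathcal{T}(t))_{t\ge0}$ on $\mathcal{E}$, then for all $x\in\mathcal{E}$ and $t\ge0$ $$\mathcal{T}(t)x=\lim_{n\to\infty}\bigl(\mathcal{T}_2(\tfrac tn)\mathcal{T}_1(\tfrac tn)\bigr)^nx\quad\text{and}\quad\mathcal{T}(t)x=\lim_{n\to\infty}\bigl(\mathcal{T}_1(\tfrac t{2n})\mathcal{T}_2(\tfrac tn)\mathcal{T}_1(\tfrac t{2n})\bigr)^nx.$$ (2) Suppose that for some $M'\ge1$ and $\omega'\ge0$ one has $\bigl\|\tfrac1{2^n}(T_1(\tfrac tn)T_2(\tfrac tn)+T_2(\tfrac tn)T_1(\tfrac tn))^n\bigr\|\le M'\mathrm{e}^{t\omega'}$ for all $t\ge0$ and $n\in\mathbb{N}$. Then there exist $M\ge1$ and $\omega\in\mathbb{R}$ such that $$\Bigl\|\frac1{2^n}\bigl(\mathcal{T}_1(\tfrac tn)\mathcal{T}_2(\tfrac tn)+\mathcal{T}_2(\tfrac tn)\mathcal{T}_1(\tfrac tn)\bigr)^n\Bigr\|\le M\mathrm{e}^{t\omega}\quad\text{for all }t\ge0\text{ and }n\in\mathbb{N}.$$ Moreover, if $\mathcal{A}:=\overline{\mathcal{A}_1+\mathcal{A}_2}$ is the generator of a strongly continuous semigroup $(\mathcal{T}(t))_{t\ge0}$ on $\mathcal{E}$, then for all $x\in\mathcal{E}$ and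 $t\ge0$ $$\mathcal{T}(t)x=\lim_{n\to\infty}\frac1{2^n}\bigl(\mathcal{T}_1(\tfrac tn)\mathcal{T}_2(\tfrac tn)+\mathcal{T}_2(\tfrac tn)\mathcal{T}_1(\tfrac tn)\bigr)^nx.$$
   Context: $\mathrm{L}^p(\mathbb{R}_+;E)$ is the Bochner–Lebesgue space on $\mathbb{R}_+=[0,\infty)$; $\frac{\mathrm d}{\mathrm ds}$ with domain the Sobolev space $\mathrm{W}^{1,p}(\mathbb{R}_+;E)$ is the generator of the left-shift semigroup $(L(t)f)(s)=f(s+t)$ on $F$; $\delta_0:\mathrm{W}^{1,p}(\mathbb{R}_+;E)\to E$, $\delta_0f:=f(0)$, is point evaluation at $0$ (of the continuous representative). The operators $\mathcal{A}_1,\mathcal{A}_2$ do generate strongly continuous semigroups on $\mathcal{E}$. $\overline{\mathcal{A}_1+\mathcal{A}_2}$ is the closure of the sum defined on $D(\mathcal{A}_1)\cap D(\mathcal{A}_2)$. $\mathbb{N}=\{1,2,\dots\}$. *)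

(* Defs.v *)
From HB Require Import structures.
From mathcomp Require Import all_boot all_order all_algebra.
From mathcomp Require Import generic_quotient ring_quotient.
From mathcomp Require Import all_classical all_reals all_analysis.
From mathcomp Require Import measurable_realfun.
Import Order.TTheory GRing.Theory Num.Theory.
Import numFieldNormedType.Exports.

Set Implicit Arguments.
Unset Strict Implicit.
Unset Printing Implicit Defensive.

Local Open Scope classical_set_scope.
Local Open Scope ring_scope.

Section bochner.
Context {R : realType} {E : normedModType R}.
Notation mu := (@lebesgue_measure R).

Definition Rplus : set R := `[0, +oo[.

(* Functions on R_+ are represented by functions on the whole line whose
   values on the negative axis are ignored. *)
Definition simple_fun (s : R -> E) :=
  finite_set (range s) /\ forall y, measurable (s @^-1` [set y]).

Definition strongly_measurable (f : R -> E) :=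
  exists s_ : nat -> R -> E, (forall n, simple_fun (s_ n)) /\
    forall x, s_ n x @[n --> \oo] --> f x.

Definition integrable_simple_fun (s : R -> E) :=
  simple_fun s /\
  forall y, y != 0 -> (mu (Rplus `&` s @^-1` [set y]) < +oo)%E.

(* [fine +oo = 0], which is harmless: only the value y = 0 can be taken on a
   set of infinite measure. *)
Definition simple_integral (s : R -> E) : E :=
  \sum_(y \in range s) fine (mu (Rplus `&` s @^-1` [set y])) *: y.

(* f is Bochner integrable over R_+ with integral v. *)
Definition is_bochner_integral (f : R -> E) (v : E) :=
  strongly_measurable f /\
  exists s_ : nat -> R -> E,
    [/\ forall n, integrable_simple_fun (s_ n),
        (\int[mu]_(x in Rplus) (`|f x - s_ n x|)%:E)%E @[n --> \oo] --> 0%E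
      & simple_integral (s_ n) @[n --> \oo] --> v].

End bochner.

Section strongly_measurable_theory.
Context {R : realType} {E : normedModType R}.
Implicit Types (s t f g : R -> E).

Lemma measurable_Rplus : measurable (@Rplus R).
Proof. exact: measurable_itv. Qed.

Lemma simple_fun_comp2 (F : normedModType R) (op : E -> E -> F) s t :
  simple_fun s -> simple_fun t -> simple_fun (fun x => op (s x) (t x)).
Proof.
move=> [fs ms] [ft mt]; split.
  apply: (@sub_finite_set _ _ [set op u v | u in range s & v in range t]).
    by move=> _ [x _ <-]; exists (s x) => //; exists (t x).
  exact: finite_image2.
move=> y; rewrite (_ : _ @^-1` _ = \bigcup_(u in range s)
    \bigcup_(v in range t `&` [set v | op u v = y])
      (s @^-1` [set u] `&` t @^-1` [set v])).
  apply: fin_bigcup_measurable => // u _; apply: fin_bigcup_measurable => [|v _].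
    exact: finite_setIl.
  by apply: measurableI; [exact: ms|exact: mt].
apply/seteqP; split=> x /=.
  by move=> xy; exists (s x) => //; exists (t x) => //; split => //; exists x.
by move=> [u _ [v [_ /= uvy] [/= -> ->]]].
Qed.

Lemma simple_fun_cst (a : E) : simple_fun (fun _ : R => a).
Proof.
split; first by apply: (@sub_finite_set _ _ [set a]) => // _ [x _ <-].
by move=> y; rewrite preimage_cst; case: ifP.
Qed.

Lemma strongly_measurable_cst (a : E) : strongly_measurable (fun _ : R => a).
Proof.
exists (fun _ _ => a); split => [_|x]; first exact: simple_fun_cst.
exact: cvg_cst.
Qed.

Lemma strongly_measurableD f g :
  strongly_measurable f -> strongly_measurable g ->
  strongly_measurable (f + g).
Proof.
move=> [s_ [ss sf]] [t_ [st tg]]; exists (fun n x => s_ n x + t_ n x); split.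
  by move=> n; exact: (@simple_fun_comp2 _ (fun u v => u + v)).
by move=> x; apply: cvgD; [exact: sf|exact: tg].
Qed.

Lemma strongly_measurableZ (a : R) f :
  strongly_measurable f -> strongly_measurable (a *: f).
Proof.
move=> [s_ [ss sf]]; exists (fun n x => a *: s_ n x); split.
  by move=> n; exact: (@simple_fun_comp2 _ (fun u _ => a *: u) _ _ (ss n) (ss n)).
by move=> x; apply: cvgZl_tmp; exact: sf.
Qed.

Lemma simple_fun_norm_measurable s :
  simple_fun s -> measurable_fun setT (fun x => `|s x|).
Proof.
move=> [fs ms] _ Y mY; rewrite setTI.
rewrite (_ : _ @^-1` _ = \bigcup_(u in range s `&` [set u | Y `|u|])
   s @^-1` [set u]).
  by apply: fin_bigcup_measurable => // ; exact: finite_setIl.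
apply/seteqP; split=> x /=.
  by move=> Yx; exists (s x) => //; split => //; exists x.
by move=> [u [_ /= Yu] /= ->].
Qed.

Lemma strongly_measurable_norm f :
  strongly_measurable f -> measurable_fun setT (fun x => `|f x|).
Proof.
move=> [s_ [ss sf]].
apply: (@measurable_fun_cvg _ _ _ _ (fun n x => `|s_ n x|)).
  by move=> n; exact: simple_fun_norm_measurable.
by move=> x _; apply: cvg_norm; exact: sf.
Qed.

End strongly_measurable_theory.

(* Locked so that unification does not unfold the integral. *)
HB.lock Definition Lp_integral {R : realType} {E : normedModType R} (p : R)
    (f : R -> E) : \bar R :=
  (\int[@lebesgue_measure R]_(x in Rplus) (`|f x| `^ p)%:E)%E.
Canonical Lp_integral_unlockable := Unlockable Lp_integral.unlock.

Section Lp_functions.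
Context {R : realType} (E : normedModType R) (p : R) (p1 : 1 <= p).
Notation mu := (@lebesgue_measure R).
Implicit Types f g : R -> E.

Definition Lp_fun & 1 <= p : {pred R -> E} :=
  mem [set f : R -> E | strongly_measurable f /\ (Lp_integral p f < +oo)%E].

Definition Lp_norm f : R := fine (Lp_integral p f) `^ p^-1.

Let p0 : 0 < p. Proof. exact: lt_le_trans p1. Qed.

Lemma Lp_integral_ge0 f : (0 <= Lp_integral p f)%E.
Proof. by rewrite unlock; apply: integral_ge0 => x _; rewrite lee_fin powR_ge0. Qed.

Lemma Lp_integrand_measurable f (D : set R) : strongly_measurable f ->
  measurable_fun D (fun x => (`|f x| `^ p)%:E).
Proof.
move=> mf; apply/measurable_EFinP.
apply: (measurable_funS measurableT) => //.
apply: (@measurableT_comp _ _ _ _ _ _ (@powR R ^~ p)) => //.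
exact: strongly_measurable_norm.
Qed.

Lemma Lp_integral_Lnorm f :
  (Lp_integral p f `^ p^-1)%E =
  Lnorm mu p%:E (EFin \o ((fun x => `|f x|) \_ Rplus)).
Proof.
rewrite Lp_integral.unlock unlock /Lnorm [in LHS]integral_mkcond; congr (_ `^ _)%E.
apply: eq_integral => x _; rewrite /patch /=; case: ifPn => _ /=.
  by rewrite normr_id.
by rewrite normr0 powR0// gt_eqF.
Qed.

Lemma Lp_integralZ a f : strongly_measurable f ->
  Lp_integral p (a *: f) = ((`|a| `^ p)%:E * Lp_integral p f)%E.
Proof.
move=> mf; rewrite unlock; transitivity
    (\int[mu]_(x in Rplus) ((`|a| `^ p)%:E * (`|f x| `^ p)%:E))%E.
  by apply: eq_integral => x _; rewrite -EFinM -powRM// -normrZ.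
rewrite ge0_integralZl_EFin ?powR_ge0//.
- exact: measurable_Rplus.
- exact: Lp_integrand_measurable.
Qed.

Lemma Lp_minkowski f g : strongly_measurable f -> strongly_measurable g ->
  (Lp_integral p (f + g)%R `^ p^-1 <=
   Lp_integral p f `^ p^-1 + Lp_integral p g `^ p^-1)%E.
Proof.
move=> mf mg; rewrite !Lp_integral_Lnorm.
have mr (h : R -> E) : strongly_measurable h ->
    measurable_fun setT ((fun x => `|h x|) \_ Rplus).
  move=> mh; apply/(measurable_restrictT _ measurable_Rplus).
  apply: (measurable_funS measurableT) => //.
  exact: strongly_measurable_norm.
have := minkowski_EFin mu (mr _ mf) (mr _ mg) p1.
apply: le_trans.
rewrite unlock /Lnorm; apply: gt0_ler_poweR.
- by rewrite invr_ge0 ltW.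
- by rewrite in_itv/= integral_ge0 ?leey// => x _; rewrite poweR_ge0.
- by rewrite in_itv/= integral_ge0 ?leey// => x _; rewrite poweR_ge0.
have mpow (h : R -> R) : measurable_fun setT h ->
    measurable_fun setT (fun x : R => (`|(EFin \o h) x| `^ p)%E).
  move=> mh; apply: (@measurableT_comp _ _ _ _ _ _ (@poweR R ^~ p)).
    exact: measurable_poweR.
  by apply: measurableT_comp => //; exact/measurable_EFinP.
apply: ge0_le_integral => //.
- by move=> x _; rewrite poweR_ge0.
- by apply: mpow; apply: mr; exact: strongly_measurableD.
- by apply: mpow; apply: measurable_funD; exact: mr.
move=> x _ /=; rewrite lee_fin ge0_ler_powR ?nnegrE ?(ltW p0)//.
rewrite /patch; case: ifPn => _; last by rewrite addr0.
rewrite normr_id ger0_norm ?addr_ge0//; exact: ler_normD.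
Qed.

Lemma Lp_fun_submod_closed : submod_closed (Lp_fun p1).
Proof.
split.
  rewrite inE /=; split; first exact: strongly_measurable_cst.
  rewrite unlock (eq_integral (cst 0%E)) ?integral0//.
  by move=> x _; rewrite normr0 powR0// gt_eqF.
move=> a f g; rewrite !inE /= => -[mf fi] [mg gi].
have maf := strongly_measurableZ a mf.
split; first exact: strongly_measurableD.
apply: (@lty_poweRy _ _ p^-1); first by rewrite gt_eqF// invr_gt0.
apply: le_lt_trans (Lp_minkowski maf mg) _.
rewrite lte_add_pinfty//; apply: poweR_lty => //.
by rewrite Lp_integralZ// lte_mul_pinfty// ?lee_fin ?powR_ge0.
Qed.

HB.instance Definition _ := GRing.isSubmodClosed.Build _ _ (Lp_fun p1)
  Lp_fun_submod_closed.

End Lp_functions.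

Section Lp_space.
Context {R : realType} (E : normedModType R) (p : R) (p1 : 1 <= p).
Notation mu := (@lebesgue_measure R).

Record Lp_function := MkLpFunction {
  Lp_function_val :> R -> E ;
  Lp_functionP : Lp_function_val \in @Lp_fun R E p p1 }.

HB.instance Definition _ := [isSub of Lp_function for Lp_function_val].
HB.instance Definition _ := [Choice of Lp_function by <:].
HB.instance Definition _ := [SubChoice_isSubLmodule of Lp_function by <:].

Implicit Types f g : Lp_function.

Definition Lp_null : {pred Lp_function} :=
  mem [set f : Lp_function | f = cst 0 %[ae mu in Rplus]].

Lemma Lp_function_measurable f : strongly_measurable f.
Proof. by case: f => f /=; rewrite inE => -[]. Qed.

Lemma Lp_function_lty f : (Lp_integral p f < +oo)%E.
Proof. by case: f => f /=; rewrite inE => -[]. Qed.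

Lemma Lp_null_submod_closed : submod_closed Lp_null.
Proof.
have FF : Filter (almost_everywhere mu) by exact: ae_filter_ringOfSetsType.
split; first by rewrite inE /=; exact: nearW.
move=> a f g; rewrite !inE /=; apply: filterS2 => x f0 g0 Rx.
by rewrite /GRing.add /GRing.scale /= f0// g0// scaler0 addr0.
Qed.

HB.instance Definition _ := GRing.isSubmodClosed.Build _ _ Lp_null
  Lp_null_submod_closed.

(* The Bochner-Lebesgue space L^p(R_+; E): p-integrable strongly measurable
   functions modulo equality almost everywhere on R_+. *)
Definition Lp : Type := Quotient.quot Lp_null.
HB.instance Definition _ := GRing.Zmodule.on Lp.
HB.instance Definition _ := EqQuotient.on Lp.

Local Open Scope quotient_scope.

Definition Lp_repr (u : Lp) : R -> E := repr u.

Lemma Lp_piE f g : (f - g \in Lp_null) = (f == g %[mod Lp]).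
Proof. exact: Quotient.idealrBE. Qed.

Lemma pi_LpD f g : \pi_Lp (f + g) = \pi_Lp f + \pi_Lp g.
Proof. exact: (raddfD (\pi_(Quotient.quot Lp_null))). Qed.

Lemma pi_Lp0 : \pi_Lp 0 = 0.
Proof. exact: (raddf0 (\pi_(Quotient.quot Lp_null))). Qed.

Lemma Lp_eqP f g :
  reflect (f = g %[ae mu in Rplus]) (f == g %[mod Lp]).
Proof.
have FF : Filter (almost_everywhere mu) by exact: ae_filter_ringOfSetsType.
rewrite -Lp_piE; apply: (iffP idP); rewrite inE /=.
  apply: filterS => x fg Rx; apply/eqP; rewrite -subr_eq0; apply/eqP.
  exact: fg.
by apply: filterS => x fg Rx; rewrite /GRing.add /GRing.opp /= fg// subrr.
Qed.

Definition Lp_scale (a : R) (u : Lp) : Lp := \pi_Lp (a *: repr u).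

Lemma Lp_scaleE a f : Lp_scale a (\pi_Lp f) = \pi_Lp (a *: f).
Proof.
apply/esym/eqP; rewrite -Lp_piE -scalerBr rpredZ//.
by rewrite Lp_piE reprK.
Qed.

Lemma Lp_elim (P : Lp -> Prop) : (forall f, P (\pi_Lp f)) -> forall u, P u.
Proof. by move=> Pf u; rewrite -[u]reprK; exact: Pf. Qed.

Lemma Lp_scaleA a b (u : Lp) : Lp_scale a (Lp_scale b u) = Lp_scale (a * b) u.
Proof. by elim/Lp_elim: u => f; rewrite !Lp_scaleE scalerA. Qed.

Lemma Lp_scale1 : left_id 1 Lp_scale.
Proof. by elim/Lp_elim => f; rewrite Lp_scaleE scale1r. Qed.

Lemma Lp_scaleDr : right_distributive Lp_scale +%R.
Proof.
move=> a; elim/Lp_elim => f; elim/Lp_elim => g.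
by rewrite -pi_LpD !Lp_scaleE scalerDr pi_LpD.
Qed.

Lemma Lp_scaleDl (u : Lp) : {morph Lp_scale^~ u : a b / a + b}.
Proof.
move=> a b; elim/Lp_elim: u => f.
by rewrite !Lp_scaleE scalerDl pi_LpD.
Qed.

HB.instance Definition _ := GRing.Zmodule_isLmodule.Build R Lp
  Lp_scaleA Lp_scale1 Lp_scaleDr Lp_scaleDl.

Definition Lp_qnorm (u : Lp) : R := Lp_norm p (Lp_repr u).

Lemma Lp_integral_ae f g :
  f = g %[ae mu in Rplus] -> Lp_integral p f = Lp_integral p g.
Proof.
have FF : Filter (almost_everywhere mu) by exact: ae_filter_ringOfSetsType.
move=> fg; rewrite unlock; apply: ae_eq_integral.
- exact: measurable_Rplus.
- by apply: Lp_integrand_measurable; exact: Lp_function_measurable.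
- by apply: Lp_integrand_measurable; exact: Lp_function_measurable.
by apply: filterS fg => x fg Rx; rewrite fg.
Qed.

Lemma Lp_qnorm_pi f : Lp_qnorm (\pi_Lp f) = Lp_norm p f.
Proof.
rewrite /Lp_qnorm /Lp_norm; congr (fine _ `^ _); apply: Lp_integral_ae.
by apply/Lp_eqP; rewrite reprK.
Qed.

Lemma Lp_norm_EFin f : (Lp_norm p f)%:E = (Lp_integral p f `^ p^-1)%E.
Proof.
rewrite /Lp_norm -poweR_EFin fineK// ge0_fin_numE ?Lp_integral_ge0//.
exact: Lp_function_lty.
Qed.

Lemma Lp_qnormD (u v : Lp) : Lp_qnorm (u + v) <= Lp_qnorm u + Lp_qnorm v.
Proof.
elim/Lp_elim: u => f; elim/Lp_elim: v => g.
have -> : Lp_qnorm (\pi_Lp f + \pi_Lp g) = Lp_norm p (f + g : Lp_function).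
  by rewrite -Lp_qnorm_pi; congr Lp_qnorm; rewrite pi_LpD.
rewrite (Lp_qnorm_pi f) (Lp_qnorm_pi g) -lee_fin EFinD.
rewrite (Lp_norm_EFin f) (Lp_norm_EFin g) (Lp_norm_EFin (f + g)).
exact: (Lp_minkowski p1 (Lp_function_measurable f) (Lp_function_measurable g)).
Qed.

Lemma Lp_qnormZ (a : R) (u : Lp) : Lp_qnorm (a *: u) = `|a| * Lp_qnorm u.
Proof.
elim/Lp_elim: u => f.
have -> : a *: \pi_Lp f = \pi_Lp (a *: f).
  exact: Lp_scaleE.
have p0 : 0 < p by exact: lt_le_trans p1.
rewrite !Lp_qnorm_pi /Lp_norm Lp_integralZ; last exact: Lp_function_measurable.
rewrite fineM//; last first.
  by rewrite ge0_fin_numE ?Lp_integral_ge0//; exact: Lp_function_lty.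
rewrite powRM//= ?powR_ge0 ?fine_ge0 ?Lp_integral_ge0//.
by rewrite -powRrM mulfV ?gt_eqF// powRr1.
Qed.

Lemma Lp_qnorm0_eq0 (u : Lp) : Lp_qnorm u = 0 -> u = 0.
Proof.
have FF : Filter (almost_everywhere mu) by exact: ae_filter_ringOfSetsType.
have p0 : 0 < p by exact: lt_le_trans p1.
elim/Lp_elim: u => f; rewrite Lp_qnorm_pi => f0.
have {f0} If0 : Lp_integral p f = 0%E.
  apply: (@poweR_eq0_eq0 _ _ p^-1); first exact: Lp_integral_ge0.
  by rewrite -Lp_norm_EFin f0.
rewrite -pi_Lp0; apply/eqP/Lp_eqP.
have : ae_eq mu Rplus (fun x => (`|f x| `^ p)%:E) (cst 0%E).
  apply/ae_eq_integral_abs.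
  - exact: measurable_Rplus.
  - by apply: Lp_integrand_measurable; exact: Lp_function_measurable.
  rewrite -[RHS]If0 unlock; apply: eq_integral => x _.
  by rewrite gee0_abs// lee_fin powR_ge0.
apply: filterS => x fx Rx; have [] := fx Rx.
by move=> /powR_eq0_eq0/normr0_eq0 ->.
Qed.

HB.instance Definition _ := Lmodule_isNormed.Build R Lp
  Lp_qnormD Lp_qnormZ Lp_qnorm0_eq0.

End Lp_space.

Section sobolev.
Context {R : realType} {E : normedModType R} {p : R} {p1 : 1 <= p}.
Notation mu := (@lebesgue_measure R).

(* C^oo functions with compact support in the open half-line ]0, +oo[. *)
Definition test_function (phi : R -> R) :=
  (forall n x, derivable (phi^`(n))%classic x 1) /\
  exists a b, 0 < a /\ forall x, x \notin `[a, b] -> phi x = 0.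

(* f belongs to W^{1,p}(R_+; E) and df/ds = f'. *)
Definition weak_derivative (f f' : Lp E p1) :=
  forall phi, test_function phi -> exists v,
    is_bochner_integral (fun s => (phi^`())%classic s *: Lp_repr f s) v /\
    is_bochner_integral (fun s => phi s *: Lp_repr f' s) (- v).

(* e is the value at 0 of the continuous representative of f. *)
Definition is_delta0 (f : Lp E p1) (e : E) :=
  exists h : R -> E, [/\ {within Rplus, continuous h},
    Lp_repr f = h %[ae mu in Rplus] & h 0 = e].

End sobolev.

Section semigroups.
Context {R : realType}.

Definition opnorm {X Y : normedModType R} (S : X -> Y) : \bar R :=
  ereal_sup [set (`|S x|)%:E | x in [set x | `|x| <= 1]].

(* An unbounded operator is given by its graph: A (x, y) means that x is in
   D(A) and A x = y. *)
Definition operator (X : normedModType R) := set (X * X).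

Definition operator_add {X : normedModType R} (A B : operator X) : operator X :=
  [set xy | exists a b, [/\ A (xy.1, a), B (xy.1, b) & xy.2 = a + b]].

Definition operator_closure {X : normedModType R} (A : operator X) :
  operator X := closure A.

Record C0_semigroup {X : normedModType R} (T : R -> X -> X) : Prop := {
  C0_linear : forall t, 0 <= t -> linear (T t) ;
  C0_bounded : forall t, 0 <= t -> continuous (T t) ;
  C0_id : T 0 = id ;
  C0_add : forall s t, 0 <= s -> 0 <= t -> T (s + t) = T s \o T t ;
  C0_continuous : forall x, {within `[0, +oo[, continuous (fun t => T t x)} }.

Definition generator {X : normedModType R} (T : R -> X -> X) : operator X :=
  [set xy | h^-1 *: (T h xy.1 - xy.1) @[h --> 0^'+] --> xy.2].

Definition generates {X : normedModType R} (A : operator X)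
  (T : R -> X -> X) := C0_semigroup T /\ A = generator T.

Section splittings.
Context {X : normedModType R} (S1 S2 : R -> X -> X) (t : R) (n : nat).

Definition sequential_splitting : X -> X :=
  iter n (S2 (t / n%:R) \o S1 (t / n%:R)).

Definition strang_splitting : X -> X :=
  iter n (S1 (t / (2 * n)%:R) \o S2 (t / n%:R) \o S1 (t / (2 * n)%:R)).

Definition weighted_splitting : X -> X := fun x =>
  (2 ^+ n)^-1 *: iter n (fun y => S1 (t / n%:R) (S2 (t / n%:R) y) +
                                  S2 (t / n%:R) (S1 (t / n%:R) y)) x.

End splittings.

End semigroups.

Section operator_matrices.
Context {R : realType} {E : normedModType R} {p : R} (p1 : 1 <= p).
Notation F := (Lp E p1).

Definition calA1 (A1 : operator E) : operator (E * F * F)%type :=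
  [set uv | let: ((x, f, g), (y, f', g')) := uv in
    exists a e, [/\ A1 (x, a), is_delta0 f e, y = a + e,
                    weak_derivative f f' & g' = 0]].

Definition calA2 (A2 : operator E) : operator (E * F * F)%type :=
  [set uv | let: ((x, f, g), (y, f', g')) := uv in
    exists a e, [/\ A2 (x, a), is_delta0 g e, y = a + e,
                    f' = 0 & weak_derivative g g']].

End operator_matrices.

Arguments calA1 {R E p} p1 A1.
Arguments calA2 {R E p} p1 A2.

(* Main.v *)
From HB Require Import structures.
Require Import Defs.
From mathcomp Require Import all_boot all_order all_algebra.
From mathcomp Require Import all_classical all_reals all_analysis.
From mathcomp Require Import finmap measurable_realfun ring lra.
Import Order.TTheory GRing.Theory Num.Theory.
Import numFieldNormedType.Exports.

(** A step of the first matrix semigroup maps [(x, f, g)] to a triple whose first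
    component is [T1 h x] plus a term fed by the values of [f] on [0, h), whose
    second component is [f] translated to the left by [h], and whose third is
    [g]; the second semigroup does the same with [f] and [g] exchanged.  A scheme
    with [n] steps therefore uses every part of [f] and [g] once: the errors made
    by replacing it, in the first component, by the corresponding scheme on [E]
    add up to a multiple of the L^1 norms of [f] and [g] on [0, n h), which are
    at most [1 + n h] times their L^p norms.  Propagated by the powers of the
    scheme on [E], which are bounded by hypothesis, they stay below an
    exponential in [n h].  This is [split_step_iter], and
    [split_step_power_bounded] puts it in exponential form.  The symmetric scheme
    has the powers of the sequential one up to its first and last half step
    ([strang_power_bounded]).

    The matrix semigroups are given by their generators only, so the description
    of a step has to be derived.  It is stated as inequalities that are
    continuous in [(x, f, g)] ([boundary_step]) and proved on the domain, which
    is dense ([generator_dense]) because L^p is complete ([Lp_seq_complete]).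
    There the orbit remains in the domain, its second component [f s] has the
    weak derivative of [f s] as derivative in [s], and a pairing with a test
    function that travels to the right is constant ([transported_pairing]);
    narrow bumps then show that [f s] is a translate of [f 0] ([path_is_shift]).
    Consequently the first component solves an inhomogeneous equation with known
    right-hand side, and the mean value inequality bounds its distance to the
    orbit of [T1] ([inhomogeneous_bound]).

    Convergence is the Chernoff product formula ([chernoff]): a scheme with
    bounded powers converges to a semigroup as soon as its derivative at 0 is the
    generator on a core.  The intersection of the two domains is a core by
    hypothesis, and the derivative there is a sum of the two generators by the
    product rule ([consistent_comp], [consistent_average]).  The formula is proved
    without resolvents, by comparing the powers with a polygon of points of the
    core close to the exact orbit. *)

Set Implicit Arguments.
Unset Strict Implicit.
Unset Printing Implicit Defensive.
Local Open Scope classical_set_scope.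
Local Open Scope ring_scope.

(** * One-sided derivatives *)

Section elementary.
Context {R : realType}.
Implicit Types (X Y : normedModType R) (a b s t e d h : R).

(** Continuity on an interval and one-sided derivatives are used below only
    through these epsilon-delta forms, which make the increments explicit. *)
Definition continuous_at_in X (u : R -> X) (D : set R) s :=
  forall e, 0 < e -> exists2 d : R, 0 < d &
    forall r, D r -> `|r - s| < d -> `|u r - u s| < e.

Definition right_derivative X (u : R -> X) s (v : X) :=
  forall e, 0 < e -> exists2 d : R, 0 < d &
    forall h, 0 < h -> h < d -> `|u (s + h) - u s - h *: v| <= e * h.

Lemma continuous_at_inS X (u : R -> X) (D D' : set R) s : D `<=` D' ->
  continuous_at_in u D' s -> continuous_at_in u D s.
Proof.
by move=> DD cu e e0; have [d d0 Hd] := cu e e0; exists d => // r /DD; exact: Hd.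
Qed.

Lemma continuous_at_in_le X Y (u : R -> X) (w : R -> Y) (D : set R) s :
  (forall r, `|w r - w s| <= `|u r - u s|) ->
  continuous_at_in u D s -> continuous_at_in w D s.
Proof.
move=> wu cu e e0; have [d d0 Hd] := cu e e0; exists d => // r Dr rs.
exact: le_lt_trans (wu r) (Hd r Dr rs).
Qed.

Lemma right_derivative_le X Y (u : R -> X) (w : R -> Y) s v z :
  (forall h, `|w (s + h) - w s - h *: z| <= `|u (s + h) - u s - h *: v|) ->
  right_derivative u s v -> right_derivative w s z.
Proof.
move=> wu du e e0; have [d d0 Hd] := du e e0; exists d => // h h0 hd.
exact: le_trans (wu h) (Hd h h0 hd).
Qed.

Lemma segment_Rplus b : `[0, b] `<=` @Rplus R.
Proof. by move=> x; rewrite /Rplus/= !in_itv/= => /andP[->]. Qed.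

Lemma within_continuousP X (u : R -> X) (D : set R) :
  {within D, continuous u} <-> (forall s, D s -> continuous_at_in u D s).
Proof.
split.
  move=> /subspace_continuousP uD s Ds e e0.
  have /cvgrPdist_lt /(_ e e0) := uD s Ds.
  rewrite near_withinE => /nbhs_ballP[d d0 Hd]; exists d => // r Dr rs.
  rewrite distrC; apply: Hd => //; rewrite /ball/= distrC; exact: rs.
move=> uD; apply/subspace_continuousP => s Ds.
apply/cvgrPdist_lt => e e0; rewrite near_withinE.
have [d d0 Hd] := uD s Ds e e0; apply/nbhs_ballP; exists d => // r rs Dr.
by rewrite distrC; apply: Hd => //; rewrite distrC.
Qed.

Lemma cvg_at_right0P X (f : R -> X) (l : X) :
  f h @[h --> 0^'+] --> l <-> (forall e, 0 < e -> exists2 d : R, 0 < d &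
    forall h, 0 < h -> h < d -> `|f h - l| <= e).
Proof.
split.
  move=> /cvgrPdist_le fl e e0; have := fl e e0.
  rewrite near_withinE => /nbhs_ballP[d d0 Hd]; exists d => // h h0 hd.
  by rewrite distrC; apply: Hd => //; rewrite /ball/= sub0r normrN gtr0_norm.
move=> H; apply/cvgrPdist_le => e e0; rewrite near_withinE.
have [d d0 Hd] := H e e0; apply/nbhs_ballP; exists d => // h.
rewrite /ball/= sub0r normrN => hd h0; rewrite distrC; apply: Hd => //.
by rewrite gtr0_norm in hd.
Qed.

Lemma right_derivativeP X (u : R -> X) s (v : X) :
  right_derivative u s v <-> h^-1 *: (u (s + h) - u s) @[h --> 0^'+] --> v.
Proof.
have E h : 0 < h -> `|h^-1 *: (u (s + h) - u s) - v| =
    h^-1 * `|u (s + h) - u s - h *: v|.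
  move=> h0; have {2}<- : `|h^-1| = h^-1 by rewrite gtr0_norm// invr_gt0.
  by rewrite -normrZ [in RHS]scalerBr scalerA mulVf ?gt_eqF// scale1r.
split=> H.
  apply/cvg_at_right0P => e e0; have [d d0 Hd] := H e e0.
  exists d => // h h0 hd; rewrite E// ler_pdivrMl// mulrC; exact: Hd.
move/cvg_at_right0P : H => H e e0; have [d d0 Hd] := H e e0.
exists d => // h h0 hd.
by have := Hd h h0 hd; rewrite E// ler_pdivrMl// mulrC.
Qed.

(** The points up to which [k] stays below a line of slope [e] form an interval
    that continuity closes and the growth condition extends to the right. *)
Lemma le_right_growth (k : R -> R) a b : a <= b ->
  (forall s, a <= s <= b -> continuous_at_in k `[a, b] s) ->
  (forall s, a <= s < b -> forall e, 0 < e -> exists2 d : R, 0 < d &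
     forall h, 0 < h -> h < d -> k (s + h) <= k s + e * h) ->
  k b <= k a.
Proof.
move=> ab ck kr; apply/ler_addgt0Pr => e0 e00.
have e1 : 0 < b - a + 1 by lra.
set e := e0 / (b - a + 1); have ep : 0 < e by exact: divr_gt0.
suff : k b <= k a + e * (b - a).
  move/le_trans; apply; rewrite lerD2l /e mulrAC ler_pdivrMr//.
  by rewrite ler_wpM2l ?ltW//; lra.
pose good s := forall r, a <= r <= s -> k r <= k a + e * (r - a).
pose S := [set s | a <= s <= b /\ good s].
have Sa : S a.
  split; first by rewrite lexx.
  by move=> r /andP[ar ra]; rewrite (le_anti (_ : a <= r <= a)) ?subrr ?mulr0 ?addr0//; apply/andP.
have Sub : ubound S b by move=> s [/andP[]].
have hsS : has_sup S by split; [exists a|exists b].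
set c := sup S.
have ac : a <= c by exact: (sup_upper_bound hsS Sa).
have cb : c <= b by exact: (ge_sup (ex_intro _ a Sa) Sub).
have lc r : a <= r < c -> k r <= k a + e * (r - a).
  move=> /andP[ar rc]; have [s [_ gs] rs] := sup_gt (ex_intro _ a Sa) rc.
  by apply: gs; rewrite ar ltW.
have kc : k c <= k a + e * (c - a).
  have [->|ac'] := eqVneq c a; first by rewrite subrr mulr0 addr0.
  have {ac'}ac' : a < c by rewrite lt_neqAle eq_sym ac' ac.
  apply/ler_addgt0Pr => z z0.
  have [|d d0 Hd] := ck c _ z z0; first by rewrite ac cb.
  pose r := Num.max a (c - d / 2).
  have rc : r < c by rewrite /r gt_max ac'/=; lra.
  have ar : a <= r by rewrite /r le_max lexx.
  have : `|k r - k c| < z.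
    apply: Hd; first by rewrite /= in_itv/= ar/= (le_trans (ltW rc)).
    have : c - d / 2 <= r by rewrite /r le_max lexx orbT.
    by move=> ?; rewrite ltr_norml; apply/andP; split; lra.
  rewrite ltr_norml => /andP[kz _].
  have := lc r; rewrite ar rc => /(_ isT) kr'.
  have : e * (r - a) <= e * (c - a) by rewrite ler_wpM2l ?ltW//; lra.
  lra.
have gc : good c.
  move=> r /andP[ar]; rewrite le_eqVlt => /predU1P[->//|rc].
  by apply: lc; rewrite ar.
have [cb'|bc] := ltP c b; last first.
  by have -> : b = c by apply: le_anti; rewrite bc cb.
have [|d d0 Hd] := kr c _ e ep; first by rewrite ac.
pose h := Num.min (d / 2) (b - c).
have h0 : 0 < h by rewrite /h lt_min; apply/andP; split; lra.
have hd : h < d by rewrite /h gt_min; apply/orP; left; lra.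
have hb : h <= b - c by rewrite /h ge_min lexx orbT.
have : S (c + h).
  split; first by apply/andP; split; lra.
  move=> r /andP[ar rh]; have [rc|cr] := leP r c; first by apply: gc; rewrite ar.
  have := Hd (r - c); rewrite subr_gt0 => /(_ cr).
  rewrite (_ : c + (r - c) = r); last by ring.
  move=> /(_ ltac:(lra)); move/le_trans; apply.
  have -> : e * (r - a) = e * (c - a) + e * (r - c) by ring.
  by have := kc; lra.
move=> /(sup_upper_bound hsS); rewrite -/c; lra.
Qed.

(** The mean value inequality in the form that vector-valued functions admit:
    no primitive of the derivative of [w] is needed, only a real function [g]
    that grows at least as fast.  One-sided derivatives suffice, which is all
    that a generator provides. *)
Lemma mean_value_right X (w : R -> X) (g : R -> R) a b : a <= b ->
  (forall s, a <= s <= b -> continuous_at_in w `[a, b] s) ->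
  (forall s, a <= s <= b -> continuous_at_in g `[a, b] s) ->
  (forall s, a <= s < b -> forall e, 0 < e -> exists2 d : R, 0 < d &
     forall h, 0 < h -> h < d ->
       `|w (s + h) - w s| <= g (s + h) - g s + e * h) ->
  `|w b - w a| <= g b - g a.
Proof.
move=> ab cw cg wg.
suff : `|w b - w a| - g b <= `|w a - w a| - g a by rewrite subrr normr0; lra.
apply: (@le_right_growth (fun r => `|w r - w a| - g r)) => // s sab e e0.
  have e2 : 0 < e / 2 by lra.
  have [d1 d10 H1] := cw s sab _ e2; have [d2 d20 H2] := cg s sab _ e2.
  exists (Num.min d1 d2) => [|r rab]; first by rewrite lt_min d10.
  rewrite lt_min => /andP[/(H1 _ rab) wr /(H2 _ rab)].
  have := ler_dist_dist (w r - w a) (w s - w a).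
  rewrite opprB addrA subrK => /le_lt_trans /(_ wr).
  rewrite !ltr_norml => /andP[h1 h2] /andP[h3 h4].
  by apply/andP; split; lra.
have [d d0 Hd] := wg s sab e e0; exists d => // h h0 hd.
have := Hd h h0 hd; have := ler_normD (w (s + h) - w s) (w s - w a).
rewrite addrA subrK; lra.
Qed.

Lemma right_derivative0_cst X (w : R -> X) a b : a <= b ->
  (forall s, a <= s <= b -> continuous_at_in w `[a, b] s) ->
  (forall s, a <= s < b -> right_derivative w s 0) -> w b = w a.
Proof.
move=> ab cw w0; apply/eqP; rewrite -subr_eq0 -normr_le0.
rewrite -[leRHS](subrr 0).
apply: (@mean_value_right _ _ (cst 0) a b) => // s sab e e0.
  by exists 1 => // r _ _; rewrite subrr normr0.
have [d d0 Hd] := w0 s sab e e0; exists d => // h h0 hd.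
by have := Hd h h0 hd; rewrite scaler0 !subr0 add0r.
Qed.

Lemma continuous_uniform_segment X (u : R -> X) a b e : 0 < e ->
  (forall s, a <= s <= b -> continuous_at_in u `[a, b] s) ->
  exists2 d : R, 0 < d & forall r s, a <= r <= b -> a <= s <= b ->
    `|r - s| < d -> `|u r - u s| <= e.
Proof.
move=> e0 cu; have /compact_near_coveringP cK := @segment_compact R a b.
pose P d r := a <= r <= b -> forall s, a <= s <= b -> `|r - s| < d -> `|u r - u s| <= e.
have : \forall d \near 0^'+, `[a, b] `<=` P d.
  apply: cK => x /=; rewrite in_itv/= => xab.
  have [|d d0 Hd] := cu x xab (e / 2); first by lra.
  exists (ball x (d / 2), [set q | q < d / 2]) => /=.
    split; first by apply: nbhsx_ballx; lra.
    by apply: nbhs_right_lt; lra.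
  move=> [r q] /= [xr qd] rab s sab rs; rewrite -ball_normE/= distrC in xr.
  have sx : `|s - x| < d by have := ler_distD r s x; rewrite (distrC s r); lra.
  have := ler_normB (u r - u x) (u s - u x); rewrite opprB addrA subrK.
  have := Hd s; have := Hd r; rewrite /= !in_itv/= rab sab.
  by move=> /(_ isT (ltac:(lra))) + /(_ isT sx); lra.
rewrite near_withinE => /nbhs_ballP[d /= d0 Hd].
have d2 : 0 < d / 2 by rewrite divr_gt0.
exists (d / 2) => // r s rab sab rs; apply: (Hd _ _ d2) => //.
by rewrite /ball/= sub0r normrN gtr0_norm//; lra.
Qed.

End elementary.

(** * The integral of simple functions *)

Section simple_integral_theory.
Context {R : realType}.
Notation mu := (@lebesgue_measure R).
Implicit Types (E F : normedModType R).

Definition level_mass E (s : R -> E) (y : E) : R :=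
  fine (mu (Rplus `&` s @^-1` [set y])).

Lemma simple_fun_comp E F (g : E -> F) (s : R -> E) :
  simple_fun s -> simple_fun (g \o s).
Proof. by move=> hs; exact: (simple_fun_comp2 (fun u _ => g u) hs hs). Qed.

Lemma simple_fun_pair E F (s : R -> E) (t : R -> F) :
  simple_fun s -> simple_fun t -> simple_fun (fun x => (s x, t x)).
Proof.
move=> hs ht; pose op (u v : E * F) : (E * F)%type := (u.1, v.2).
exact: (simple_fun_comp2 op (simple_fun_comp (fun u => (u, 0)) hs)
  (simple_fun_comp (pair 0) ht)).
Qed.

Lemma simple_funD E (s t : R -> E) :
  simple_fun s -> simple_fun t -> simple_fun (s + t).
Proof. exact: (simple_fun_comp2 (fun u v => u + v)). Qed.

Lemma simple_funB E (s t : R -> E) :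
  simple_fun s -> simple_fun t -> simple_fun (s - t).
Proof. exact: (simple_fun_comp2 (fun u v => u - v)). Qed.

Lemma measurable_level E (s : R -> E) y : simple_fun s ->
  measurable (Rplus `&` s @^-1` [set y]).
Proof. by move=> [_ ms]; apply: measurableI => //; exact: measurable_Rplus. Qed.

Lemma simple_fun_restrict E (A : set R) (s : R -> E) : measurable A ->
  simple_fun s -> simple_fun (fun x => if `[< A x >] then s x else 0).
Proof.
move=> mA [fs ms]; split.
  apply: (@sub_finite_set _ _ (range s `|` [set 0])) => [_ [x _ <-]/=|].
    by case: asboolP; [left; exists x|right].
  by rewrite finite_setU; split.
move=> y.
have -> : (fun x => if `[< A x >] then s x else 0) @^-1` [set y] =
    (A `&` s @^-1` [set y]) `|` (~` A `&` [set _ | y = 0]).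
  apply/seteqP; split=> x /=.
    by case: asboolP => Ax <-; [left|right].
  by case=> -[Ax ->]; case: asboolP.
apply: measurableU; apply: measurableI => //; first exact: measurableC.
have [->|y0] := pselect (y = 0).
  by rewrite (_ : [set _ | _] = setT)//; apply/seteqP; split.
by rewrite (_ : [set _ | _] = set0)//; apply/seteqP; split.
Qed.

(** The contributions of the values of [z] that [g] identifies add up; the
    value 0 may carry infinite mass but contributes nothing. *)
Lemma simple_integral_comp E F (g : E -> F) (z : R -> E) : simple_fun z ->
  (forall v, g v != 0 -> (mu (Rplus `&` z @^-1` [set v]) < +oo)%E) ->
  simple_integral (g \o z) = \sum_(v <- fset_set (range z)) level_mass z v *: g v.
Proof.
move=> sz zfin; have sgz := simple_fun_comp g sz.
have [fz mz] := sz; have [fgz mgz] := sgz.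
rewrite /simple_integral fsbig_finite//=.
have lev y : y != 0 -> level_mass (g \o z) y =
    \sum_(v <- fset_set (range z) | g v == y) level_mass z v.
  move=> y0; rewrite /level_mass.
  have -> : Rplus `&` (g \o z) @^-1` [set y] = \bigcup_(v in range z)
      (if g v == y then Rplus `&` z @^-1` [set v] else set0).
    apply/seteqP; split=> x /=.
      by move=> [Rx gy]; exists (z x); [exists x|rewrite gy eqxx].
    by move=> [v _]; case: eqP => // gv [Rx /= zv]; rewrite zv.
  rewrite measure_fin_bigcup//; last 2 first.
  - by move=> v w _ _ [x []]; do 2 case: ifP => // _; move=> [_ /= <-] [_ /= <-].
  - by move=> v _; case: ifP => // _; exact: measurable_level.
  rewrite fsbig_finite//= [RHS]big_mkcond/= -sum_fine; last first.
    move=> v _; case: ifP => [/eqP gv|_]; last by rewrite measure0.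
    by rewrite ge0_fin_numE//; apply: zfin; rewrite gv.
  by apply: eq_bigr => v _; case: ifP => _; rewrite ?measure0.
rewrite (eq_bigr (fun y =>
   \sum_(v <- fset_set (range z)) (if g v == y then level_mass z v *: g v else 0))); last first.
  move=> y _; have [->|y0] := eqVneq y 0.
    by rewrite scaler0 big1// => v _; case: eqP => // ->; rewrite scaler0.
  rewrite -/(level_mass _ _) lev// scaler_suml [LHS]big_mkcond/=.
  by apply: eq_bigr => v _; case: eqP => // ->.
rewrite exchange_big/=; apply: eq_big_seq => v vz.
rewrite -big_mkcond/= (big_rem (g v))/=; last first.
  rewrite in_fset_set//; apply/mem_set.
  by move: vz; rewrite in_fset_set// => /set_mem[x _ <-]; exists x.
rewrite eqxx big1_seq ?addr0// => y /andP[/eqP <-].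
by rewrite mem_rem_uniq ?fset_uniq// inE eqxx.
Qed.

Definition int_norm E (f : R -> E) : \bar R :=
  (\int[mu]_(x in Rplus) (`|f x|)%:E)%E.

Lemma simple_strongly_measurable E (s : R -> E) :
  simple_fun s -> strongly_measurable s.
Proof. by move=> ss; exists (fun=> s); split => // x; exact: cvg_cst. Qed.

Lemma strongly_measurableN E (f : R -> E) :
  strongly_measurable f -> strongly_measurable (- f).
Proof. by rewrite -scaleN1r; exact: strongly_measurableZ. Qed.

Lemma strongly_measurableB E (f g : R -> E) : strongly_measurable f ->
  strongly_measurable g -> strongly_measurable (f - g).
Proof.
by move=> mf mg; apply: strongly_measurableD => //; exact: strongly_measurableN.
Qed.

Lemma measurable_EFin_norm E (f : R -> E) (D : set R) :
  strongly_measurable f -> measurable_fun D (fun x => (`|f x|)%:E).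
Proof.
move=> mf; apply/measurable_EFinP; apply: (measurable_funS measurableT) => //.
exact: strongly_measurable_norm.
Qed.

Lemma int_norm_ge0 E (f : R -> E) : (0 <= int_norm f)%E.
Proof. by apply: integral_ge0 => x _; rewrite lee_fin. Qed.

Lemma le_int_norm E F (f : R -> E) (g : R -> F) :
  strongly_measurable f -> strongly_measurable g ->
  (forall x, Rplus x -> `|f x| <= `|g x|) -> (int_norm f <= int_norm g)%E.
Proof.
move=> mf mg fg; apply: ge0_le_integral => //.
- exact: measurable_Rplus.
- exact: measurable_EFin_norm.
- exact: measurable_EFin_norm.
Qed.

Lemma int_normN E (f : R -> E) : int_norm (- f) = int_norm f.
Proof. by apply: eq_integral => x _; rewrite normrN. Qed.

Lemma int_normZ E (a : R) (f : R -> E) : strongly_measurable f ->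
  int_norm (a *: f) = (`|a|%:E * int_norm f)%E.
Proof.
move=> mf; rewrite /int_norm -ge0_integralZl_EFin//.
- by apply: eq_integral => x _; rewrite -EFinM -normrZ.
- exact: measurable_Rplus.
- exact: measurable_EFin_norm.
Qed.

Lemma int_normD E (f g : R -> E) : strongly_measurable f ->
  strongly_measurable g -> (int_norm (f + g)%R <= int_norm f + int_norm g)%E.
Proof.
move=> mf mg; rewrite /int_norm -ge0_integralD//; last 3 first.
- exact: measurable_Rplus.
- exact: measurable_EFin_norm.
- exact: measurable_EFin_norm.
apply: ge0_le_integral => //.
- exact: measurable_Rplus.
- by apply: measurable_EFin_norm; exact: strongly_measurableD.
- by apply: emeasurable_funD; exact: measurable_EFin_norm.
- by move=> x Rx; rewrite -EFinD lee_fin ler_normD.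
Qed.

Lemma int_norm_simple E (s : R -> E) : simple_fun s ->
  int_norm s = (\sum_(y <- fset_set (range s))
    (mu (Rplus `&` s @^-1` [set y]) * `|y|%:E))%E.
Proof.
move=> ss; have [fs ms] := ss.
rewrite -fsbig_finite//= /int_norm.
under [LHS]eq_integral => x _.
  have -> : (`|s x|%:E = \sum_(y \in range s) (`|y| * \1_(s @^-1` [set y]) x)%:E)%E.
    rewrite fsbig_finite//= (big_rem (s x))/=; last first.
      by rewrite in_fset_set//; apply/mem_set; exists x.
    rewrite indicE mem_set//= mulr1 big1_seq ?addr0// => y.
    rewrite mem_rem_uniq ?fset_uniq// inE/= => /andP[ysx _].
    by rewrite indicE memNset ?mulr0//= => sxy; rewrite sxy eqxx in ysx.
  over.
have mi y : measurable_fun (@Rplus R) (fun x => (\1_(s @^-1` [set y]) x : R)%:E).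
  by apply/measurable_EFinP; apply: measurable_indic.
rewrite ge0_integral_fsum//; last 2 first.
- exact: measurable_Rplus.
- move=> y; apply/measurable_EFinP; apply: measurable_funM => //.
  by move: (mi y) => /measurable_EFinP.
apply: eq_fsbigr => y _; under eq_integral do rewrite EFinM.
rewrite ge0_integralZl_EFin//; last 2 first.
- exact: measurable_Rplus.
- exact: mi.
rewrite integral_indic//; first by rewrite muleC (setIC Rplus).
- exact: measurable_Rplus.
- exact: ms.
Qed.

Lemma int_norm_simple_fin E (s : R -> E) : integrable_simple_fun s ->
  int_norm s = (\sum_(y <- fset_set (range s)) level_mass s y * `|y|)%:E.
Proof.
move=> [ss sfin]; rewrite int_norm_simple// -sumEFin; apply: eq_bigr => y _.
have [->|y0] := eqVneq y 0; first by rewrite normr0 mulr0 mule0.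
by rewrite EFinM /level_mass fineK// ge0_fin_numE// sfin.
Qed.

Lemma integrable_simpleP E (s : R -> E) : simple_fun s ->
  integrable_simple_fun s <-> (int_norm s < +oo)%E.
Proof.
move=> ss; split => [/int_norm_simple_fin ->|]; first by rewrite ltry.
have [fs ms] := ss.
move=> sfin; split=> // y y0.
have [ys|ys] := pselect (range s y); last first.
  rewrite (_ : _ `&` _ = set0) ?measure0// -subset0 => x [_ /= sx].
  by apply: ys; exists x.
have : (mu (Rplus `&` s @^-1` [set y]) * `|y|%:E < +oo)%E.
  apply: le_lt_trans sfin; rewrite int_norm_simple//.
  rewrite (big_rem y)/=; last by rewrite in_fset_set//; apply/mem_set.
  by rewrite leeDl// sume_ge0// => z _; rewrite mule_ge0.
rewrite ltey; apply: contraTT; rewrite -leNgt leye_eq => /eqP ->.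
by rewrite gt0_mulye ?lte_fin ?normr_gt0// eqxx.
Qed.

Lemma simple_integralE E (s : R -> E) : integrable_simple_fun s ->
  simple_integral s = \sum_(y <- fset_set (range s)) level_mass s y *: y.
Proof. by move=> [ss sfin]; exact: (simple_integral_comp (g := id)). Qed.

Lemma simple_integral_le E (s : R -> E) : integrable_simple_fun s ->
  ((`|simple_integral s|)%:E <= int_norm s)%E.
Proof.
move=> is_; rewrite simple_integralE// int_norm_simple_fin// lee_fin.
apply: le_trans (ler_norm_sum _ _ _) _; apply: ler_sum => y _.
by rewrite normrZ ger0_norm// fine_ge0.
Qed.

Lemma simple_integral_norm E (s : R -> E) : integrable_simple_fun s ->
  (simple_integral (fun x => `|s x|))%:E = int_norm s.
Proof.
move=> is_; have [ss sfin] := is_; rewrite int_norm_simple_fin//.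
rewrite (simple_integral_comp (g := fun v => `|v|) ss)// => v.
by rewrite normr_eq0; exact: sfin.
Qed.

Lemma simple_integralZr E (s : R -> R) (e : E) : integrable_simple_fun s ->
  simple_integral (fun x => s x *: e) = simple_integral s *: e.
Proof.
move=> is_; have [ss sfin] := is_.
rewrite [in RHS]simple_integralE// [LHS](simple_integral_comp (g := fun v : R => v *: e) ss).
  by rewrite scaler_suml; apply: eq_bigr => v _; rewrite scalerA.
by move=> v; rewrite scaler_eq0 negb_or => /andP[v0 _]; exact: sfin.
Qed.

(** Both functions factor through the simple function of pairs, so additivity
    becomes an identity between sums over the levels of one function. *)
Lemma simple_integral_linear E (a : R) (s t : R -> E) :
  integrable_simple_fun s -> integrable_simple_fun t ->
  simple_integral (a *: s + t) = a *: simple_integral s + simple_integral t.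
Proof.
move=> [ss sfin] [st tfin].
have sz := simple_fun_pair ss st; set z := fun x => (s x, t x) in sz.
have zfin v : v != 0 -> (mu (Rplus `&` z @^-1` [set v]) < +oo)%E.
  case: v => v w vw.
  have [v0|v0] := eqVneq v 0; last first.
    apply: le_lt_trans (sfin _ v0); apply: le_measure.
    - by apply/mem_set; exact: measurable_level.
    - by apply/mem_set; exact: measurable_level.
    - by move=> x [Rx [/= sx tx]].
  have w0 : w != 0 by apply: contra vw => /eqP ->; rewrite v0.
  apply: le_lt_trans (tfin _ w0); apply: le_measure.
  - by apply/mem_set; exact: measurable_level.
  - by apply/mem_set; exact: measurable_level.
  - by move=> x [Rx [/= sx tx]].
have -> : a *: s + t = (fun v => a *: v.1 + v.2) \o z by [].
have -> : simple_integral s = simple_integral (fst \o z) by [].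
have -> : simple_integral t = simple_integral (snd \o z) by [].
rewrite !simple_integral_comp//; last 3 first.
- by move=> v v0; apply: zfin; apply: contra v0 => /eqP ->.
- by move=> v v0; apply: zfin; apply: contra v0 => /eqP ->.
- move=> v v0; apply: zfin; apply: contra v0 => /eqP ->.
  by rewrite scaler0 addr0.
rewrite scaler_sumr -big_split/=; apply: eq_bigr => v _.
by rewrite scalerDr !scalerA mulrC.
Qed.

Lemma integrable_simple_linear E (a : R) (s t : R -> E) :
  integrable_simple_fun s -> integrable_simple_fun t ->
  integrable_simple_fun (a *: s + t).
Proof.
move=> is_ it; have [ss _] := is_; have [st _] := it.
have sas : simple_fun (a *: s) by exact: (simple_fun_comp (fun u => a *: u) ss).
apply/integrable_simpleP; first exact: simple_funD.
apply: le_lt_trans (int_normD _ _) _; try exact: simple_strongly_measurable.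
rewrite int_normZ; last exact: simple_strongly_measurable.
rewrite lte_add_pinfty// ?lte_mul_pinfty// ?lee_fin//.
  by apply/integrable_simpleP.
by apply/integrable_simpleP.
Qed.

End simple_integral_theory.

(** * The Bochner integral *)

Section bochner_theory.
Context {R : realType}.
Notation mu := (@lebesgue_measure R).
Implicit Types (E F X Y : normedModType R).

(** Completeness is carried as a property, so that it passes to products. *)
Definition seq_complete X := forall u : nat -> X,
  (forall e : R, 0 < e -> exists N, forall m n, (N <= m)%N -> (N <= n)%N ->
     `|u m - u n| <= e) ->
  exists l : X, u n @[n --> \oo] --> l.

Lemma seq_complete_completeNormed (E : completeNormedModType R) : seq_complete E.
Proof.
move=> u cu; exists (lim (u @ \oo)); apply/cauchy_cvgP/cauchy_exP.
move=> e e0; have [N HN] := cu (e / 2) (ltac:(lra)).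
exists (u N); exists N => // n /= Nn; rewrite -ball_normE/=.
by apply: le_lt_trans (HN _ _ (leqnn N) Nn) _; lra.
Qed.

Lemma cvg_seqP X (u : nat -> X) (l : X) : u n @[n --> \oo] --> l <->
  (forall e : R, 0 < e -> exists N, forall n, (N <= n)%N -> `|u n - l| <= e).
Proof.
split=> [/cvgrPdist_le H e e0|H].
  by have [N _ HN] := H e e0; exists N => n Nn; rewrite distrC; exact: HN.
apply/cvgrPdist_le => e e0; have [N HN] := H e e0.
by exists N => // n Nn; rewrite distrC; exact: HN.
Qed.

Lemma cvg_pair X Y (u : nat -> X) (v : nat -> Y) l m :
  u n @[n --> \oo] --> l -> v n @[n --> \oo] --> m ->
  ((u n, v n) : (X * Y)%type) @[n --> \oo] --> ((l, m) : (X * Y)%type).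
Proof.
move=> /cvg_seqP ul /cvg_seqP vm; apply/cvg_seqP => e e0.
have [N HN] := ul e e0; have [M HM] := vm e e0.
exists (maxn N M) => n; rewrite geq_max => /andP[Nn Mn].
by rewrite prod_normE/= ge_max HN// HM.
Qed.

Lemma seq_complete_prod X Y :
  seq_complete X -> seq_complete Y -> seq_complete (X * Y)%type.
Proof.
move=> cX cY u cu.
have [|l ul] := cX (fst \o u).
  move=> e e0; have [N HN] := cu e e0; exists N => m n Nm Nn.
  by have := HN m n Nm Nn; rewrite prod_normE/= ge_max => /andP[].
have [|m um] := cY (snd \o u).
  move=> e e0; have [N HN] := cu e e0; exists N => k n Nm Nn.
  by have := HN k n Nm Nn; rewrite prod_normE/= ge_max => /andP[].
exists (l, m); have := cvg_pair ul um.
by under eq_fun do rewrite /= -surjective_pairing.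
Qed.

Lemma cvge0P (u : nat -> \bar R) : (forall n, 0 <= u n)%E ->
  u n @[n --> \oo] --> 0%E <->
  (forall e : R, 0 < e -> exists N, forall n, (N <= n)%N -> (u n <= e%:E)%E).
Proof.
move=> u0; split=> [ul e e0|H].
  have [[N _ HN] /cvg_seqP/(_ e e0)[M HM]] := (fine_cvgP _ _).1 ul.
  exists (maxn N M) => n; rewrite geq_max => /andP[Nn Mn].
  rewrite -(fineK (HN n Nn)) lee_fin; have := HM n Mn.
  by rewrite subr0; apply: le_trans; exact: ler_norm.
have [N HN] := H 1 ltr01.
apply/fine_cvgP; split.
  exists N => // n /= Nn; by rewrite ge0_fin_numE// (le_lt_trans (HN n Nn))// ltry.
apply/(@cvg_seqP R^o (fine \o u) 0) => e e0; have [M HM] := H e e0.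
exists (maxn N M) => n; rewrite geq_max => /andP[Nn Mn].
rewrite subr0 ger0_norm ?fine_ge0//.
have un : u n \is a fin_num.
  by rewrite ge0_fin_numE// (le_lt_trans (HN n Nn))// ltry.
by rewrite /= -lee_fin fineK// HM.
Qed.

Lemma bochner_norm_le E (f : R -> E) v :
  is_bochner_integral f v -> (`|v|%:E <= int_norm f)%E.
Proof.
move=> [mf [s_ [is_ fs sv]]].
have [fy|] := ltP (int_norm f) +oo%E; last by rewrite leye_eq => /eqP ->; rewrite leey.
have ff : int_norm f \is a fin_num by rewrite ge0_fin_numE// int_norm_ge0.
rewrite -(fineK ff) lee_fin; apply/ler_addgt0Pr => e e0.
have e2 : 0 < e / 2 by lra.
move/cvg_seqP : sv => /(_ _ e2)[N HN].
have [//|+ _] := @cvge0P (fun n => int_norm (f - s_ n)).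
  by move=> n; exact: int_norm_ge0.
move=> /(_ fs _ e2)[M HM]; pose n := maxn N M.
have {}HN := HN n (leq_maxl _ _); have {}HM := HM n (leq_maxr _ _).
have ms : strongly_measurable (s_ n) by apply: simple_strongly_measurable; case: (is_ n).
have : ((`|simple_integral (s_ n)|)%:E <= (fine (int_norm f) + e / 2)%:E)%E.
  apply: (le_trans (simple_integral_le (is_ n))).
  rewrite EFinD fineK//.
  have -> : s_ n = f + - (f - s_ n) by rewrite opprB addrC subrK.
  apply: (le_trans (int_normD _ _)) => //.
    by apply: strongly_measurableN; exact: strongly_measurableB.
  by rewrite int_normN leeD2l.
rewrite lee_fin => h; have := ler_normB (simple_integral (s_ n)) (simple_integral (s_ n) - v).
rewrite opprB addrC subrK; lra.
Qed.

Lemma bochner_linear E (a : R) (f g : R -> E) v w :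
  is_bochner_integral f v -> is_bochner_integral g w ->
  is_bochner_integral (a *: f + g) (a *: v + w).
Proof.
move=> [mf [s_ [is_ fs sv]]] [mg [t_ [it gt tw]]]; split.
  by apply: strongly_measurableD => //; exact: strongly_measurableZ.
have ms n : strongly_measurable (s_ n) by apply: simple_strongly_measurable; case: (is_ n).
have mt n : strongly_measurable (t_ n) by apply: simple_strongly_measurable; case: (it n).
exists (fun n => a *: s_ n + t_ n); split.
- by move=> n; exact: integrable_simple_linear.
- have B n : (int_norm ((a *: f + g) - (a *: s_ n + t_ n))%R <=
     `|a|%:E * int_norm (f - s_ n)%R + int_norm (g - t_ n)%R)%E.
    have -> : (a *: f + g) - (a *: s_ n + t_ n) = a *: (f - s_ n) + (g - t_ n).
      by rewrite scalerBr opprD addrACA.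
    have mfs := strongly_measurableB mf (ms n).
    have mgt := strongly_measurableB mg (mt n).
    by rewrite -int_normZ// int_normD//; exact: strongly_measurableZ.
  apply: (squeeze_cvge (f := cst 0%E) _ _ _ (h := fun n =>
    (`|a|%:E * int_norm (f - s_ n)%R + int_norm (g - t_ n)%R)%E)).
  + by apply: nearW => n; rewrite int_norm_ge0/=; exact: B.
  + exact: cvg_cst.
  + rewrite -[X in _ --> X](_ : (`|a|%:E * 0 + 0 = 0)%E); last by rewrite mule0 adde0.
    apply: cvgeD => //.
    by apply: cvgeZl.
- under eq_fun => n do rewrite simple_integral_linear//.
  by apply: cvgD => //; exact: cvgZl_tmp.
Qed.

Lemma bochner_unique E (f : R -> E) v w :
  is_bochner_integral f v -> is_bochner_integral f w -> v = w.
Proof.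
move=> fv fw; have /bochner_norm_le := bochner_linear (-1) fv fw.
have -> : -1 *: f + f = 0 by rewrite scaleN1r addNr.
have -> : int_norm (0 : R -> E) = 0%E.
  by apply: integral0_eq => x _; rewrite normr0.
rewrite lee_fin normr_le0 scaleN1r addrC subr_eq0 => /eqP ->//.
Qed.

(** Truncating where the approximant is more than twice as large as the limit
    keeps pointwise convergence and provides domination. *)
Lemma dominated_simple_approximation E (f : R -> E) : strongly_measurable f ->
  exists s_ : nat -> R -> E, [/\ forall n, simple_fun (s_ n),
    forall n x, `|s_ n x| <= 2 * `|f x| & forall x, s_ n x @[n --> \oo] --> f x].
Proof.
move=> mf; have [s_ [ss sf]] := mf.
pose A n := [set x | `|s_ n x| <= 2 * `|f x|].
pose t_ n x := if `[< A n x >] then s_ n x else 0.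
have mA n : measurable (A n).
  have -> : A n = (fun x => `|s_ n x| - 2 * `|f x|) @^-1` `]-oo, 0].
    by apply/seteqP; split=> x /=; rewrite in_itv/= subr_le0.
  rewrite -[_ @^-1` _]setTI.
  have m : measurable_fun setT (fun x => `|s_ n x| - 2 * `|f x|).
    apply: measurable_funB; first exact: simple_fun_norm_measurable.
    by apply: measurable_funM => //; exact: strongly_measurable_norm.
  exact: m.
exists t_; split.
- by move=> n; exact: simple_fun_restrict.
- move=> n x; rewrite /t_; case: asboolP => // _.
  by rewrite normr0 mulr_ge0.
- move=> x; apply/cvg_seqP => e e0.
  have /cvg_seqP sx := sf x.
  have [fx0|fx0] := eqVneq (f x) 0.
    exists 0%N => n _; rewrite /t_ /A/= fx0 normr0 mulr0 subr0; case: asboolP => [|_].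
      by move=> /le_trans; apply; exact: ltW.
    by rewrite normr0; exact: ltW.
  have fp : 0 < `|f x| by rewrite normr_gt0.
  have [N HN] := sx e e0; have [M HM] := sx _ fp.
  exists (maxn N M) => n; rewrite geq_max => /andP[Nn Mn].
  rewrite /t_; case: asboolP => [_|]; first exact: HN.
  case; rewrite /A/=; have := HM n Mn; have := ler_normD (s_ n x - f x) (f x).
  rewrite subrK; lra.
Qed.

(** Dominated convergence: the errors are at most [3 * `|f x|]. *)
Lemma simple_approximation_Lp E (p : R) (f : R -> E) : 1 <= p ->
  strongly_measurable f -> (Lp_integral p f < +oo)%E ->
  exists s_ : nat -> R -> E, [/\ forall n, simple_fun (s_ n),
    forall n x, `|s_ n x| <= 2 * `|f x| &
    Lp_integral p (f - s_ n) @[n --> \oo] --> 0%E].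
Proof.
move=> p1 mf fi; have [s_ [ss sf2 sf]] := dominated_simple_approximation mf.
have p0 : 0 < p by lra.
exists s_; split => //.
have mfs n : strongly_measurable (f - s_ n).
  by apply: strongly_measurableB => //; exact: simple_strongly_measurable.
rewrite unlock.
pose G x := ((3 `^ p)%:E * (`|f x| `^ p)%:E)%E.
have iG : mu.-integrable Rplus G.
  apply: integrableZl; first exact: measurable_Rplus.
  apply/integrableP; split; first exact: Lp_integrand_measurable.
  under eq_integral do rewrite gee0_abs ?lee_fin ?powR_ge0//.
  by move: fi; rewrite unlock.
have := @dominated_convergence _ _ _ mu Rplus measurable_Rplus
  (fun n x => (`|f x - s_ n x| `^ p)%:E) (cst 0%E) G.
case.
- by move=> n; exact: (Lp_integrand_measurable _ _ (f := f - s_ n)).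
- exact: measurable_cst.
- apply: nearW => x _; apply/cvge0P.
    by move=> n; rewrite lee_fin powR_ge0.
  move=> e e0; have /cvg_seqP/(_ (e `^ p^-1)) := sf x.
  case; first exact: powR_gt0.
  move=> N HN; exists N => n Nn; rewrite lee_fin distrC.
  have -> : e = (e `^ p^-1) `^ p by rewrite -powRrM mulVf ?gt_eqF// powRr1// ltW.
  by apply: ge0_ler_powR; rewrite ?nnegrE ?powR_ge0 ?(ltW p0)// HN.
- exact: iG.
- apply: nearW => x n _; rewrite gee0_abs ?lee_fin ?powR_ge0//.
  rewrite -powRM//; apply: ge0_ler_powR; rewrite ?nnegrE ?(ltW p0)//.
  by have := ler_normB (f x) (s_ n x); have := sf2 n x; lra.
- by move=> _ _; rewrite integral0.
Qed.

Lemma Lp_integral1 E (f : R -> E) : Lp_integral 1 f = int_norm f.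
Proof. by rewrite unlock; apply: eq_integral => x _; rewrite powRr1. Qed.

Lemma integrable_approximation E (f : R -> E) :
  strongly_measurable f -> (int_norm f < +oo)%E -> exists s_ : nat -> R -> E,
    (forall n, integrable_simple_fun (s_ n)) /\ forall e : R, 0 < e ->
      exists N, forall n, (N <= n)%N -> (int_norm (f - s_ n)%R <= e%:E)%E.
Proof.
move=> mf fi.
have [|s_ [ss sf2]] := simple_approximation_Lp (lexx 1) mf; first by rewrite Lp_integral1.
under eq_fun do rewrite Lp_integral1; move=> fs; exists s_; split => [n|].
  have ms : strongly_measurable (s_ n) by exact: simple_strongly_measurable.
  apply/integrable_simpleP => //; apply: (@le_lt_trans _ _ (int_norm (2 *: f))).
    apply: le_int_norm => //; first exact: strongly_measurableZ.
    by move=> x _; rewrite normrZ ger0_norm// sf2.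
  by rewrite int_normZ// lte_mul_pinfty// lee_fin.
by apply: (cvge0P (u := fun n => int_norm (f - s_ n)) _).1 => // n; exact: int_norm_ge0.
Qed.

Lemma bochner_exists E (f : R -> E) : seq_complete E ->
  strongly_measurable f -> (int_norm f < +oo)%E ->
  exists v, is_bochner_integral f v.
Proof.
move=> cE mf fi.
have [s_ [is_ fs]] := integrable_approximation mf fi.
have ms n : strongly_measurable (s_ n) by apply: simple_strongly_measurable; case: (is_ n).
have [|v sv] := cE (fun n => simple_integral (s_ n)).
  move=> e e0; have e2 : 0 < e / 2 by lra.
  have [N HN] := fs _ e2; exists N => m n Nm Nn.
  have <- : simple_integral (-1 *: s_ n + s_ m) = simple_integral (s_ m) - simple_integral (s_ n).
    by rewrite simple_integral_linear// scaleN1r addrC.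
  rewrite -lee_fin (le_trans (simple_integral_le _))//; first exact: integrable_simple_linear.
  have -> : -1 *: s_ n + s_ m = (f - s_ n) + - (f - s_ m).
    by rewrite opprB scaleN1r [RHS]addrC addrA subrK addrC.
  apply: (le_trans (int_normD _ _)).
  - exact: strongly_measurableB.
  - by apply: strongly_measurableN; exact: strongly_measurableB.
  rewrite int_normN; have -> : e = e / 2 + e / 2 by lra.
  by rewrite EFinD leeD// HN.
exists v; split => //; exists s_; split => //.
by apply/(@cvge0P (fun n => int_norm (f - s_ n))) => // n; exact: int_norm_ge0.
Qed.

(** For a scalar weight the vector integral is the Lebesgue integral; replacing
    approximants by their absolute values reduces this to [int_norm]. *)
Lemma bochner_scalar E (phi : R -> R) (e : E) :
  (forall x, Rplus x -> 0 <= phi x) -> @strongly_measurable R R^o phi ->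
  (int_norm (phi : R -> R^o) < +oo)%E ->
  is_bochner_integral (fun x => phi x *: e) (fine (int_norm (phi : R -> R^o)) *: e).
Proof.
move=> phi0 mphi phiy.
have [s_ [is_ fs]] := integrable_approximation mphi phiy.
have ss n : simple_fun (s_ n) by case: (is_ n).
have ms n : strongly_measurable (s_ n) by exact: simple_strongly_measurable.
have mpe : strongly_measurable (fun x => phi x *: e).
  have [u_ [us up]] := mphi; exists (fun n x => u_ n x *: e); split.
    by move=> n; exact: (simple_fun_comp (fun v : R^o => v *: e) (us n)).
  by move=> x; apply: cvgZr_tmp; exact: up.
have st n : @simple_fun R R^o (fun x => `|s_ n x|).
  exact: (simple_fun_comp (fun v : R^o => `|v| : R^o) (ss n)).
have it n : @integrable_simple_fun R R^o (fun x => `|s_ n x|).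
  apply/integrable_simpleP => //.
  have -> : int_norm (fun x => `|s_ n x| : R^o) = int_norm (s_ n).
    by apply: eq_integral => x _; rewrite normr_id.
  by apply/integrable_simpleP.
have ste n : simple_fun (fun x => `|s_ n x| *: e).
  exact: (simple_fun_comp (fun v : R^o => v *: e) (st n)).
split => //; exists (fun n x => `|s_ n x| *: e); split.
- move=> n; apply/integrable_simpleP => //.
  apply: (@le_lt_trans _ _ (int_norm (`|e| *: s_ n))).
    apply: le_int_norm.
    + exact: simple_strongly_measurable.
    + exact: strongly_measurableZ.
    + by move=> x _; rewrite !normrZ !normr_id mulrC.
  rewrite int_normZ// lte_mul_pinfty ?lee_fin//.
  by apply/integrable_simpleP.
- apply/cvge0P => [n|z z0]; first by apply: integral_ge0 => x _; rewrite lee_fin.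
  have e1 : 0 < `|e| + 1 by have := normr_ge0 e; lra.
  have [|N HN] := fs (z / (`|e| + 1)); first exact: divr_gt0.
  exists N => n Nn.
  have mps : strongly_measurable (phi - s_ n : R -> R^o) by exact: strongly_measurableB.
  apply: (@le_trans _ _ (int_norm ((`|e| + 1) *: (phi - s_ n : R -> R^o)))).
    apply: le_int_norm.
    + apply: strongly_measurableB => //; exact: simple_strongly_measurable.
    + exact: strongly_measurableZ.
    + move=> x Rx; rewrite -scalerBl !normrZ [leRHS]mulrC.
      rewrite [X in _ <= _ * X]gtr0_norm//; apply: ler_pM => //.
        rewrite -[X in X - _](ger0_norm (phi0 x Rx)).
        by rewrite (le_trans (ler_dist_dist _ _)).
      by lra.
  rewrite int_normZ// gtr0_norm//.
  have := HN n Nn; rewrite -(@lee_pmul2l _ (`|e| + 1)%:E)// ?lte_fin//.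
  by move=> /le_trans; apply; rewrite -EFinM mulrC divfK ?gt_eqF.
- under eq_fun => n do rewrite (simple_integralZr _ (it n)).
  apply: cvgZr_tmp.
  apply/(@cvg_seqP R^o) => z z0; have [N HN] := fs z z0.
  exists N => n Nn; have fphi : int_norm (phi : R -> R^o) \is a fin_num.
    by rewrite ge0_fin_numE// int_norm_ge0.
  rewrite -lee_fin (le_trans _ (HN n Nn))//.
  have isn := simple_integral_norm (is_ n).
  have mps : strongly_measurable (phi - s_ n : R -> R^o) by exact: strongly_measurableB.
  have fd : int_norm (phi - s_ n : R -> R^o) \is a fin_num.
    by rewrite ge0_fin_numE ?int_norm_ge0// (le_lt_trans (HN n Nn))// ltry.
  have h1 : fine (int_norm (phi : R -> R^o)) <=
      simple_integral (fun x => `|s_ n x| : R^o) + fine (int_norm (phi - s_ n : R -> R^o)).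
    rewrite -lee_fin EFinD fineK// fineK// isn.
    have {1}-> : (phi : R -> R^o) = s_ n + (phi - s_ n) by rewrite addrC subrK.
    exact: int_normD.
  have h2 : simple_integral (fun x => `|s_ n x| : R^o) <=
      fine (int_norm (phi : R -> R^o)) + fine (int_norm (phi - s_ n : R -> R^o)).
    rewrite -lee_fin EFinD fineK// fineK// isn.
    have {1}-> : s_ n = (phi : R -> R^o) + - (phi - s_ n) by rewrite opprB addrC subrK.
    rewrite -(int_normN (phi - s_ n)); apply: int_normD => //.
    exact: strongly_measurableN.
  by rewrite -(fineK fd) lee_fin ler_norml; apply/andP; split; lra.
Qed.

End bochner_theory.

(** * Completeness of L^p *)

Section Lp_theory.
Context {R : realType} (E : normedModType R) (p : R) (p1 : 1 <= p).
Notation mu := (@lebesgue_measure R).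
Notation F := (Lp E p1).

Lemma Lp_fun_intro (f : R -> E) : strongly_measurable f ->
  (Lp_integral p f < +oo)%E -> f \in Lp_fun p1.
Proof. by move=> mf fi; apply/asboolP. Qed.

Definition Lp_class (f : Lp_function E p1) : F := (\pi_(Lp E p1) f)%qT.

Lemma Lp_class_repr (u : F) : Lp_class (repr u) = u.
Proof. exact: reprK. Qed.

Lemma Lp_classB (f g : Lp_function E p1) :
  Lp_class (f - g) = Lp_class f - Lp_class g.
Proof.
apply/eqP; rewrite eq_sym subr_eq; apply/eqP.
have := pi_LpD (f - g) g; rewrite subrK; exact.
Qed.

Lemma Lp_classZ a (f : Lp_function E p1) : Lp_class (a *: f) = a *: Lp_class f.
Proof. by symmetry; exact: Lp_scaleE. Qed.

Lemma Lp_classD (f g : Lp_function E p1) :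
  Lp_class (f + g) = Lp_class f + Lp_class g.
Proof. exact: pi_LpD. Qed.

Lemma Lp_class_norm (f : Lp_function E p1) : `|Lp_class f| = Lp_norm p f.
Proof. exact: Lp_qnorm_pi. Qed.

Lemma Lp_integral_norm (f : Lp_function E p1) :
  Lp_integral p f = (`|Lp_class f| `^ p)%:E.
Proof.
have p0 : 0 < p by move: p1; lra.
rewrite Lp_class_norm /Lp_norm -powRrM mulVf ?gt_eqF// powRr1.
  by rewrite fineK// ge0_fin_numE ?Lp_integral_ge0//; exact: Lp_function_lty.
by rewrite fine_ge0// Lp_integral_ge0.
Qed.

Lemma Lp_repr_measurable (u : F) : strongly_measurable (Lp_repr u).
Proof. exact: Lp_function_measurable. Qed.

Lemma Lp_repr_integral (u : F) : Lp_integral p (Lp_repr u) = (`|u| `^ p)%:E.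
Proof. by rewrite [LHS]Lp_integral_norm Lp_class_repr. Qed.

Lemma Lp_norm_le (f : Lp_function E p1) c : 0 <= c ->
  (Lp_integral p f <= (c `^ p)%:E)%E <-> `|Lp_class f| <= c.
Proof.
have p0 : 0 < p by move: p1; lra.
move=> c0; rewrite Lp_integral_norm lee_fin; split; last first.
  by move=> H; apply: ge0_ler_powR; rewrite ?nnegrE ?(ltW p0).
move=> H; rewrite leNgt; apply/negP => lt.
by move: H; rewrite leNgt; apply/negP; rewrite negbK gt0_ltr_powR ?nnegrE.
Qed.

End Lp_theory.

Section Riesz_Fischer.
Context {R : realType} (E : normedModType R) (p : R) (p1 : 1 <= p).
Notation mu := (@lebesgue_measure R).

(** For simple functions whose increments decay like [4 ^- j], the weighted
    sum [H] of the increments is integrable, and pointwise it controls the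
    tails; where [H] is infinite the final bound is void. *)
Lemma simple_limit (s_ : nat -> R -> E) (c : R) : seq_complete E -> 0 <= c ->
  (forall j, simple_fun (s_ j)) ->
  (forall j, Lp_integral p (s_ j.+1 - s_ j)%R <= ((c * (4^-1) ^+ j) `^ p)%:E)%E ->
  exists f : R -> E, strongly_measurable f /\
    exists C : R, 0 <= C /\
    forall j, (Lp_integral p (f - s_ j)%R <= ((C * (2^-1) ^+ j) `^ p)%:E)%E.
Proof.
move=> cE c0 ss sd.
have p0 : 0 < p by move: p1; lra.
have pn0 : p != 0 by rewrite gt_eqF.
pose d j x := s_ j.+1 x - s_ j x.
have sdj j : simple_fun (d j) by exact: (simple_funB (ss j.+1) (ss j)).
have mdj j : strongly_measurable (d j) by exact: simple_strongly_measurable.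
pose h j x : \bar R := (((2 ^+ j) `^ p)%:E * (`|d j x| `^ p)%:E)%E.
have h0 j x : (0 <= h j x)%E by rewrite mule_ge0// lee_fin powR_ge0.
have mh j D : measurable_fun D (h j).
  by apply: emeasurable_funM => //; exact: Lp_integrand_measurable.
pose H x := (\sum_(0 <= j <oo) h j x)%E.
have mH D : measurable_fun D H.
  by apply: (ge0_emeasurable_sum (P := xpredT)) => // k _; exact: mh.
have H0 x : (0 <= H x)%E by apply: nneseries_ge0 => n _ _; exact: h0.
have ih j : (\int[mu]_(x in Rplus) h j x <= (c `^ p * (2^-1) ^+ j)%:E)%E.
  rewrite ge0_integralZl_EFin; last 4 first.
  - exact: measurable_Rplus.
  - by move=> x _; rewrite lee_fin powR_ge0.
  - exact: Lp_integrand_measurable.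
  - exact: powR_ge0.
  have := sd j; rewrite unlock => sdj'.
  apply: (@le_trans _ _ (((2 ^+ j) `^ p)%:E * ((c * (4^-1) ^+ j) `^ p)%:E)%E).
    by apply: lee_wpmul2l; rewrite ?lee_fin ?powR_ge0.
  rewrite -EFinM lee_fin -powRM ?mulr_ge0// ?exprn_ge0//.
  have -> : 2 ^+ j * (c * 4^-1 ^+ j) = c * (2^-1) ^+ j :> R.
    rewrite mulrCA -exprMn; congr (_ * _ ^+ _); lra.
  rewrite powRM// ?exprn_ge0// ler_wpM2l ?powR_ge0//.
  rewrite -[leRHS]powRr1 ?exprn_ge0//; apply: ger_powR => //.
  by rewrite exprn_gt0//= exprn_ile1//; lra.
have iH : (\int[mu]_(x in Rplus) H x <= (2 * c `^ p)%:E)%E.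
  rewrite integral_nneseries => [|||n x _]; [|exact: measurable_Rplus| |exact: h0];
    last by move=> n; exact: mh.
  apply: lime_le.
    by apply: is_cvg_nneseries => n _ _; apply: integral_ge0 => x _; exact: h0.
  apply: nearW => n; apply: (@le_trans _ _ (\sum_(0 <= j < n) (c `^ p * (2^-1) ^+ j)%:E)%E).
    by apply: lee_sum => j _.
  rewrite sumEFin lee_fin.
  have -> : \sum_(0 <= j < n) c `^ p * 2^-1 ^+ j = c `^ p * (2 - 2 * 2^-1 ^+ n).
    elim: n => [|n IH]; first by rewrite big_nil expr0 mulr1 subrr mulr0.
    by rewrite big_nat_recr//= IH exprS; lra.
  have : 0 <= c `^ p * (2^-1 ^+ n) by rewrite mulr_ge0 ?powR_ge0// exprn_ge0.
  by lra.
pose A := [set x | H x \is a fin_num].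
have mA : measurable A.
  by rewrite -[A]setTI; apply: emeasurable_fin_num.
pose t_ j x := if `[< A x >] then s_ j x else 0.
(* where [H] is finite, the increments decay like [b x * 2 ^- j] *)
pose b x := (fine (H x)) `^ p^-1.
have dle x j : A x -> `|d j x| <= b x * (2^-1) ^+ j.
  move=> Ax; have : (h j x <= H x)%E.
    apply: le_trans (nneseries_lim_ge j.+1 _); last by move=> n _ _; exact: h0.
    by rewrite big_nat_recr//= leeDr// sume_ge0.
  rewrite -(fineK Ax) /h -EFinM lee_fin -powRM ?exprn_ge0// => hle.
  have : ((2 ^+ j * `|d j x|) `^ p) `^ p^-1 <= (fine (H x)) `^ p^-1.
    apply: ge0_ler_powR; rewrite ?invr_ge0 ?(ltW p0)// ?nnegrE ?powR_ge0//.
    by rewrite fine_ge0.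
  rewrite -powRrM mulfV// powRr1 ?mulr_ge0 ?exprn_ge0// => hle2.
  rewrite exprVn ler_pdivlMr ?exprn_gt0// mulrC; exact: hle2.
have tail x j k : A x -> `|s_ (j + k)%N x - s_ j x| <= 2 * b x * (2^-1) ^+ j * (1 - (2^-1) ^+ k).
  move=> Ax; elim: k => [|k IH]; first by rewrite addn0 subrr normr0 expr0 subrr mulr0.
  have := dle x (j + k)%N Ax; rewrite /d -addnS exprD => h1; rewrite exprS.
  have := ler_normD (s_ (j + k.+1)%N x - s_ (j + k)%N x) (s_ (j + k)%N x - s_ j x).
  by rewrite addrA subrK; lra.
have b0 x : 0 <= b x by exact: powR_ge0.
have tail2 x j m : A x -> (j <= m)%N -> `|s_ m x - s_ j x| <= 2 * b x * (2^-1) ^+ j.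
  move=> Ax jm; have := tail x j (m - j)%N Ax; rewrite subnKC//.
  move/le_trans; apply; apply: ler_piMr; first by rewrite !mulr_ge0// exprn_ge0.
  have : 0 <= (2^-1 : R) ^+ (m - j) by rewrite exprn_ge0.
  lra.
have half0 : forall (z e : R), 0 <= z -> 0 < e -> exists N,
    forall n, (N <= n)%N -> z * 2^-1 ^+ n <= e.
  move=> z e z0 e0.
  have : (z * 2^-1 ^+ n) @[n --> \oo] --> z * 0.
    by apply: cvgMr; apply: cvg_expr; rewrite ger0_norm; lra.
  rewrite mulr0 => /(@cvg_seqP R R^o) /(_ e e0)[N HN]; exists N => n /HN.
  by rewrite subr0; apply: le_trans; exact: ler_norm.
have cv x : exists l : E, t_ j x @[j --> \oo] --> l.
  rewrite /t_; case: asboolP => Ax; last by exists 0; exact: cvg_cst.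
  apply: cE => e e0.
  have [|N HN] := half0 (4 * b x) e _ e0; first by rewrite mulr_ge0.
  exists N => m n Nm Nn; have := HN N (leqnn N).
  have := tail2 x N m Ax Nm; have := tail2 x N n Ax Nn.
  have := ler_normB (s_ m x - s_ N x) (s_ n x - s_ N x).
  by rewrite opprB addrA subrK; lra.
pose f x := sval (cid (cv x)).
have tf x : t_ j x @[j --> \oo] --> f x by rewrite /f; case: cid.
have mf : strongly_measurable f.
  by exists t_; split => // j; exact: simple_fun_restrict.
have fle x j : A x -> `|f x - s_ j x| <= 2 * b x * (2^-1) ^+ j.
  move=> Ax; apply/ler_addgt0Pr => e e0.
  have /cvg_seqP/(_ e e0)[N HN] := tf x.
  have := HN (maxn N j) (leq_maxl _ _); rewrite /t_; case: asboolP => // _ h1.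
  have := tail2 x j _ Ax (leq_maxr N j).
  have := ler_normB (s_ (maxn N j) x - s_ j x) (s_ (maxn N j) x - f x).
  by rewrite opprB addrC addrA subrK; lra.
exists f; split => //; exists (2 * (2 * c `^ p) `^ p^-1); split.
  by rewrite mulr_ge0 ?powR_ge0.
move=> j.
have -> : ((2 * (2 * c `^ p) `^ p^-1 * 2^-1 ^+ j) `^ p)%:E =
    (((2 * 2^-1 ^+ j) `^ p)%:E * (2 * c `^ p)%:E)%E.
  have {2}<- : ((2 * c `^ p) `^ p^-1) `^ p = 2 * c `^ p.
    by rewrite -powRrM mulVf// powRr1// mulr_ge0 ?powR_ge0.
  by rewrite -EFinM -powRM ?mulr_ge0 ?exprn_ge0 ?powR_ge0// mulrAC.
apply: le_trans (lee_wpmul2l _ iH); last by rewrite lee_fin powR_ge0.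
rewrite -ge0_integralZl_EFin;
  [|exact: measurable_Rplus|by move=> x _; exact: H0|exact: mH|exact: powR_ge0].
have mfs : strongly_measurable (f - s_ j).
  by apply: strongly_measurableB => //; exact: simple_strongly_measurable.
rewrite unlock; apply: ge0_le_integral.
- exact: measurable_Rplus.
- by move=> x _; rewrite lee_fin powR_ge0.
- exact: (Lp_integrand_measurable _ mfs).
- by apply: emeasurable_funM; [exact: measurable_cst|exact: mH].
move=> x _; have [Ax|Ax] := pselect (A x); last first.
  have -> : H x = +oo%E.
    by apply/eqP; move/negP: Ax; rewrite ge0_fin_numE// -leNgt leye_eq.
  by rewrite gt0_muley ?leey// lte_fin powR_gt0// mulr_gt0// exprn_gt0.
rewrite -(fineK Ax) -EFinM lee_fin.
have -> : fine (H x) = b x `^ p.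
  by rewrite /b -powRrM mulVf// powRr1// fine_ge0.
rewrite -powRM ?mulr_ge0 ?exprn_ge0//; apply: ge0_ler_powR; rewrite ?nnegrE ?(ltW p0)//.
  by rewrite !mulr_ge0// exprn_ge0.
by rewrite mulrAC; exact: fle.
Qed.

Lemma Lp_simple_dense (u : Lp E p1) (e : R) : 0 < e ->
  exists s : Lp_function E p1, simple_fun s /\ `|Lp_class s - u| <= e.
Proof.
move=> e0; have p0 : 0 < p by move: p1; lra.
have uy : (Lp_integral p (Lp_repr u) < +oo)%E by rewrite Lp_repr_integral ltry.
have mu_ := Lp_repr_measurable u.
have [s_ [ss sf2 sf]] := simple_approximation_Lp p1 mu_ uy.
have [|+ _] := @cvge0P _ (fun n => Lp_integral p (Lp_repr u - s_ n)).
  by move=> n; exact: Lp_integral_ge0.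
move=> /(_ sf (e `^ p) (powR_gt0 _ e0))[N /(_ N (leqnn N)) HN].
have ms : strongly_measurable (s_ N) by exact: simple_strongly_measurable.
have sLp : s_ N \in Lp_fun p1.
  apply: Lp_fun_intro => //.
  apply: (@le_lt_trans _ _ (Lp_integral p (2 *: Lp_repr u))); last first.
    by rewrite Lp_integralZ// lte_mul_pinfty// ?lee_fin ?powR_ge0.
  rewrite unlock; apply: ge0_le_integral.
  - exact: measurable_Rplus.
  - by move=> x _; rewrite lee_fin powR_ge0.
  - exact: Lp_integrand_measurable.
  - by apply: (Lp_integrand_measurable _ (f := 2 *: Lp_repr u)); exact: strongly_measurableZ.
  - move=> x _; rewrite lee_fin; apply: ge0_ler_powR; rewrite ?nnegrE ?(ltW p0)//.
    by rewrite [leRHS]normrZ ger0_norm// sf2.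
exists (MkLpFunction sLp); split; first exact: (ss N).
rewrite -[u]Lp_class_repr distrC -Lp_classB.
by apply/Lp_norm_le; [exact: ltW|exact: HN].
Qed.

(** Riesz-Fischer.  A fast subsequence is first replaced by simple functions,
    so that the pointwise limit is strongly measurable by construction. *)
Lemma Lp_seq_complete : seq_complete E -> seq_complete (Lp E p1).
Proof.
move=> cE u cu.
have q0 j : 0 < (4^-1 : R) ^+ j by rewrite exprn_gt0//; lra.
pose K j := sval (cid (cu _ (q0 j))).
have KP j m n : (K j <= m)%N -> (K j <= n)%N -> `|u m - u n| <= 4^-1 ^+ j.
  by rewrite /K; case: cid => N /= HN; exact: HN.
have /choice[S SP] : forall j, exists s : Lp_function E p1,
    simple_fun s /\ `|Lp_class s - u (K j)| <= 4^-1 ^+ j.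
  by move=> j; exact: Lp_simple_dense.
have SS j : `|Lp_class (S j.+1) - Lp_class (S j)| <= 4 * 4^-1 ^+ j.
  have [_ h1] := SP j; have [_ h2] := SP j.+1.
  pose m := maxn (K j) (K j.+1).
  have h3 := KP j m (K j) (leq_maxl _ _) (leqnn _).
  have h4 := KP j.+1 (K j.+1) m (leqnn _) (leq_maxr _ _).
  have hj := ltW (q0 j); rewrite exprS in h2 h4.
  have -> : Lp_class (S j.+1) - Lp_class (S j) =
    (Lp_class (S j.+1) - u (K j.+1)) + (u (K j.+1) - u m) + (u m - u (K j)) -
    (Lp_class (S j) - u (K j)).
    by rewrite opprB !addrA !subrK.
  apply: (le_trans (ler_normB _ _)).
  have := ler_normD (Lp_class (S j.+1) - u (K j.+1) + (u (K j.+1) - u m)) (u m - u (K j)).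
  have := ler_normD (Lp_class (S j.+1) - u (K j.+1)) (u (K j.+1) - u m).
  lra.
have [||j|f [mf [C [C0 fC]]]] := @simple_limit (fun j => S j) 4 cE _ _.
- by [].
- by move=> j; have [] := SP j.
- have := SS j; rewrite -Lp_classB => /Lp_norm_le; apply.
  by rewrite mulr_ge0// ltW.
have mfS j : strongly_measurable (f - S j).
  by apply: strongly_measurableB => //; exact: Lp_function_measurable.
have fS0 : f - S 0%N \in Lp_fun p1.
  by apply: Lp_fun_intro => //; rewrite (le_lt_trans (fC 0%N))// ltry.
have fLp : f \in Lp_fun p1.
  rewrite -(subrK (S 0%N : R -> E) f) rpredD//; exact: Lp_functionP.
pose U := Lp_class (MkLpFunction fLp).
have US j : `|U - Lp_class (S j)| <= C * 2^-1 ^+ j.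
  rewrite -Lp_classB; apply/Lp_norm_le; last exact: fC.
  by rewrite mulr_ge0// exprn_ge0.
exists U; apply/cvg_seqP => e e0.
have : (C * 2^-1 ^+ n + 2 * 4^-1 ^+ n) @[n --> \oo] --> C * 0 + 2 * (0 : R).
  by apply: cvgD; apply: cvgMr; apply: cvg_expr; rewrite ger0_norm; lra.
rewrite !mulr0 addr0 => /(@cvg_seqP R R^o)/(_ e e0)[j /(_ j (leqnn j))].
rewrite subr0 => /(le_trans (ler_norm _)) hj.
exists (K j) => n Kn; have h1 := KP j n (K j) Kn (leqnn _).
have [_ h2] := SP j; have h3 := US j.
have -> : u n - U = (u n - u (K j)) - (Lp_class (S j) - u (K j)) - (U - Lp_class (S j)).
  by rewrite !opprB addrA !addrA !subrK.
apply: (le_trans (ler_normB _ _)).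
have := ler_normB (u n - u (K j)) (Lp_class (S j) - u (K j)).
lra.
Qed.

End Riesz_Fischer.

(** * Primitives of continuous functions *)

Section primitives.
Context {R : realType}.
Notation mu := (@lebesgue_measure R).
Implicit Types (X : normedModType R).

Definition window X (a b : R) (u : R -> X) : R -> X :=
  fun x => if `[< a <= x < b >] then u x else 0.

Lemma measurable_window (a b : R) : measurable [set x : R | a <= x < b].
Proof.
have -> : [set x : R | a <= x < b] = `[a, b[%classic.
  by apply/seteqP; split => x /=; rewrite in_itv.
exact: measurable_itv.
Qed.

(** The approximants take the value of [u] at the last point of the grid
    [a + k / n.+1] before [x]. *)
Lemma strongly_measurable_window X (a b : R) (u : R -> X) : 0 <= a ->
  (forall s, Rplus s -> continuous_at_in u Rplus s) ->
  strongly_measurable (window a b u).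
Proof.
move=> a0 cu.
pose z n x : R^o := if `[< a <= x < b >] then (Num.truncn ((x - a) * n.+1%:R))%:R else 0.
have sz n : simple_fun (z n).
  pose K := (Num.truncn ((b - a) * n.+1%:R)).+1.
  split.
    apply: (@sub_finite_set _ _ ((fun k : nat => k%:R : R) @` `I_K.+1)); last first.
      by apply: finite_image; exact: finite_II.
    move=> _ [x _ <-]; rewrite /z; case: asboolP => [/andP[ax xb]|_]; last by exists 0%N.
    exists (Num.truncn ((x - a) * n.+1%:R)) => //=.
    rewrite !ltnS /K; apply: leq_trans (leqnSn _); apply: le_truncn.
    by rewrite ler_wpM2r//; lra.
  move=> y.
  have mt : measurable_fun setT (fun x : R => ((Num.truncn ((x - a) * n.+1%:R))%:R : R)).
    apply: nondecreasing_measurable => // x x' xx'; rewrite ler_nat; apply: le_truncn.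
    by rewrite ler_wpM2r// lerD2r.
  have -> : z n @^-1` [set y] =
    ([set x | a <= x < b] `&`
      (fun x : R => ((Num.truncn ((x - a) * n.+1%:R))%:R : R)) @^-1` [set y]) `|`
    (~` [set x | a <= x < b] `&` [set _ | y = 0]).
    apply/seteqP; split=> x /=; rewrite /z.
      by case: asboolP => h <-; [left|right].
    by case=> -[h <-]; case: asboolP.
  have mw := measurable_window a b.
  apply: measurableU; apply: measurableI => //; last 2 first.
  - exact: measurableC.
  - have [->|y0] := pselect (y = 0).
      by rewrite (_ : [set _ | _] = setT)//; apply/seteqP; split.
    by rewrite (_ : [set _ | _] = set0)//; apply/seteqP; split.
  by rewrite -[_ @^-1` _]setTI; apply: mt.
exists (fun n => window a b ((fun v : R => u (a + v / n.+1%:R)) \o z n)); split.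
  move=> n; apply: simple_fun_restrict; first exact: measurable_window.
  exact: (@simple_fun_comp R R^o).
move=> x; rewrite /window; case: asboolP => [/andP[ax xb]|_]; last exact: cvg_cst.
have Rx : Rplus x by rewrite /Rplus/= in_itv/= (le_trans a0).
apply/cvg_seqP => e e0; have [d d0 Hd] := cu x Rx e e0.
have : (n.+1%:R^-1 : R) @[n --> \oo] --> (0 : R).
  exact: cvg_harmonic.
move=> /(@cvg_seqP R R^o)/(_ (d / 2) (ltac:(lra)))[N HN].
exists N => n Nn; rewrite /= /z asboolT ?ax ?xb//; apply/ltW/Hd.
  by rewrite /Rplus/= in_itv/= andbT addr_ge0// divr_ge0.
have nn : 0 < n.+1%:R :> R by rewrite ltr0n.
have xa : 0 <= (x - a) * n.+1%:R by rewrite mulr_ge0// subr_ge0.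
have := truncn_itv xa; set k := Num.truncn _ => /andP[k1 k2].
have k1' : k%:R / n.+1%:R <= x - a by rewrite ler_pdivrMr.
have k2' : x - a < k%:R / n.+1%:R + n.+1%:R^-1.
  have -> : k%:R / n.+1%:R + n.+1%:R^-1 = k.+1%:R / n.+1%:R :> R.
    by rewrite -[k.+1%:R]natr1 mulrDl mul1r.
  by rewrite ltr_pdivlMr.
have := HN n Nn; rewrite subr0 ger0_norm ?invr_ge0//= => h.
move: k1' k2' h; set q := k%:R / n.+1%:R; set w : R := n.+1%:R^-1 => k1' k2' h.
have h' : w <= d / 2 by exact: h.
by rewrite ltr_norml; clear -k1' k2' h' d0; apply/andP; split; lra.
Qed.

Lemma measurable_window1 (a b : R) :
  strongly_measurable (window a b (cst 1 : R -> R^o)).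
Proof.
apply: simple_strongly_measurable; apply: simple_fun_restrict.
  exact: measurable_window.
exact: simple_fun_cst.
Qed.

Lemma int_norm_window1 (a b : R) : 0 <= a -> a <= b ->
  int_norm (window a b (cst 1 : R -> R^o)) = (b - a)%:E.
Proof.
move=> a0 ab.
have -> : (b - a)%:E = (\int[mu]_(x in Rplus) (\1_(`[a, b[%classic : set R) x)%:E)%E.
  rewrite integral_indic//; last exact: measurable_Rplus.
  rewrite setIidl; last first.
    by move=> x /=; rewrite /Rplus/= !in_itv/= => /andP[ax _]; rewrite andbT (le_trans a0).
  rewrite /= lebesgue_measure_itv/= lte_fin; case: ltP => ab' //.
  by rewrite (_ : b = a); [rewrite subrr|lra].
apply: eq_integral => x _; rewrite /window indicE; case: asboolP => h.
  by rewrite normr1 mem_set//= in_itv.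
by rewrite normr0 memNset//= in_itv.
Qed.

Lemma int_norm_window X (a b c : R) (u : R -> X) : 0 <= a -> a <= b ->
  strongly_measurable (window a b u) ->
  (forall s, a <= s < b -> `|u s| <= c) ->
  (int_norm (window a b u) <= (c * (b - a))%:E)%E.
Proof.
move=> a0 ab mw uc; apply: (@le_trans _ _ (`|c| * (b - a))%:E); last first.
  move: ab; rewrite le_eqVlt => /predU1P[->|ab]; first by rewrite subrr !mulr0.
  rewrite ger0_norm//; have := uc a; rewrite lexx ab => /(_ isT).
  exact: le_trans.
rewrite EFinM -(int_norm_window1 a0 ab) -int_normZ; last exact: measurable_window1.
apply: le_int_norm => //; first by apply: strongly_measurableZ; exact: measurable_window1.
move=> x _; rewrite [X in _ <= `|X|](_ : _ = c * window a b (cst 1 : R -> R^o) x)//.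
rewrite normrM /window; case: asboolP => [/uc xc|_]; last by rewrite !normr0 mulr0.
by rewrite normr1 mulr1 (le_trans xc)// ler_norm.
Qed.

Lemma continuous_bounded_segment X (u : R -> X) (a b : R) : 0 <= a ->
  (forall s, Rplus s -> continuous_at_in u Rplus s) ->
  exists2 c, 0 <= c & forall s, a <= s <= b -> `|u s| <= c.
Proof.
move=> a0 cu; have [ab|ab] := leP a b; last first.
  by exists 0 => // s /andP[]; lra.
have [|c cab Hc] := @EVT_max _ (fun s => `|u s|) a b ab.
  apply/(within_continuousP (X := R^o)) => s sab.
  apply: (continuous_at_in_le (u := u)) => [r|]; first exact: ler_dist_dist.
  have abR : `[a, b] `<=` @Rplus R.
    by move=> x; rewrite /Rplus/= !in_itv/= andbT => /andP[/(le_trans a0)].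
  by apply: (continuous_at_inS abR); apply: cu; exact: abR.
by exists `|u c| => // s sab; apply: Hc; rewrite in_itv.
Qed.

Lemma int_norm_window_lty X (a b : R) (u : R -> X) : 0 <= a ->
  (forall s, Rplus s -> continuous_at_in u Rplus s) ->
  (int_norm (window a b u) < +oo)%E.
Proof.
move=> a0 cu; have mw := strongly_measurable_window b a0 cu.
have [ab|ab] := leP a b; last first.
  rewrite (_ : int_norm _ = 0%E)//; apply: integral0_eq => x _.
  rewrite /window; case: asboolP => [/andP[x1 x2]|_]; last by rewrite normr0.
  by have := le_lt_trans x1 (lt_trans x2 ab); rewrite ltxx.
have [c c0 Hc] := continuous_bounded_segment b a0 cu.
apply: le_lt_trans (int_norm_window a0 ab mw _) (ltry _).
by move=> s /andP[sa sb]; apply: Hc; rewrite sa ltW.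
Qed.

(** A primitive, given with the estimate of its increments by the oscillation
    of [u]; continuity and differentiability are both special cases. *)
Lemma primitive_exists X (u : R -> X) : seq_complete X ->
  (forall s, Rplus s -> continuous_at_in u Rplus s) ->
  exists U : R -> X, [/\ U 0 = 0,
    forall t, exists2 C, 0 <= C & forall q r, 0 <= q <= t -> 0 <= r <= t ->
      `|U q - U r| <= C * `|q - r|,
    forall b, (`|U b|%:E <= int_norm (window 0 b u))%E &
    forall (a b e : R) (c : X), 0 <= a -> a <= b ->
      (forall s, a <= s < b -> `|u s - c| <= e) ->
      `|U b - U a - (b - a) *: c| <= e * (b - a)].
Proof.
move=> cX cu.
have ex b : exists v, is_bochner_integral (window 0 b u) v.
  apply: bochner_exists => //; first exact: strongly_measurable_window.
  exact: int_norm_window_lty.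
pose U b := sval (cid (ex b)).
have UP b : is_bochner_integral (window 0 b u) (U b) by rewrite /U; case: cid.
have inc (a b e : R) (c : X) : 0 <= a -> a <= b ->
    (forall s, a <= s < b -> `|u s - c| <= e) ->
    `|U b - U a - (b - a) *: c| <= e * (b - a).
  move=> a0 ab uc.
  have m1 := measurable_window1 a b.
  have I1 := int_norm_window1 a0 ab.
  have B1 : is_bochner_integral (fun x => window a b (cst 1 : R -> R^o) x *: c) ((b - a) *: c).
    have -> : b - a = fine (int_norm (window a b (cst 1 : R -> R^o))) by rewrite I1.
    apply: bochner_scalar => //; last by rewrite I1 ltry.
    by move=> x _; rewrite /window; case: asboolP.
  have B2 := bochner_linear (-1) (UP a) (UP b).
  have := bochner_linear (-1) B1 B2.
  rewrite !scaleN1r => B3.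
  have E : - (fun x => window a b (cst 1 : R -> R^o) x *: c) + (- window 0 a u + window 0 b u) =
      window a b (fun s => u s - c).
    apply/funext => x; rewrite /window [LHS]/GRing.add/= /GRing.opp/= [X in _ + X]/GRing.add/=.
    case: asboolP => [/andP[ax xb]|h].
      case: asboolP => [/andP[_ xa]|_]; first by have := lt_le_trans xa ax; rewrite ltxx.
      case: asboolP => [_|]; first by rewrite scale1r oppr0 add0r addrC.
      by case; rewrite xb andbT (le_trans a0).
    have -> : `[< 0 <= x < b >] = `[< 0 <= x < a >].
      by apply/asboolP/asboolP => /andP[x0 xa]; apply/andP; split; lra.
    by rewrite scale0r oppr0 add0r addNr.
  rewrite E in B3.
  have -> : U b - U a - (b - a) *: c = - ((b - a) *: c) + (- U a + U b).
    by rewrite [RHS]addrC; congr (_ - _); rewrite addrC.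
  rewrite -lee_fin (le_trans (bochner_norm_le B3))//; apply: int_norm_window => //.
  by case: B3.
exists U; split => // [|t|b]; last exact: bochner_norm_le.
  have m0 : strongly_measurable (window 0 0 u) by exact: strongly_measurable_window.
  have := le_trans (bochner_norm_le (UP 0)) (int_norm_window (c := 0) (lexx 0) (lexx 0) m0 _).
  rewrite subrr mulr0 lee_fin normr_le0 => H; apply/eqP/H => s /andP[s0 s1].
  by have := le_lt_trans s0 s1; rewrite ltxx.
have [C C0 HC] := continuous_bounded_segment t (lexx 0) cu; exists C => //.
have L q r : 0 <= q -> q <= r -> r <= t -> `|U r - U q| <= C * (r - q).
  move=> q0 qr rt; have := inc q r C 0 q0 qr; rewrite scaler0 subr0; apply.
  by move=> s /andP[qs sr]; rewrite subr0; apply: HC;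
    rewrite (le_trans q0 qs)/= ltW// (lt_le_trans sr).
move=> q r /andP[q0 qt] /andP[r0 rt]; have [qr|/ltW rq] := leP q r.
  by rewrite distrC (distrC q) (ger0_norm (_ : 0 <= r - q)) ?subr_ge0//; exact: L.
by rewrite (ger0_norm (_ : 0 <= q - r)) ?subr_ge0//; exact: L.
Qed.

End primitives.

(** * Orbits of strongly continuous semigroups *)

Section semigroup_theory.
Context {R : realType}.
Implicit Types (X Y : normedModType R).

Lemma linear_bounded X Y (f : X -> Y) : linear f -> continuous f ->
  exists2 K : R, 0 < K & forall x, `|f x| <= K * `|x|.
Proof.
move=> lf cf.
pose g : {linear X -> Y} := HB.pack f (GRing.isLinear.Build _ _ _ _ _ lf).
have /linear_boundedP : bounded_near g (nbhs 0) by exact/linear_bounded_continuous.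
move=> [M [_ HM]]; exists (`|M| + 1); first by rewrite ltr_wpDl.
by move=> x; apply: (HM (`|M| + 1)); have := ler_norm M; lra.
Qed.

Lemma subrACA (V : zmodType) (a b c d : V) : (a - b) - (c - d) = (a - c) - (b - d).
Proof. by rewrite !opprD !opprK addrACA. Qed.

Lemma subrKB (V : zmodType) (x y w : V) : (x - w) - (y - w) = x - y.
Proof. by rewrite opprB addrA subrK. Qed.

Section fun_linear.
Context (X Y : normedModType R) (f : X -> Y) (lf : linear f).

Let g : {linear X -> Y} := HB.pack f (GRing.isLinear.Build _ _ _ _ _ lf).

Lemma linear_fun0 : f 0 = 0. Proof. exact: (linear0 g). Qed.

Lemma linear_funB x y : f (x - y) = f x - f y. Proof. exact: (linearB g). Qed.

Lemma linear_funD x y : f (x + y) = f x + f y. Proof. exact: (linearD g). Qed.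

Lemma linear_funZ a x : f (a *: x) = a *: f x. Proof. exact: (linearZ_LR g). Qed.

End fun_linear.

Section orbits.
Context (X : normedModType R) (T : R -> X -> X) (hT : C0_semigroup T).

Lemma orbit_continuous x s : Rplus s -> continuous_at_in (T^~ x) Rplus s.
Proof. by have /within_continuousP := @C0_continuous _ _ _ hT x; exact. Qed.

Lemma generator_right_derivative x y t : 0 <= t -> generator T (x, y) ->
  right_derivative (T^~ x) t (T t y).
Proof.
move=> t0 gxy e e0.
have [K K0 HK] := linear_bounded (C0_linear hT t0) (C0_bounded hT t0).
have /(right_derivativeP (T^~ x))/(_ _ (divr_gt0 e0 K0))[d d0 Hd] :
    h^-1 *: (T (0 + h) x - T 0 x) @[h --> 0^'+] --> y.
  by move: gxy; rewrite /generator/= (C0_id hT); under eq_fun do rewrite -[X in T X]add0r.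
exists d => // h h0 hd; have := Hd h h0 hd; rewrite add0r (C0_id hT) => Hh.
rewrite C0_add// ?(ltW h0)//=.
have lT := C0_linear hT t0.
rewrite -(linear_funB lT) -(linear_funZ lT) -(linear_funB lT).
apply: (le_trans (HK _)); rewrite -ler_pdivlMl//.
by apply: (le_trans Hh); rewrite mulrAC mulrC.
Qed.

Lemma generator_invariant x y t : 0 <= t -> generator T (x, y) ->
  generator T (T t x, T t y).
Proof.
move=> t0 gxy; have /right_derivativeP := generator_right_derivative t0 gxy.
apply: cvg_trans; apply: near_eq_cvg; rewrite near_withinE; apply: nearW => h /= h0.
by rewrite (addrC t) C0_add ?(ltW h0).
Qed.

(** Averages [h^-1 *: U h] of an orbit lie in the domain: the primitive [U]
    satisfies [T r (U h) = U (h + r) - U r], since both sides have the same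
    derivative in [h]. *)
Lemma generator_dense : seq_complete X -> forall x e, 0 < e ->
  exists y z, generator T (y, z) /\ `|y - x| <= e.
Proof.
move=> cX x e e0.
have cu s : Rplus s -> continuous_at_in (T^~ x) Rplus s by exact: orbit_continuous.
have [U [U0 LU _ HU]] := primitive_exists cX cu.
have nearu s z : 0 <= s -> 0 < z -> exists2 d : R, 0 < d &
    forall r, 0 <= r -> `|r - s| < d -> `|T r x - T s x| <= z.
  move=> s0 z0; have [|d d0 Hd] := cu s _ z z0; first by rewrite /Rplus/= in_itv/= s0.
  by exists d => // r r0 /Hd; rewrite /Rplus/= in_itv/= r0 => /(_ isT)/ltW.
have dU s : 0 <= s -> right_derivative U s (T s x).
  move=> s0 z z0; have [d d0 Hd] := nearu s z s0 z0; exists d => // h h0 hd.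
  have := HU s (s + h) z (T s x) s0; rewrite (_ : s + h - s = h); last by ring.
  apply; first by lra.
  move=> r /andP[sr rh]; apply: Hd; first by lra.
  by rewrite ger0_norm; lra.
have contU s : 0 <= s -> continuous_at_in U Rplus s.
  move=> s0 z z0; have [C C0 HC] := LU (s + 1).
  have C1 : 0 < C + 1 by lra.
  exists (Num.min 1 (z / (C + 1))) => [|r]; first by rewrite lt_min ltr01 divr_gt0.
  rewrite /Rplus/= in_itv/= andbT lt_min ltr_pdivlMr// => r0 /andP[r1 rz].
  have := HC r s; rewrite r0 s0 lerDl ler01 => /(_ _ isT) H.
  have {}H : `|U r - U s| <= C * `|r - s| by apply: H; have := ler_norm (r - s); lra.
  by have := normr_ge0 (r - s); lra.
have shiftU r h : 0 <= r -> 0 <= h -> T r (U h) = U (h + r) - U r.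
  move=> r0 h0.
  have lT := C0_linear hT r0.
  have [K K0 HK] := linear_bounded lT (C0_bounded hT r0).
  have := @right_derivative0_cst _ X (fun s => T r (U s) - U (s + r)) 0 h h0.
  rewrite U0 (linear_fun0 lT) !add0r => H.
  suff E : T r (U h) - U (h + r) = - U r by rewrite [RHS]addrC -E subrK.
  apply: H.
    move=> s /andP[s0 sh] z z0; have z2 : 0 < z / 2 by lra.
    have [d1 d10 H1] := contU s s0 _ (divr_gt0 z2 K0).
    have [|d2 d20 H2] := contU (s + r) _ _ z2; first by lra.
    exists (Num.min d1 d2) => [|q]; first by rewrite lt_min d10.
    rewrite /= in_itv/= lt_min => /andP[q0 _] /andP[qd1 qd2].
    have Rq : Rplus q by rewrite /Rplus/= in_itv/= q0.
    have Rqr : Rplus (q + r) by rewrite /Rplus/= in_itv/= addr_ge0.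
    have h1 := H1 q Rq qd1; have := H2 (q + r) Rqr; rewrite opprD addrACA subrr addr0.
    move=> /(_ qd2) h2.
    have -> : T r (U q) - U (q + r) - (T r (U s) - U (s + r)) =
        T r (U q - U s) - (U (q + r) - U (s + r)).
      by rewrite (linear_funB lT) subrACA.
    apply: (le_lt_trans (ler_normB _ _)).
    have : `|T r (U q - U s)| <= z / 2.
      apply: (le_trans (HK _)); by rewrite -ler_pdivlMl// [leRHS]mulrC ltW.
    by lra.
  move=> s /andP[s0 sh] z z0; have z2 : 0 < z / 2 by lra.
  have [d1 d10 H1] := dU s s0 _ (divr_gt0 z2 K0).
  have [|d2 d20 H2] := dU (s + r) _ _ z2; first by lra.
  exists (Num.min d1 d2) => [|q q0]; first by rewrite lt_min d10.
  rewrite lt_min => /andP[/(H1 _ q0) h1 /(H2 _ q0)].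
  rewrite (addrAC s r q) scaler0 subr0 => h2.
  have -> : T r (U (s + q)) - U (s + q + r) - (T r (U s) - U (s + r)) =
      T r (U (s + q) - U s - q *: T s x) - (U (s + q + r) - U (s + r) - q *: T (s + r) x).
    have -> : T (s + r) x = T r (T s x) by rewrite addrC (C0_add hT).
    by rewrite !(linear_funB lT) (linear_funZ lT) subrKB subrACA.
  apply: (le_trans (ler_normB _ _)).
  have : `|T r (U (s + q) - U s - q *: T s x)| <= z / 2 * q.
    apply: (le_trans (HK _)); rewrite -ler_pdivlMl//; apply: (le_trans h1).
    by rewrite mulrAC mulrC.
  by lra.
have [d d0 Hd] := nearu 0 e (lexx 0) e0.
pose h := d / 2; have h0 : 0 < h by rewrite /h; lra.
exists (h^-1 *: U h), (h^-1 *: (T h x - x)); split; last first.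
  have := HU 0 h e x (lexx 0) (ltW h0); rewrite U0 !subr0.
  have H r : 0 <= r < h -> `|T r x - x| <= e.
    move=> /andP[r0 rh]; have := Hd r r0; rewrite (C0_id hT); apply.
    by rewrite subr0 ger0_norm//; rewrite /h in rh; lra.
  move=> /(_ H) H2.
  have -> : h^-1 *: U h - x = h^-1 *: (U h - h *: x).
    by rewrite scalerBr scalerA mulVf ?gt_eqF// scale1r.
  by rewrite normrZ gtr0_norm ?invr_gt0// ler_pdivrMl// mulrC.
apply/cvg_at_right0P => z z0.
have z2 : 0 < z * h / 2 by rewrite divr_gt0// mulr_gt0.
have [d1 d10 H1] := dU h (ltW h0) _ z2; have [d2 d20 H2] := dU 0 (lexx 0) _ z2.
exists (Num.min d1 d2) => [|r r0]; first by rewrite lt_min d10.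
rewrite lt_min => /andP[/(H1 _ r0) h1 /(H2 _ r0)].
rewrite add0r U0 subr0 (C0_id hT) => h2.
have lT := C0_linear hT (ltW r0).
rewrite /= (linear_funZ lT) shiftU ?(ltW r0)// ?(ltW h0)//.
rewrite -!scalerBr scalerA mulrC -scalerA -scalerBr.
have -> : r^-1 *: (U (h + r) - U r - U h) - (T h x - x) =
    r^-1 *: ((U (h + r) - U h - r *: T h x) - (U r - r *: x)).
  by rewrite subrACA -scalerBr [RHS]scalerBr scalerA mulVf ?gt_eqF// scale1r addrAC.
rewrite !normrZ !gtr0_norm ?invr_gt0// ler_pdivrMl// ler_pdivrMl//.
apply: (le_trans (ler_normB _ _)); lra.
Qed.

End orbits.
End semigroup_theory.

(** * Growth bounds and the Chernoff product formula *)

Section growth_bound.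
Context {R : realType}.

(** Orbits are bounded on [[0, 1]], hence so are the operators, uniformly; the
    semigroup law turns this into an exponential bound. *)
Lemma semigroup_growth (E : completeNormedModType R) (T : R -> E -> E) :
  C0_semigroup T -> exists M omega : R, [/\ 1 <= M, 0 <= omega &
    forall t x, 0 <= t -> `|T t x| <= M * expR (omega * t) * `|x|].
Proof.
move=> hT.
pose F := [set f | exists2 t, 0 <= t <= 1 & f = T t].
have [|x|M0 HM0] := @Banach_Steinhauss R E E F _ _ 1.
- move=> f [t /andP[t0 _] ->]; split; last exact: C0_linear.
  have [K K0 HK] := linear_bounded (C0_linear hT t0) (C0_bounded hT t0).
  move=> r; exists (K * r) => x xr; apply: (le_trans (HK x)).
  by rewrite ler_wpM2l// ltW.
- have [c _ Hc] := continuous_bounded_segment 1 (lexx 0) (@orbit_continuous _ _ _ hT x).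
  by exists c => f [t t01 ->]; exact: Hc.
pose M := `|M0| + 1.
have M1 : 1 <= M by rewrite /M; have := normr_ge0 M0; lra.
have M0' : 0 < M by lra.
have H01 t x : 0 <= t <= 1 -> `|T t x| <= M * `|x|.
  move=> t01; have t0 : 0 <= t by case/andP: t01.
  have lT := C0_linear hT t0.
  have [->|x0] := eqVneq x 0; first by rewrite (linear_fun0 lT) !normr0 mulr0.
  have nx : 0 < `|x| by rewrite normr_gt0.
  have Ft : F (T t) by exists t.
  have := HM0 _ Ft (`|x|^-1 *: x).
  rewrite normrZ ger0_norm ?invr_ge0// mulVf ?gt_eqF// => /(_ (lexx _)).
  rewrite (linear_funZ lT) normrZ ger0_norm ?invr_ge0// ler_pdivrMl// mulrC => h.
  apply: (le_trans h); rewrite ler_wpM2r//.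
  by rewrite /M; have := ler_norm M0; lra.
have Hn n : forall t x, 0 <= t <= n.+1%:R -> `|T t x| <= M ^+ n.+1 * `|x|.
  elim: n => [|n IH] t x tn; first by rewrite expr1; exact: H01.
  have [t1|t1] := leP t 1.
    apply: (le_trans (H01 _ _ _)); first by rewrite t1 andbT; case/andP: tn.
    by rewrite ler_wpM2r// -[leLHS]mulr1 exprS ler_wpM2l ?(ltW M0')// exprn_ege1.
  have -> : t = 1 + (t - 1) by ring.
  have tt : 0 <= t - 1 <= n.+1%:R.
    by case/andP: tn => _; rewrite -[n.+2%:R]natr1 => h; apply/andP; split; lra.
  rewrite (C0_add hT)//=; last by case/andP: tt.
  apply: (le_trans (H01 _ _ _)); first by rewrite ler01 lexx.
  by rewrite exprS -mulrA ler_wpM2l ?(ltW M0')// IH.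
exists M, (ln M); split => //; first by rewrite ln_ge0.
move=> t x t0; have /andP[k1 k2] := truncn_itv t0; set k := Num.truncn t in k1 k2.
apply: (le_trans (Hn k t x _)); first by rewrite t0 ltW.
rewrite ler_wpM2r// exprS ler_wpM2l ?(ltW M0')//.
have -> : M ^+ k = expR (ln M * k%:R) by rewrite mulrC expRM_natl lnK ?posrE.
by rewrite ler_expR ler_wpM2l ?ln_ge0.
Qed.

End growth_bound.

Lemma subrB4 (W : zmodType) (a b c d : W) : b - d = (a - c) - ((a - b) - (c - d)).
Proof. by rewrite (subrACA a b c d) opprB [RHS]addrC subrK. Qed.

Section chernoff.
Context {R : realType} (X : normedModType R).
Implicit Types (V : R -> X -> X) (T : R -> X -> X).

Lemma iter_linear (f : X -> X) n : linear f -> linear (iter n f).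
Proof. by move=> lf; elim: n => [|n IH] a x y //=; rewrite IH lf. Qed.

(** The path [w] is compared with blocks of powers of [V]: the error made in one
    block is propagated by the remaining powers, which are bounded by [K]. *)
Lemma telescope_le (V : X -> X) (K : R) (k : nat -> nat) (w : nat -> X) (N : nat) :
  linear V -> {homo k : i j / (i <= j)%N} -> k 0%N = 0%N ->
  (forall i x, (i <= k N)%N -> `|iter i V x| <= K * `|x|) ->
  `|iter (k N) V (w 0%N) - w N| <=
    K * \sum_(j < N) `|iter (k j.+1 - k j) V (w j) - w j.+1|.
Proof.
move=> lV hk k0 HK.
have H j : (j <= N)%N -> forall l, (l + k j <= k N)%N ->
    `|iter l V (iter (k j) V (w 0%N) - w j)| <=
    K * \sum_(i < j) `|iter (k i.+1 - k i) V (w i) - w i.+1|.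
  elim: j => [_ l _|j IH jN l lk].
    by rewrite k0 subrr big_ord0 mulr0 (linear_fun0 (iter_linear l lV)) normr0.
  have kj : (k j <= k j.+1)%N by exact: hk.
  rewrite big_ord_recr/= mulrDr.
  have -> : iter l V (iter (k j.+1) V (w 0%N) - w j.+1) =
      iter (l + (k j.+1 - k j)) V (iter (k j) V (w 0%N) - w j) +
      iter l V (iter (k j.+1 - k j) V (w j) - w j.+1).
    rewrite iterD -(linear_funD (iter_linear l lV)); congr (iter l V _).
    rewrite (linear_funB (iter_linear _ lV)) -iterD subnK//.
    by rewrite addrA subrK.
  apply: (le_trans (ler_normD _ _)); apply: lerD.
    by apply: IH; [exact: ltnW|rewrite -addnA subnK].
  by apply: HK; rewrite (leq_trans _ lk)// leq_addr.
by have := H N (leqnn N) 0%N; rewrite add0n leqnn => /(_ isT).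
Qed.

(** One segment of the path: [a] moves towards [b] in [m] equal steps along
    the chord, and each step of [V] differs from a chord step by the
    consistency error. *)
Lemma chord_step (V : X -> X) (h K ea eb : R) (m : nat) (a b zeta : X) :
  linear V -> 0 <= h -> 0 <= K ->
  (forall i x, (i <= m)%N -> `|iter i V x| <= K * `|x|) ->
  `|V a - a - h *: zeta| <= ea -> `|V b - b - h *: zeta| <= eb ->
  `|iter m V a - b| <= K * (m%:R * (ea + eb) + `|b - a - (m%:R * h) *: zeta|).
Proof.
move=> lV h0 K0 HK Ha Hb.
have [->|mn0'] := eqVneq m 0%N.
  by rewrite mul0r add0r mul0r scale0r subr0/= distrC; exact: (HK 0%N).
have ea0 : 0 <= ea by apply: le_trans Ha.
have eb0 : 0 <= eb by apply: le_trans Hb.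
have mn0 : m%:R != 0 :> R by rewrite pnatr_eq0.
have mp : 0 < m%:R :> R by rewrite ltr0n lt0n.
pose c i := a + (i%:R / m%:R) *: (b - a).
set D := `|b - a - (m%:R * h) *: zeta|.
have step i : (i < m)%N -> `|V (c i) - c i.+1| <= ea + eb + D / m%:R.
  move=> im; set q : R := i%:R / m%:R.
  have q0 : 0 <= q by rewrite divr_ge0.
  have q1 : q <= 1 by rewrite ler_pdivrMr// mul1r ler_nat ltnW.
  have comb x1 x2 y1 y2 : (1 - q) *: (x1 - y1) + q *: (x2 - y2) =
      ((1 - q) *: x1 + q *: x2) - ((1 - q) *: y1 + q *: y2) :> X.
    by rewrite !scalerBr opprD addrACA.
  have comb1 x : (1 - q) *: x + q *: x = x by rewrite -scalerDl subrK scale1r.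
  have ci : c i = (1 - q) *: a + q *: b.
    rewrite /c -/q scalerBr scalerBl scale1r addrC -addrA (addrC (- _)) addrC.
    by rewrite addrC.
  have ci1 : c i.+1 = c i + m%:R^-1 *: (b - a).
    by rewrite /c -natr1 mulrDl mul1r scalerDl addrA.
  have -> : V (c i) - c i.+1 =
      ((1 - q) *: (V a - a - h *: zeta) + q *: (V b - b - h *: zeta)) -
      m%:R^-1 *: (b - a - (m%:R * h) *: zeta).
    rewrite !comb comb1 [in RHS](scalerBr m%:R^-1) scalerA mulrA mulVf// mul1r subrKB.
    rewrite -ci ci1 opprD addrA; congr (_ - _ - _).
    by rewrite ci (linear_funD lV) !(linear_funZ lV).
  apply: (le_trans (ler_normB _ _)); apply: lerD; last first.
    by rewrite normrZ ger0_norm ?invr_ge0// mulrC.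
  apply: (le_trans (ler_normD _ _)); rewrite !normrZ !ger0_norm ?subr_ge0//.
  apply: lerD.
    by rewrite -[leRHS]mul1r ler_pM// ?subr_ge0//; lra.
  by rewrite -[leRHS]mul1r ler_pM.
have := @telescope_le V K id c m lV (fun _ _ => id) erefl HK.
rewrite /c mul0r scale0r addr0 divff// scale1r [a + (b - a)]addrC subrK => /le_trans; apply.
rewrite ler_wpM2l//.
apply: (@le_trans _ _ (\sum_(i < m) (ea + eb + D / m%:R))).
  by apply: ler_sum => i _; rewrite subSnn; exact: step.
rewrite sumr_const card_ord -[leLHS]mulr_natl mulrDr.
by rewrite (mulrC D) mulrA divff// mul1r.
Qed.

(** Chernoff's product formula.  The exact orbit of a point of the domain is
    replaced at finitely many times [j t / N] by points [w j] of the core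
    [A0], on which [V] is consistent; between these times the path is a chord.
    Approximation in the graph norm suffices, and no resolvent is needed. *)
Theorem chernoff (V : R -> X -> X) (T : R -> X -> X) (A0 : operator X) (M omega : R) :
  seq_complete X -> C0_semigroup T -> generator T = closure A0 ->
  0 <= omega -> 0 <= M -> (forall h, 0 <= h -> linear (V h)) ->
  V 0 = id ->
  (forall h n x, 0 <= h -> `|iter n (V h) x| <= M * expR (omega * (n%:R * h)) * `|x|) ->
  (forall x y, A0 (x, y) -> forall e, 0 < e -> exists2 d : R, 0 < d &
     forall h, 0 < h -> h < d -> `|V h x - x - h *: y| <= e * h) ->
  forall x t, 0 <= t -> iter n (V (t / n%:R)) x @[n --> \oo] --> T t x.
Proof.
move=> cX hT gT om0 M0 lV V0 HV HA x t t0.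
have [->|tn0] := eqVneq t 0.
  rewrite (C0_id hT)/=; under eq_fun do rewrite mul0r V0.
  under eq_fun => n. rewrite (_ : iter n id x = x); last by elim: n => //= n ->. over.
  exact: cvg_cst.
have tp : 0 < t by rewrite lt_neqAle eq_sym tn0.
set K := M * expR (omega * t).
have K0 : 0 <= K by rewrite mulr_ge0 ?expR_ge0.
have HK n i y : (0 < n)%N -> (i <= n)%N -> `|iter i (V (t / n%:R)) y| <= K * `|y|.
  move=> n0 iln; apply: (le_trans (HV _ _ _ _)); first by rewrite divr_ge0.
  rewrite ler_wpM2r// ler_wpM2l// ler_expR ler_wpM2l//.
  rewrite mulrCA ler_piMr// ler_pdivrMr ?ltr0n// mul1r ler_nat//.
(* both sides are Lipschitz in [x], uniformly in [n], so [x] may be moved into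
   the domain *)
suff main x1 y1 : generator T (x1, y1) -> forall e, 0 < e -> exists N0, forall n, (N0 <= n)%N ->
    `|iter n (V (t / n%:R)) x1 - T t x1| <= e.
  have [KT KT0 HKT] := linear_bounded (C0_linear hT t0) (C0_bounded hT t0).
  apply/cvg_seqP => e e0.
  have KK : 0 < K + KT + 1 by lra.
  have [|x1 [y1 [g1 xx1]]] := generator_dense hT cX x (e := e / 2 / (K + KT + 1)).
    by rewrite divr_gt0//; lra.
  have [|N0 HN0] := main x1 y1 g1 (e / 2); first by lra.
  exists (maxn N0 1) => n; rewrite geq_max => /andP[/HN0 h1 n0].
  have lVn := iter_linear n (lV (t / n%:R) (divr_ge0 t0 (ler0n _ n))).
  have h2 := HK n n (x1 - x) n0 (leqnn n).
  have h3 := HKT (x1 - x).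
  rewrite (linear_funB lVn) in h2; rewrite (linear_funB (C0_linear hT t0)) in h3.
  have h4 : (K + KT) * `|x1 - x| <= e / 2.
    rewrite ler_pdivlMr// in xx1; have := normr_ge0 (x1 - x); lra.
  rewrite (subrB4 (iter n (V (t / n%:R)) x1) _ (T t x1)).
  apply: (le_trans (ler_normB _ _)).
  have := ler_normB (iter n (V (t / n%:R)) x1 - iter n (V (t / n%:R)) x) (T t x1 - T t x).
  lra.
move=> g1 e e0.
pose u s := T s x1; pose u' s := T s y1.
have cu' s : Rplus s -> continuous_at_in u' Rplus s by exact: orbit_continuous.
have cu s : Rplus s -> continuous_at_in u Rplus s by exact: orbit_continuous.
have du s : 0 <= s -> right_derivative u s (u' s).
  by move=> s0; exact: generator_right_derivative.
(* [B] collects the coefficients of [z] in the final estimate *)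
set B := K + 1 + K * (K * (13 * t + 3)).
have B0 : 0 < B.
  have : 0 <= K * (K * (13 * t + 3)) by rewrite !mulr_ge0//; lra.
  by rewrite /B; lra.
pose z := e / B; have z0 : 0 < z by exact: divr_gt0.
have [|d0 d00 Hd0] := @continuous_uniform_segment _ _ u' 0 t z z0.
  move=> s st; have Rs : Rplus s by apply: (@segment_Rplus _ t); rewrite /= in_itv.
  exact: continuous_at_inS (@segment_Rplus _ t) (cu' s Rs).
have taylor s r : 0 <= s -> s <= r -> r <= t -> r - s < d0 ->
    `|u r - u s - (r - s) *: u' s| <= z * (r - s).
  move=> s0 sr rt rs.
  have -> : u r - u s - (r - s) *: u' s = (u r - r *: u' s) - (u s - s *: u' s).
    by rewrite scalerBl subrACA.
  rewrite mulrBr.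
  apply: (@mean_value_right _ _ (fun q => u q - q *: u' s) (fun q => z * q)) => //.
  - move=> q /andP[sq qr] c c0; have c2 : 0 < c / 2 by lra.
    have [|d dp Hd] := cu q _ _ c2; first by rewrite /Rplus/= in_itv/= (le_trans s0).
    have n1 : 0 < `|u' s| + 1 by have := normr_ge0 (u' s); lra.
    exists (Num.min d (c / 2 / (`|u' s| + 1))) => [|q']; first by rewrite lt_min dp divr_gt0.
    rewrite /= in_itv/= lt_min => /andP[sq' _] /andP[/Hd h1 h2].
    rewrite subrACA -scalerBl (le_lt_trans (ler_normB _ _))// normrZ.
    rewrite ltr_pdivlMr// in h2.
    have := h1 (ltac:(by rewrite /Rplus/= in_itv/= (le_trans s0))).
    have := normr_ge0 (q' - q); nra.
  - move=> q _ c c0; exists (c / z) => [|q' _ h]; first exact: divr_gt0.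
    by rewrite -mulrBr normrM gtr0_norm// mulrC -ltr_pdivlMr.
  - move=> q /andP[sq qr] c c0.
    have [|d dp Hd] := du q _ _ c0; first exact: (le_trans s0).
    exists d => // h h0 hd; have := Hd h h0 hd.
    have : `|u' q - u' s| <= z.
      apply: Hd0; [by apply/andP; split; lra|by apply/andP; split; lra|].
      by rewrite ger0_norm; lra.
    have -> : u (q + h) - (q + h) *: u' s - (u q - q *: u' s) =
        (u (q + h) - u q - h *: u' q) + h *: (u' q - u' s).
      rewrite subrACA -scalerBl (_ : q + h - q = h); last by ring.
      by rewrite scalerBr addrA subrK.
    move=> h1 h2; apply: (le_trans (ler_normD _ _)); rewrite normrZ gtr0_norm//.
    rewrite -mulrBr (_ : q + h - q = h); last by ring.
    have := ler_wpM2l (ltW h0) h1; lra.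
have [N N1 Nd] : exists2 N : nat, (0 < N)%N & t / N%:R < d0.
  exists (Num.truncn (t / d0)).+1 => //.
  have td : 0 <= t / d0 by rewrite divr_ge0// ltW.
  have /andP[_ h] := truncn_itv td.
  by rewrite ltr_pdivrMr ?ltr0n// mulrC -ltr_pdivrMr.
have Np : 0 < N%:R :> R by rewrite ltr0n.
pose del := t / N%:R; have del0 : 0 < del by exact: divr_gt0.
have Ndel : N%:R * del = t by rewrite /del mulrC divfK// gt_eqF.
(* small enough for the errors at all [N] nodes to add up to [z] *)
pose eta := z / (N%:R + 1).
have eta0 : 0 < eta by rewrite divr_gt0//; lra.
have etaz : (N%:R + 1) * eta = z by rewrite /eta mulrC divfK// gt_eqF//; lra.
have etaz' : eta <= z by rewrite -etaz -[leLHS]mul1r ler_wpM2r ?ltW//; lra.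
have /choice[wz Hwz] : forall j : nat, exists wz : X * X, [/\ A0 wz,
    `|wz.1 - u (j%:R * del)| <= eta & `|wz.2 - u' (j%:R * del)| <= eta].
  move=> j.
  have jd : 0 <= j%:R * del by rewrite mulr_ge0// ltW.
  have : closure A0 (u (j%:R * del), u' (j%:R * del)).
    by rewrite -gT; exact: generator_invariant.
  move=> /(_ (ball (u (j%:R * del), u' (j%:R * del)) eta)) [|[w z'] [Aw]].
    by apply: nbhsx_ballx.
  rewrite -ball_normE/= prod_normE/= gt_max => /andP[h1 h2].
  by exists (w, z'); split => //=; rewrite distrC ltW.
pose w j := (wz j).1.
have [C C0 HC] := continuous_bounded_segment t (lexx 0) cu'.
(* finitely many nodes share one consistency radius *)
have [d1 d10 Hd1] : exists2 d : R, 0 < d & forall j, (j <= N)%N -> forall h, 0 < h -> h < d ->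
    `|V h (w j) - w j - h *: (wz j).2| <= z * h.
  elim: (N) => [|k [d dp Hd]].
    have [A0w _ _] := Hwz 0%N; have [|d dp Hd] := HA (w 0%N) (wz 0%N).2 _ z z0.
      by rewrite /w -surjective_pairing.
    by exists d => // j; rewrite leqn0 => /eqP ->.
  have [A0w _ _] := Hwz k.+1; have [|d' dp' Hd'] := HA (w k.+1) (wz k.+1).2 _ z z0.
    by rewrite /w -surjective_pairing.
  exists (Num.min d d') => [|j]; first by rewrite lt_min dp.
  rewrite leq_eqVlt ltnS => /orP[/eqP -> h h0|jk h h0]; rewrite lt_min => /andP[hd hd'].
    exact: Hd'.
  exact: Hd.
have [n0 n01 Hn0] : exists2 n0 : nat, (0 < n0)%N & forall n, (n0 <= n)%N ->
    [/\ t / n%:R < d1, t / n%:R <= del & t / n%:R * C * N%:R <= z].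
  pose D := Num.min d1 (Num.min del (z / (C * N%:R + 1))).
  have CN : 0 < C * N%:R + 1 by rewrite ltr_wpDl// mulr_ge0// ltW.
  have D0 : 0 < D by rewrite !lt_min d10 del0 divr_gt0.
  exists (Num.truncn (t / D)).+1 => // n nn.
  have tD : 0 <= t / D by rewrite divr_ge0// ltW.
  have /andP[_ h] := truncn_itv tD.
  have np : 0 < n%:R :> R by rewrite ltr0n (leq_trans _ nn).
  have hD : t / n%:R < D.
    rewrite ltr_pdivrMr// mulrC -ltr_pdivrMr//; apply: (lt_le_trans h).
    by rewrite ler_nat.
  move: hD; rewrite !lt_min => /andP[h1 /andP[h2 h3]]; split => //; first exact: ltW.
  rewrite ltr_pdivlMr// in h3.
  have : 0 <= t / n%:R by rewrite divr_ge0// ltW.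
  move: h3; rewrite mulrDr mulr1 mulrA; lra.
exists n0 => n nn.
have nN : (0 < n)%N by exact: leq_trans nn.
have np : 0 < n%:R :> R by rewrite ltr0n.
have [hd1 hdel hC] := Hn0 n nn.
set h := t / n%:R in hd1 hdel hC *; have h0 : 0 < h by exact: divr_gt0.
(* [k j] steps of length [h] end within [h] of the node [j * del] *)
pose k j := ((j * n) %/ N)%N.
have kN : k N = n by rewrite /k mulnC mulnK.
have kmono : {homo k : i j / (i <= j)%N} by move=> i j ij; rewrite /k leq_div2r// leq_mul2r ij orbT.
have k00 : k 0%N = 0%N by rewrite /k mul0n div0n.
have lVh := lV h (ltW h0).
have stab i y : (i <= k N)%N -> `|iter i (V h) y| <= K * `|y|.
  by rewrite kN => ikn; exact: HK.
have := @telescope_le (V h) K k w N lVh kmono k00 stab.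
rewrite kN => tel.
have piece (j : 'I_N) : `|iter (k j.+1 - k j) (V h) (w j) - w j.+1| <=
    K * (12 * z * del + (z * del + 2 * eta + h * C)).
  set m := (k j.+1 - k j)%N.
  have jN : (j < N)%N by [].
  have jt : j%:R * del <= t.
    by rewrite -Ndel; apply: ler_wpM2r; [exact: ltW|rewrite ler_nat ltnW].
  have jt1 : j.+1%:R * del <= t by rewrite -Ndel; apply: ler_wpM2r; [exact: ltW|rewrite ler_nat].
  have jp : 0 <= j%:R * del by rewrite mulr_ge0// ltW.
  have jj : j.+1%:R * del = j%:R * del + del by rewrite -natr1 mulrDl mul1r.
  have mh : `|m%:R * h - del| <= h.
    have mE : m%:R = (k j.+1)%:R - (k j)%:R :> R by rewrite /m natrB// kmono.
    have kb i : ((k i)%:R * N%:R <= i%:R * n%:R :> R) /\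
        (i%:R * n%:R < ((k i)%:R + 1) * N%:R :> R).
      split; first by rewrite -!natrM ler_nat leq_divM.
      by rewrite natr1 -!natrM ltr_nat ltn_ceil.
    have [a1 a2] := kb j; have [b1 b2] := kb j.+1.
    have E : m%:R * h - del = (m%:R * N%:R - n%:R) * (h / N%:R).
      by rewrite /del /h; field; rewrite !gt_eqF.
    rewrite E normrM (ger0_norm (divr_ge0 (ltW h0) (ltW Np))).
    have hN0 : 0 <= h / N%:R by rewrite divr_ge0// ltW.
    have : `|m%:R * N%:R - n%:R| <= N%:R :> R.
      by move: b1 b2; rewrite mE -[j.+1%:R]natr1 ler_norml => b1 b2; apply/andP; split; lra.
    move=> /(ler_wpM2r hN0)/le_trans; apply.
    by rewrite mulrCA mulfV ?mulr1 ?gt_eqF.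
  set zeta := u' (j%:R * del).
  have [A1 W1 Z1] := Hwz j; have [A2 W2 Z2] := Hwz j.+1.
  have U12 : `|u' (j.+1%:R * del) - zeta| <= z.
    apply: Hd0; [by apply/andP; split; lra|by apply/andP; split; lra|].
    by rewrite jj addrAC subrr add0r gtr0_norm.
  have cons v y : `|V h v - v - h *: y| <= z * h -> `|y - zeta| <= z + z ->
      `|V h v - v - h *: zeta| <= 3 * z * h.
    move=> h1 h2; have -> : V h v - v - h *: zeta = (V h v - v - h *: y) + h *: (y - zeta).
      by rewrite scalerBr addrA subrK.
    apply: (le_trans (ler_normD _ _)); rewrite normrZ gtr0_norm//.
    have := ler_wpM2l (ltW h0) h2; lra.
  have C1 : `|V h (w j) - w j - h *: zeta| <= 3 * z * h.
    by apply: (cons _ (wz j).2); [apply: Hd1 => //; exact: ltnW|lra].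
  have C2 : `|V h (w j.+1) - w j.+1 - h *: zeta| <= 3 * z * h.
    apply: (cons _ (wz j.+1).2); first exact: Hd1.
    have := ler_normD ((wz j.+1).2 - u' (j.+1%:R * del)) (u' (j.+1%:R * del) - zeta).
    by rewrite addrA subrK; lra.
  have stabm i y : (i <= m)%N -> `|iter i (V h) y| <= K * `|y|.
    move=> im; apply: stab; rewrite (leq_trans im)// (leq_trans (leq_subr _ _))//.
    exact: kmono.
  apply: (le_trans (chord_step lVh (ltW h0) K0 stabm C1 C2)).
  rewrite ler_wpM2l//; apply: lerD.
    have : m%:R * h <= 2 * del by move: mh; rewrite ler_norml => /andP[_]; lra.
    have zz : 0 <= 6 * z by lra.
    move=> /(ler_wpM2l zz).
    have : 0 <= z * del by rewrite mulr_ge0// ltW.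
    by lra.
  have -> : w j.+1 - w j - (m%:R * h) *: zeta =
      (w j.+1 - u (j.+1%:R * del)) - (w j - u (j%:R * del)) +
      (u (j.+1%:R * del) - u (j%:R * del) - del *: zeta) - (m%:R * h - del) *: zeta.
    rewrite [in RHS]subrACA addrA subrK scalerBl opprB addrA subrK//.
  have ty := taylor (j%:R * del) (j.+1%:R * del) jp.
  have jd : j.+1%:R * del - j%:R * del = del by rewrite jj addrAC subrr add0r.
  rewrite jd in ty.
  have {}ty : `|u (j.+1%:R * del) - u (j%:R * del) - del *: zeta| <= z * del.
    by apply: ty => //; rewrite jj; lra.
  have zC : `|(m%:R * h - del) *: zeta| <= h * C.
    rewrite normrZ ler_pM//; apply: HC; apply/andP; split => //.
  apply: (le_trans (ler_normB _ _)).
  have := ler_normD (w j.+1 - u (j.+1%:R * del) - (w j - u (j%:R * del)))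
      (u (j.+1%:R * del) - u (j%:R * del) - del *: zeta).
  have := ler_normB (w j.+1 - u (j.+1%:R * del)) (w j - u (j%:R * del)).
  by move: W1 W2; rewrite -/(w j) -/(w j.+1); lra.
have tot : `|iter n (V h) (w 0%N) - w N| <= K * (K * ((13 * t + 3) * z)).
  apply: (le_trans tel); rewrite ler_wpM2l//.
  apply: (@le_trans _ _ (\sum_(j < N) (K * (12 * z * del + (z * del + 2 * eta + h * C))))).
    by apply: ler_sum => j _; exact: piece.
  rewrite sumr_const card_ord -[leLHS]mulr_natl mulrCA ler_wpM2l//.
  rewrite !mulrDr.
  have : N%:R * (2 * eta) <= 2 * z by rewrite -etaz; lra.
  have -> : N%:R * (12 * z * del) = 12 * z * t by rewrite -Ndel; ring.
  have -> : N%:R * (z * del) = z * t by rewrite -Ndel; ring.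
  by move: hC; lra.
have [_ W0 _] := Hwz 0%N; have [_ WN _] := Hwz N.
rewrite mul0r /u (C0_id hT) in W0; rewrite Ndel in WN.
have S0 := HK n n (w 0%N - x1) nN (leqnn n).
have lVn := iter_linear n lVh.
rewrite -/h (linear_funB lVn) in S0.
have -> : iter n (V h) x1 - T t x1 =
  (iter n (V h) (w 0%N) - w N) + (w N - T t x1) - (iter n (V h) (w 0%N) - iter n (V h) x1).
  by rewrite addrA subrK opprB [RHS]addrC addrA subrK.
apply: (le_trans (ler_normB _ _)).
have := ler_normD (iter n (V h) (w 0%N) - w N) (w N - T t x1).
have eE : e = z * B by rewrite /z divfK// gt_eqF.
rewrite eE /B.
have : K * `|w 0%N - x1| <= K * z by rewrite ler_wpM2l// (le_trans W0).
by move: WN; rewrite -/(u t) -/(w N); lra.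
Qed.

End chernoff.

(** * Smooth functions with compact support *)

Section bump.
Context {R : realType}.

Lemma is_derive_of_increment (f : R -> R) (x df : R) :
  (forall e, 0 < e -> exists2 d : R, 0 < d &
    forall h, `|h| < d -> `|f (x + h) - f x - h * df| <= e * `|h|) ->
  is_derive x 1 f df.
Proof.
move=> H.
have C : h^-1 *: (f (h *: 1 + x) - f x) @[h --> 0^'] --> df.
  apply/cvgrPdist_le => e e0; have [d d0 Hd] := H e e0.
  rewrite /dnbhs near_withinE; apply/nbhs_ballP; exists d => // h.
  rewrite /ball/= sub0r normrN => hd h0.
  rewrite [_ *: 1]mulr1 (addrC h).
  have hp : 0 < `|h| by rewrite normr_gt0.
  have -> : df - h^-1 *: (f (x + h) - f x) = - (h^-1 * (f (x + h) - f x - h * df)).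
    by rewrite /GRing.scale/= [in RHS]mulrBr mulKf// opprB.
  rewrite normrN normrM normfV ler_pdivrMl// [leRHS]mulrC; exact: Hd.
by apply: DeriveDef; [apply/cvg_ex; exists df|exact/cvg_lim].
Qed.

(** [y ^- k * expR (- y^-1)], extended by 0 to [y <= 0]; the factors [y ^- k]
    make the family stable under differentiation. *)
Definition flat (k : nat) (y : R) : R :=
  if 0 < y then y^-1 ^+ k * expR (- y^-1) else 0.

Lemma flat_ge0 k y : 0 <= flat k y.
Proof.
by rewrite /flat; case: ifP => // y0; rewrite mulr_ge0 ?expR_ge0 ?exprn_ge0 ?invr_ge0 ?ltW.
Qed.

(** Exponential decay at 0 beats every power; a quadratic bound is what the
    derivative at 0 needs. *)
Lemma flat_le k y : flat k y <= k.+2`!%:R * y ^+ 2.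
Proof.
rewrite /flat; case: ifPn => [y0|_]; last by rewrite mulr_ge0 ?sqr_ge0.
have iy : 0 < y^-1 by rewrite invr_gt0.
have H := expR_ge1Dxn k.+1 (ltW iy).
have fp : 0 < k.+2`!%:R :> R by rewrite ltr0n fact_gt0.
rewrite expRN ler_pdivrMr ?expR_gt0//.
have : y^-1 ^+ k.+2 / k.+2`!%:R <= expR y^-1 by lra.
rewrite ler_pdivrMr// => /(ler_wpM2r (sqr_ge0 y)).
have -> : y^-1 ^+ k.+2 * y ^+ 2 = y^-1 ^+ k.
  rewrite -addn2 exprD -mulrA -exprMn mulVf ?gt_eqF// expr1n mulr1//.
by move/le_trans; apply; rewrite le_eqVlt; apply/orP; left; apply/eqP; ring.
Qed.

Lemma is_derive_flat k (y : R) :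
  is_derive y 1 (flat k) (- (k%:R * flat k.+1 y) + flat k.+2 y).
Proof.
have [y0|y0|->] := ltgtP y 0.
- have E : \forall z \near y, flat k z = cst 0 z.
    near=> z; rewrite /flat /cst ifF//; apply/negbTE; rewrite -leNgt ltW//.
    by near: z; exact: lt_nbhsl.
  have -> : - (k%:R * flat k.+1 y) + flat k.+2 y = 0.
    by rewrite /flat !ifF ?mulr0 ?oppr0 ?addr0//; apply/negbTE; rewrite -leNgt ltW.
  by apply: (near_eq_is_derive (f := cst 0)) => //; apply: filterS E => z ->.
- have E : \forall z \near y, flat k z = z^-1 ^+ k * expR (- z^-1).
    near=> z; rewrite /flat ifT//.
    by near: z; exact: lt_nbhsr.
  have yn0 : y != 0 by rewrite gt_eqF.
  apply: (near_eq_is_derive (f := fun z : R => z^-1 ^+ k * expR (- z^-1) : R)).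
    by apply: filterS E => z ->.
  rewrite /flat !ifT//.
  have dV : is_derive y 1 (fun z : R => z^-1) (- y ^- 2).
    by have := @is_deriveV R id y 1 1 yn0 (is_derive_id y 1); rewrite [_ *: 1]mulr1.
  have dN : is_derive y 1 (fun z : R => - z^-1) (- (- y ^- 2)) by exact: is_deriveN.
  have dE := @is_derive1_comp R expR (fun z => - z^-1) y _ _ (is_derive_expR _) dN.
  have dX : is_derive y 1 (fun z : R => z^-1 ^+ k) (- (k%:R * y^-1 ^+ k.+1)).
    elim: (k) => [|m IH].
      rewrite mul0r oppr0 (_ : (fun _ => _) = cst 1); first exact: is_derive_cst.
      by apply/funext => z; rewrite expr0.
    rewrite (_ : (fun z : R => z^-1 ^+ m.+1) = (fun z => z^-1) * (fun z => z^-1 ^+ m)).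
      apply: (is_derive_eq (is_deriveM dV IH)).
      by rewrite /GRing.scale/= -exprVn -[m.+1%:R]natr1 !exprS; ring.
    by apply/funext => z; rewrite exprS.
  apply: (is_derive_eq (is_deriveM dX dE)).
  by rewrite /= /GRing.scale/= -exprVn !exprS; ring.
- apply: is_derive_of_increment => e e0.
  have F0 j : flat j 0 = 0 by rewrite /flat ltxx.
  have fp : 0 < k.+2`!%:R :> R by rewrite ltr0n fact_gt0.
  exists (e / k.+2`!%:R) => [|h]; first exact: divr_gt0.
  rewrite ltr_pdivlMr// => hd; rewrite add0r !F0.
  rewrite (_ : _ - _ - _ = flat k h); last by ring.
  rewrite ger0_norm ?flat_ge0//; apply: (le_trans (flat_le k h)).
  rewrite -(real_normK (num_real h)) expr2 mulrA ler_wpM2r//.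
  by rewrite mulrC ltW.
Unshelve. all: by end_near.
Qed.

Definition bump (m r x : R) : R := flat 0 (r ^+ 2 - (x - m) ^+ 2).

(** A space of functions containing the bump and stable under differentiation. *)
Inductive bump_span (m r : R) : (R -> R) -> Prop :=
| bump_span0 : bump_span m r (fun=> 0)
| bump_spanD c j k f : bump_span m r f -> bump_span m r
    (fun x => c * (x - m) ^+ j * flat k (r ^+ 2 - (x - m) ^+ 2) + f x).

Lemma bump_span_derive (m r : R) f : bump_span m r f ->
  exists2 g, bump_span m r g & forall x : R, is_derive x 1 f (g x).
Proof.
elim => [|c j k {}f _ [g gs df]].
  by exists (fun=> 0); [exact: bump_span0|move=> x; exact: is_derive_cst].
pose q (x : R) : R := r ^+ 2 - (x - m) ^+ 2.
exists (fun x => c * j%:R * (x - m) ^+ j.-1 * flat k (q x) +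
  (2 * c * k%:R * (x - m) ^+ j.+1 * flat k.+1 (q x) +
  (- 2 * c * (x - m) ^+ j.+1 * flat k.+2 (q x) + g x))).
  by do 3 apply: bump_spanD.
move=> x; have {}df := df x.
have dx : is_derive x 1 (fun y : R => y - m) 1.
  by apply: (is_derive_eq (is_deriveB (is_derive_id x 1) (is_derive_cst m x 1))); rewrite subr0.
have dp i : is_derive x 1 (fun y : R => (y - m) ^+ i) (i%:R * (x - m) ^+ i.-1).
  elim: i => [|i IH].
    rewrite mul0r (_ : (fun _ => _) = cst 1); first exact: is_derive_cst.
    by apply/funext => z; rewrite expr0.
  rewrite (_ : (fun y : R => (y - m) ^+ i.+1) = (fun y => y - m) * (fun y => (y - m) ^+ i)).
    apply: (is_derive_eq (is_deriveM dx IH)).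
    rewrite /GRing.scale/= -[i.+1%:R]natr1 mulr1; case: (i) => [|l].
      by rewrite mul0r mulr0 expr0; ring.
    by rewrite /= exprS; ring.
  by apply/funext => y; rewrite exprS.
have dq : is_derive x 1 q (- (2 * (x - m))).
  apply: (is_derive_eq (is_deriveB (is_derive_cst (r ^+ 2) x 1) (dp 2%N))).
  by rewrite /= expr1; ring.
have dF := @is_derive1_comp R (flat k) q x _ _ (is_derive_flat k (q x)) dq.
have dc := is_deriveM (is_derive_cst c x 1) (dp j).
apply: (is_derive_eq (is_deriveD (is_deriveM dc dF) df)).
rewrite /GRing.scale/= /cst/= !exprS -/(q x).
rewrite (_ : ((fun=> c) * (fun y : R => (y - m) ^+ j)) x = c * (x - m) ^+ j) //; ring.
Qed.

Lemma bump_span_derive1n (m r : R) f n : bump_span m r f ->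
  bump_span m r (derive1n n f).
Proof.
move=> fs; elim: n => // n IH; rewrite derive1nS.
have [g gs dg] := bump_span_derive IH.
rewrite (_ : derive1 _ = g)//; apply/funext => x.
by rewrite derive1E; apply: derive_val.
Qed.

Definition smooth_supported (a b : R) (phi : R -> R) :=
  (forall n (x : R), derivable (derive1n n phi) x 1) /\
  (forall x, x \notin `[a, b] -> phi x = 0).

Lemma bump_smooth m r : 0 < r -> smooth_supported (m - r) (m + r) (bump m r).
Proof.
move=> r0; split => [n x|x].
  have : bump_span m r (bump m r).
    rewrite (_ : bump m r = fun x => 1 * (x - m) ^+ 0 * flat 0 (r ^+ 2 - (x - m) ^+ 2) + 0).
      by apply: bump_spanD; exact: bump_span0.
    by apply/funext => y; rewrite expr0 !mul1r addr0.
  move=> /(bump_span_derive1n n)/bump_span_derive[g _ dg].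
  by have [] := dg x.
rewrite in_itv/= negb_and -!ltNge => h; rewrite /bump /flat ifF//.
apply/negbTE; rewrite -leNgt subr_le0 -(real_normK (num_real (x - m))).
rewrite ler_sqr ?nnegrE// ?(ltW r0)// ler_normr.
by case/orP: h => h; apply/orP; [right|left]; lra.
Qed.

Lemma bump_ge0 m r x : 0 <= bump m r x. Proof. exact: flat_ge0. Qed.

Lemma bump_gt0 m r x : `|x - m| < r -> 0 < bump m r x.
Proof.
move=> h; rewrite /bump /flat ifT ?mulr_gt0 ?expR_gt0//.
rewrite subr_gt0 -(real_normK (num_real (x - m))) ltr_sqr ?nnegrE//.
exact: le_trans (ltW h).
Qed.

Lemma smooth_supported_test a b phi :
  0 < a -> smooth_supported a b phi -> test_function phi.
Proof. by move=> a0 [d s]; split => //; exists a, b. Qed.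

Lemma smooth_supported_derive a b phi :
  smooth_supported a b phi -> smooth_supported a b (derive1 phi).
Proof.
move=> [d s]; split=> [n x|x xab]; first by rewrite -derive1Sn.
rewrite derive1E (near_eq_derive (g := cst 0)) ?derive_cst//.
have : open (~` `[a, b]%classic : set R) by apply: closed_openC; exact: itv_closed.
move=> /(_ x) H; have : nbhs x (~` `[a, b]%classic : set R).
  by apply: open_nbhs_nbhs; split; [apply: closed_openC; exact: itv_closed|apply/negP].
by apply: filterS => y /= yab; rewrite s//; apply/negP.
Qed.

Lemma smooth_supported_shift a b c phi : smooth_supported a b phi ->
  smooth_supported (a + c) (b + c) (fun x => phi (x - c)).
Proof.
move=> [d s].
have E (f : R -> R) : derive1 (fun x => f (x - c)) = (fun x => derive1 f (x - c)).
  by apply/funext => x; rewrite /derive1; under eq_fun do rewrite -addrA.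
have En n : derive1n n (fun x => phi (x - c)) = (fun x => derive1n n phi (x - c)).
  by elim: n => // n IH; rewrite !derive1nS IH E.
split=> [n x|x]; last first.
  rewrite in_itv/= => xab; apply: s; rewrite in_itv/=.
  by apply: contra xab => /andP[h1 h2]; apply/andP; split; lra.
rewrite En.
have dx : is_derive x 1 (fun y : R => y - c) 1.
  by apply: (is_derive_eq (is_deriveB (is_derive_id x 1) (is_derive_cst c x 1))); rewrite subr0.
have /derivableP dn := d n (x - c).
by have [] := @is_derive1_comp R (derive1n n phi) (fun y => y - c) x _ _ dn dx.
Qed.

Lemma smooth_supported_is_derive a b phi (x : R) : smooth_supported a b phi ->
  is_derive x 1 phi (derive1 phi x).
Proof. by move=> [d _]; rewrite derive1E; apply/derivableP; exact: (d 0%N). Qed.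

Lemma smooth_supported_continuous a b phi (D : set R) x :
  smooth_supported a b phi -> @continuous_at_in R R^o phi D x.
Proof.
move=> [d _] e e0; have /derivable1_diffP/differentiable_continuous := d 0%N x.
move=> /cvgrPdist_lt /(_ e e0) /nbhs_ballP[z z0 Hz]; exists z => // r _ rx.
by rewrite distrC; apply: Hz; rewrite /ball/= distrC.
Qed.

Lemma smooth_supported_bounded a b phi : smooth_supported a b phi ->
  exists2 M : R, 0 <= M & forall x, `|phi x| <= M.
Proof.
move=> sphi; have [ab|ba] := leP a b; last first.
  exists 0 => // x; rewrite sphi.2 ?normr0// in_itv/=.
  by apply/negP => /andP[h1 h2]; have := le_trans h1 h2; rewrite leNgt ba.
have [|c cab Hc] := @EVT_max _ (fun s => `|phi s|) a b ab.
  apply/(within_continuousP (X := R^o)) => s _.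
  apply: (continuous_at_in_le (u := phi : R -> R^o)) => [r|]; first exact: ler_dist_dist.
  exact: smooth_supported_continuous sphi.
exists `|phi c| => // x; have [/Hc//|/sphi.2 ->] := boolP (x \in `[a, b]).
by rewrite normr0.
Qed.

Lemma derive_bound_increment (w dw : R -> R) x y M : x <= y ->
  (forall s : R, is_derive s 1 w (dw s)) -> (forall s, x <= s <= y -> `|dw s| <= M) ->
  `|w y - w x| <= M * (y - x).
Proof.
move=> xy d dM; have [|c cxy ->] := MVT_segment xy (fun s _ => d s).
  by apply: derivable_within_continuous => s _; have [] := d s.
rewrite normrM (ger0_norm (_ : 0 <= y - x)) ?subr_ge0// ler_wpM2r ?subr_ge0//.
exact: dM.
Qed.

Lemma smooth_supported_lipschitz a b phi : smooth_supported a b phi ->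
  exists2 M : R, 0 <= M & forall x y, `|phi x - phi y| <= M * `|x - y|.
Proof.
move=> sphi; have [M M0 HM] := smooth_supported_bounded (smooth_supported_derive sphi).
have H x y : x <= y -> `|phi y - phi x| <= M * (y - x).
  move=> xy; apply: derive_bound_increment (fun s _ => HM s) => // s.
  exact: smooth_supported_is_derive sphi.
exists M => // x y; have [xy|/ltW yx] := leP x y; last first.
  by rewrite (ger0_norm (_ : 0 <= x - y)) ?subr_ge0//; exact: H.
by rewrite distrC (distrC x) (ger0_norm (_ : 0 <= y - x)) ?subr_ge0//; exact: H.
Qed.

Lemma smooth_supported_taylor a b phi : smooth_supported a b phi ->
  exists2 M : R, 0 <= M & forall x h, 0 <= h ->
    `|phi (x + h) - phi x - h * derive1 phi x| <= M * h ^+ 2.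
Proof.
move=> sphi; have [M M0 HM] := smooth_supported_lipschitz (smooth_supported_derive sphi).
exists M => // x h h0; pose D := derive1 phi x.
pose w q := phi (x + q) - q * D.
have -> : phi (x + h) - phi x - h * D = w h - w 0.
  by rewrite /w addr0 mul0r subr0 addrAC.
have dw (s : R) : is_derive s 1 w (derive1 phi (x + s) - D).
  have dx : is_derive s 1 (fun q : R => x + q) 1.
    by apply: (is_derive_eq (is_deriveD (is_derive_cst x s 1) (is_derive_id s 1))); rewrite add0r.
  have dphi := @is_derive1_comp R phi (fun q => x + q) s _ _
    (smooth_supported_is_derive (x + s) sphi) dx.
  have dl := is_deriveM (is_derive_id s 1) (is_derive_cst D s 1).
  by apply: (is_derive_eq (is_deriveB dphi dl)); rewrite /GRing.scale/= /cst; ring.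
have -> : M * h ^+ 2 = M * h * (h - 0) by ring.
apply: (derive_bound_increment h0 dw) => s /andP[s0 sh].
apply: (le_trans (HM _ _)); rewrite (_ : x + s - x = s); last by ring.
by rewrite ger0_norm// ler_wpM2l.
Qed.

End bump.

(** * Translation and the L^1 norm near the boundary *)

Section translation.
Context {R : realType}.
Notation mu := (@lebesgue_measure R).

(** Both sides are measures that agree on half-open intervals. *)
Lemma lebesgue_measure_translate (t : R) (A : set R) : measurable A ->
  pushforward mu ((fun x => x + t) : _ -> measurableTypeR R) A = mu A.
Proof.
have mt : measurable_fun setT ((fun x => x + t) : R -> measurableTypeR R).
  exact: measurable_funD.
move=> mA; apply/esym/lebesgue_measure_unique => //= _ [[a b]] _ <-.
rewrite /pushforward.
have -> : (fun x => x + t) @^-1` (`]a, b]%classic : set R) = `]a - t, b - t]%classic.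
  by apply/seteqP; split => x /=; rewrite !in_itv/= ltrBlDr lerBrDr.
rewrite !lebesgue_measure_itv/= !lte_fin ltrD2r; case: ifP => // _.
by congr _%:E; ring.
Qed.

Lemma integral_translate (t : R) (G : R -> \bar R) : measurable_fun setT G ->
  (forall x, 0 <= G x)%E ->
  (\int[mu]_x G (x + t)%R = \int[mu]_x G x)%E.
Proof.
move=> mG G0.
have mt : measurable_fun setT ((fun x => x + t) : R -> measurableTypeR R).
  exact: measurable_funD.
transitivity (\int[pushforward mu ((fun x => x + t)%R : _ -> measurableTypeR R)]_(x in setT) G x)%E.
  by rewrite ge0_integral_pushforward.
by apply: eq_measure_integral => //= A mA _; exact: lebesgue_measure_translate.
Qed.

End translation.

(** Lets [filterS] act on almost everywhere statements. *)
#[export] Instance lebesgue_ae_filter (R : realType) :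
  Filter (nbhs (almost_everywhere (@lebesgue_measure R))).
Proof. exact: ae_filter_ringOfSetsType. Qed.

Section local_norm.
Context {R : realType} (E : normedModType R).
Notation mu := (@lebesgue_measure R).

Lemma strongly_measurable_restrict (f : R -> E) (a b : R) :
  strongly_measurable f -> strongly_measurable (window a b f).
Proof.
move=> [s_ [ss sf]]; exists (fun n => window a b (s_ n)); split.
  by move=> n; apply: simple_fun_restrict => //; exact: measurable_window.
by move=> x; rewrite /window; case: asboolP => _; [exact: sf|exact: cvg_cst].
Qed.

Lemma int_norm_ae_le (F : normedModType R) (f : R -> E) (g : R -> F) :
  strongly_measurable f -> strongly_measurable g ->
  (\forall x \ae mu, Rplus x -> `|f x| <= `|g x|) ->
  (int_norm f <= int_norm g)%E.
Proof.
move=> mf mg fg; apply: ae_ge0_le_integral.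
- exact: measurable_Rplus.
- by move=> x _; rewrite lee_fin.
- exact: measurable_EFin_norm.
- by move=> x _; rewrite lee_fin.
- exact: measurable_EFin_norm.
- by apply: filterS fg => x h Rx; rewrite lee_fin; exact: h.
Qed.

Lemma bochner_ae (f g : R -> E) v : strongly_measurable g ->
  f = g %[ae mu in Rplus] -> is_bochner_integral f v -> is_bochner_integral g v.
Proof.
move=> mg fg [mf [s_ [is_ fs sv]]]; split => //; exists s_; split => //.
have ms n : strongly_measurable (s_ n).
  by apply: simple_strongly_measurable; case: (is_ n).
have E1 n : int_norm (g - s_ n) = int_norm (f - s_ n).
  apply/eqP; rewrite eq_le; apply/andP; split; apply: int_norm_ae_le;
    try exact: strongly_measurableB.
    by apply: filterS fg => x h Rx; rewrite /GRing.add/= h.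
  by apply: filterS fg => x h Rx; rewrite /GRing.add/= h.
rewrite (_ : (fun n => _) = fun n => int_norm (f - s_ n))//.
by apply/funext => n; exact: E1.
Qed.

End local_norm.

Section head_norm.
Context {R : realType} (E : normedModType R) (p : R) (p1 : 1 <= p).
Notation mu := (@lebesgue_measure R).
Notation F := (Lp E p1).
Implicit Types u v : F.

Let p0 : 0 < p. Proof. by move: p1; lra. Qed.

Lemma Lp_repr_linear (a : R) u v :
  Lp_repr (a *: u + v) = a *: Lp_repr u + Lp_repr v %[ae mu in Rplus].
Proof.
have : Lp_class (repr (a *: u + v)) = Lp_class (a *: repr u + repr v).
  by rewrite Lp_classD Lp_classZ !Lp_class_repr.
by move=> /eqP/Lp_eqP.
Qed.

(** The L^1 norm over [0, b); it controls what the boundary values of the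
    translates of a function contribute up to time [b]. *)
Definition head_norm (b : R) u : R := fine (int_norm (window 0 b (Lp_repr u))).

Lemma measurable_head b u : strongly_measurable (window 0 b (Lp_repr u)).
Proof. by apply: strongly_measurable_restrict; exact: Lp_repr_measurable. Qed.

(** Pointwise [y <= 1 + y `^ p]. *)
Lemma head_norm_lty b u : (int_norm (window 0 b (Lp_repr u)) <= (Num.max 0 b + `|u| `^ p)%:E)%E.
Proof.
pose b' := Num.max 0 b; have b'0 : 0 <= b' by rewrite le_max lexx.
have m1 := measurable_window1 0 b'.
have := @int_norm_window1 R 0 b' (lexx 0) b'0; rewrite subr0 => I1.
rewrite EFinD -I1 -Lp_repr_integral unlock /int_norm -ge0_integralD; last 5 first.
- exact: measurable_Rplus.
- by move=> x _; rewrite lee_fin.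
- exact: measurable_EFin_norm.
- by move=> x _; rewrite lee_fin powR_ge0.
- by apply: Lp_integrand_measurable; exact: Lp_repr_measurable.
apply: ge0_le_integral.
- exact: measurable_Rplus.
- by move=> x _; rewrite lee_fin.
- by apply: measurable_EFin_norm; exact: measurable_head.
- apply: emeasurable_funD; first exact: measurable_EFin_norm.
  by apply: Lp_integrand_measurable; exact: Lp_repr_measurable.
move=> x _; rewrite -EFinD lee_fin /window; case: asboolP => [/andP[x0 xb]|_]; last first.
  by rewrite normr0 addr_ge0 ?powR_ge0.
rewrite asboolT; last by rewrite x0/= lt_max xb orbT.
rewrite /= normr1; have [h|h] := leP `|Lp_repr u x| 1.
  by rewrite (le_trans h)// lerDl powR_ge0.
rewrite -[leLHS]add0r lerD// -[leLHS]powRr1// ler_powR//; exact: ltW.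
Qed.

Lemma head_norm_fin b u : int_norm (window 0 b (Lp_repr u)) = (head_norm b u)%:E.
Proof.
rewrite fineK// ge0_fin_numE ?int_norm_ge0//.
exact: le_lt_trans (head_norm_lty b u) (ltry _).
Qed.

Lemma head_norm_ge0 b u : 0 <= head_norm b u.
Proof. by rewrite fine_ge0// int_norm_ge0. Qed.

Lemma head_norm_linear b a u v :
  head_norm b (a *: u + v) <= `|a| * head_norm b u + head_norm b v.
Proof.
rewrite -lee_fin EFinD EFinM -!head_norm_fin.
have mu_ := measurable_head b u; have mv := measurable_head b v.
rewrite -int_normZ//; apply: le_trans (int_normD _ _) => //; last exact: strongly_measurableZ.
apply: int_norm_ae_le.
- exact: measurable_head.
- by apply: strongly_measurableD => //; exact: strongly_measurableZ.
apply: filterS (Lp_repr_linear a u v) => x /= h Rx.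
rewrite [X in _ <= `|X|](_ : _ = window 0 b (a *: Lp_repr u + Lp_repr v) x).
  by rewrite /window h.
rewrite /window; case: asboolP => [xb|xb].
  by rewrite /GRing.add/= /GRing.scale/= asboolT.
by rewrite /GRing.add/= /GRing.scale/= asboolF// scaler0 addr0.
Qed.

Lemma head_norm0 b : head_norm b (0 : F) = 0.
Proof.
rewrite /head_norm (_ : int_norm _ = 0%E)//.
apply/eqP; rewrite eq_le int_norm_ge0 andbT.
have m0 : strongly_measurable (fun _ : R => 0 : E) by exact: strongly_measurable_cst.
rewrite (_ : 0%E = int_norm (fun _ : R => 0 : E)); last first.
  by symmetry; apply: integral0_eq => x _; rewrite normr0.
apply: int_norm_ae_le => //; first exact: measurable_head.
have : Lp_repr (0 : F) = (0 : Lp_function E p1) %[ae mu in Rplus].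
  apply/Lp_eqP; rewrite -/(Lp_class _) -/(Lp_class _) Lp_class_repr.
  by rewrite /Lp_class pi_Lp0.
by apply: filterS => x h Rx; rewrite /window; case: asboolP => _ //; rewrite h.
Qed.

(** The previous bound, applied to [u] scaled to norm 1. *)
Lemma head_norm_le b u : 0 <= b -> head_norm b u <= (1 + b) * `|u|.
Proof.
move=> b0.
have H v : head_norm b v <= b + `|v| `^ p.
  rewrite -lee_fin -head_norm_fin (le_trans (head_norm_lty b v))//.
  by rewrite lee_fin lerD2r ge_max b0 lexx.
have Z := head_norm0 b.
have [->|u0] := eqVneq u 0; first by rewrite Z normr0 mulr0.
have nu : 0 < `|u| by rewrite normr_gt0.
have := H (`|u|^-1 *: u); rewrite normrZ ger0_norm ?invr_ge0// mulVf ?gt_eqF// powR1 => h1.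
have := head_norm_linear b `|u| (`|u|^-1 *: u) 0.
rewrite addr0 scalerA mulfV ?gt_eqF// scale1r Z addr0 normr_id => h2.
by apply: (le_trans h2); rewrite mulrC ler_wpM2r// addrC.
Qed.

End head_norm.

(** * Pairing with test functions *)

Lemma telescoping_sum (V : zmodType) (x y z q r : V) :
  x - z = (- q + (- y + x)) + (q - r) + (r + (- z + y)).
Proof.
rewrite (addrACA (- q)) addNr add0r addrA subrK [- z + y]addrC addrACA addNr.
by rewrite add0r.
Qed.

Section pairing.
Context {R : realType} (E : completeNormedModType R) (p : R) (p1 : 1 <= p).
Notation mu := (@lebesgue_measure R).
Notation F := (Lp E p1).
Implicit Types u : F.

Definition weight (K : R) (phi : R -> R) :=
  (forall x, @continuous_at_in R R^o phi setT x) /\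
  (forall x, ~~ (0 <= x < K) -> phi x = 0).

Lemma weight_linear K a phi psi : weight K phi -> weight K psi ->
  weight K (fun x => a * phi x + psi x).
Proof.
move=> [cphi sphi] [cpsi spsi]; split; last first.
  by move=> x xK; rewrite sphi// spsi// mulr0 addr0.
move=> x e e0; have e2 : 0 < e / 2 by lra.
have a1 : 0 < `|a| + 1 by have := normr_ge0 a; lra.
have [d d0 Hd] := cphi x _ (divr_gt0 e2 a1); have [d' d'0 Hd'] := cpsi x _ e2.
exists (Num.min d d') => [|r _]; first by rewrite lt_min d0.
rewrite lt_min => /andP[/(Hd _ Logic.I) h1 /(Hd' _ Logic.I) h2].
have -> : a * phi r + psi r - (a * phi x + psi x) = a * (phi r - phi x) + (psi r - psi x) by ring.
rewrite (le_lt_trans (ler_normD _ _))// normrM.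
rewrite ltr_pdivlMr// in h1.
by move: h1 h2; have := normr_ge0 (phi r - phi x); set A := `|phi r - phi x|;
  set B := `|psi r - psi x|; nra.
Qed.

Lemma weight_measurable K phi : weight K phi -> @strongly_measurable R R^o phi.
Proof.
move=> [cphi sphi].
have -> : phi = window 0 K (phi : R -> R^o).
  by apply/funext => x; rewrite /window; case: asboolP => // /negP/sphi.
apply: strongly_measurable_window => // s _.
exact: continuous_at_inS (@subsetT _ _) (cphi s).
Qed.

Lemma weighted_measurable K phi u : weight K phi ->
  strongly_measurable (fun s => phi s *: Lp_repr u s).
Proof.
move=> /weight_measurable[s_ [ss sphi]]; have [t_ [st tu]] := Lp_repr_measurable u.
exists (fun n x => s_ n x *: t_ n x); split.
  move=> n; exact: (simple_fun_comp (fun v : (R^o * E)%type => v.1 *: v.2)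
    (simple_fun_pair (ss n) (st n))).
by move=> x; apply: cvgZ; [exact: sphi|exact: tu].
Qed.

Lemma weighted_int_norm K phi u M : 0 <= K -> weight K phi -> 0 <= M ->
  (forall x, `|phi x| <= M) ->
  (int_norm (fun s => phi s *: Lp_repr u s) <= (M * head_norm K u)%:E)%E.
Proof.
move=> K0 wphi M0 phiM; rewrite EFinM -head_norm_fin -{1}(ger0_norm M0).
rewrite -int_normZ; last exact: measurable_head.
apply: le_int_norm.
- exact: weighted_measurable wphi.
- by apply: strongly_measurableZ; exact: measurable_head.
move=> x _; rewrite [X in _ <= `|X|](_ : _ = M *: window 0 K (Lp_repr u) x)// !normrZ.
rewrite /window; case: asboolP => [_|/negP/wphi.2 ->]; last by rewrite !normr0 mul0r mulr0.
by rewrite (ger0_norm M0) ler_wpM2r.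
Qed.

(** The action of [phi] as a vector-valued distribution on [u]. *)
Definition pairing (phi : R -> R) u : E :=
  xget 0 [set v | is_bochner_integral (fun s => phi s *: Lp_repr u s) v].

Lemma pairingP K phi u : 0 <= K -> weight K phi ->
  is_bochner_integral (fun s => phi s *: Lp_repr u s) (pairing phi u).
Proof.
move=> K0 wphi.
have [|c c0 Hc] := @continuous_bounded_segment R R^o phi 0 K (lexx 0).
  by move=> s _; exact: continuous_at_inS (@subsetT _ _) (wphi.1 s).
have phic x : `|phi x| <= c.
  have [xK|/wphi.2 ->] := boolP (0 <= x < K); last by rewrite normr0.
  by apply: Hc; case/andP: xK => -> /ltW.
have [v Hv] : exists v, is_bochner_integral (fun s => phi s *: Lp_repr u s) v.
  apply: bochner_exists; first exact: seq_complete_completeNormed.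
    exact: weighted_measurable wphi.
  exact: le_lt_trans (weighted_int_norm u K0 wphi c0 phic) (ltry _).
by rewrite /pairing; case: xgetP => [w -> //|/(_ v)].
Qed.

Lemma pairing_unique phi u v :
  is_bochner_integral (fun s => phi s *: Lp_repr u s) v -> pairing phi u = v.
Proof.
move=> Hv; rewrite /pairing; case: xgetP => [w _ Hw|/(_ v)//].
exact: bochner_unique Hw Hv.
Qed.

Lemma pairing_le K phi u M : 0 <= K -> weight K phi -> 0 <= M ->
  (forall x, `|phi x| <= M) -> `|pairing phi u| <= M * ((1 + K) * `|u|).
Proof.
move=> K0 wphi M0 phiM; rewrite -lee_fin.
apply: le_trans (bochner_norm_le (pairingP u K0 wphi)) _.
apply: le_trans (weighted_int_norm u K0 wphi M0 phiM) _.
by rewrite lee_fin ler_wpM2l// head_norm_le.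
Qed.

Lemma pairing_linear_r K phi a u (v : F) : 0 <= K -> weight K phi ->
  pairing phi (a *: u + v) = a *: pairing phi u + pairing phi v.
Proof.
move=> K0 wphi; apply: pairing_unique.
apply: bochner_ae (bochner_linear a (pairingP u K0 wphi) (pairingP v K0 wphi)).
  exact: weighted_measurable wphi.
apply: filterS (Lp_repr_linear a u v) => x h Rx.
rewrite h// /GRing.add/= /GRing.scale/= -/(GRing.add _ _).
by rewrite [RHS]scalerDr scalerA mulrC -scalerA.
Qed.

Lemma pairing_linear_l K phi psi a u : 0 <= K -> weight K phi -> weight K psi ->
  pairing (fun x => a * phi x + psi x) u = a *: pairing phi u + pairing psi u.
Proof.
move=> K0 wphi wpsi; apply: pairing_unique.
rewrite (_ : (fun s => _) = a *: (fun s => phi s *: Lp_repr u s) + (fun s => psi s *: Lp_repr u s)).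
  exact: bochner_linear (pairingP u K0 wphi) (pairingP u K0 wpsi).
by apply/funext => x; rewrite scalerDl -scalerA.
Qed.

Lemma smooth_weight a b K phi : 0 <= a -> b < K -> smooth_supported a b phi -> weight K phi.
Proof.
move=> a0 bK sphi; split=> [x|x xK]; first exact: smooth_supported_continuous sphi.
apply: sphi.2; apply: contra xK; rewrite in_itv/= => /andP[ax xb].
by rewrite (le_trans a0)//= (le_lt_trans xb).
Qed.

Lemma weak_derivative_pairing a b K phi (u u' : F) : 0 < a -> b < K -> 0 <= K ->
  smooth_supported a b phi -> weak_derivative u u' ->
  pairing (derive1 phi) u = - pairing phi u'.
Proof.
move=> a0 bK K0 sphi /(_ phi (smooth_supported_test a0 sphi))[v [h1 h2]].
by rewrite (pairing_unique h1) (pairing_unique h2) opprK.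
Qed.

(** Along a path in L^p whose derivative is the weak derivative in space, the
    action on a test function travelling against the shift is constant. *)
Lemma transported_pairing (f f' : R -> F) (al be : R) (phi : R -> R) (a : R) :
  0 < al -> 0 <= be -> 0 <= a -> smooth_supported al be phi ->
  (forall s, 0 <= s -> continuous_at_in f Rplus s) ->
  (forall s, 0 <= s -> right_derivative f s (f' s)) ->
  (forall s, 0 <= s -> weak_derivative (f s) (f' s)) ->
  pairing phi (f a) = pairing (fun x => phi (x - a)) (f 0).
Proof.
move=> al0 be0 a0 sphi cf df wf.
pose K := be + a + 1; have K0 : 0 <= K by rewrite /K; lra.
pose ph c x := phi (x - c).
have sph c : smooth_supported (al + c) (be + c) (ph c) by exact: smooth_supported_shift.
have wph c : 0 <= c -> c <= a -> weight K (ph c).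
  by move=> c0 ca; apply: (smooth_weight _ _ (sph c)); rewrite /K; lra.
have dph c : derive1 (ph c) = (fun x => derive1 phi (x - c)).
  by apply/funext => x; rewrite /derive1 /ph; under eq_fun do rewrite -addrA.
have wdph c : 0 <= c -> c <= a -> weight K (derive1 (ph c)).
  move=> c0 ca; apply: (smooth_weight _ _ (smooth_supported_derive (sph c))); rewrite /K; lra.
have [M0 M00 HM0] := smooth_supported_bounded sphi.
have [L L0 HL] := smooth_supported_lipschitz sphi.
have [M2 M20 HM2] := smooth_supported_taylor sphi.
pose D t := pairing (ph (a - t)) (f t).
suff : D a = D 0 by rewrite /D subrr subr0 /ph; under eq_fun do rewrite subr0.
have K1 : 0 < 1 + K by lra.
have dif c c' : 0 <= c -> c <= a -> 0 <= c' -> c' <= a -> forall u,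
    `|pairing (ph c) u - pairing (ph c') u| <= L * `|c - c'| * ((1 + K) * `|u|).
  move=> c0 ca c'0 c'a u.
  have -> : pairing (ph c) u - pairing (ph c') u = pairing (fun x => -1 * ph c' x + ph c x) u.
    by rewrite (pairing_linear_l _ _ K0 (wph _ c'0 c'a) (wph _ c0 ca)) scaleN1r addrC.
  apply: (pairing_le u K0); first by apply: weight_linear; exact: wph.
    by rewrite mulr_ge0.
  move=> x; rewrite mulN1r addrC /ph; apply: (le_trans (HL _ _)).
  by rewrite ler_wpM2l// distrC le_eqVlt; apply/orP; left; apply/eqP; congr `|_|; ring.
apply: (@right_derivative0_cst _ _ D 0 a a0).
- move=> s /andP[s0 sa] e e0.
  have e2 : 0 < e / 2 by lra.
  have A1 : 0 < M0 * (1 + K) + 1 by have := mulr_ge0 M00 (ltW K1); lra.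
  have A2 : 0 < L * ((1 + K) * `|f s|) + 1.
    by have := mulr_ge0 L0 (mulr_ge0 (ltW K1) (normr_ge0 (f s))); lra.
  have [d d0 Hd] := cf s s0 _ (divr_gt0 e2 A1).
  exists (Num.min d (e / 2 / (L * ((1 + K) * `|f s|) + 1))) => [|r].
    by rewrite lt_min d0 divr_gt0.
  rewrite /= in_itv/= => /andP[r0 ra]; rewrite lt_min => /andP[rd].
  have {rd} := Hd r (ltac:(by rewrite /Rplus/= in_itv/= r0)) rd.
  rewrite ltr_pdivlMr// => h1; rewrite ltr_pdivlMr// => h2.
  have ar : 0 <= a - r by lra. have ar' : a - r <= a by lra.
  have as_ : 0 <= a - s by lra. have as' : a - s <= a by lra.
  have -> : D r - D s = pairing (ph (a - r)) (f r - f s) +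
      (pairing (ph (a - r)) (f s) - pairing (ph (a - s)) (f s)).
    have -> : f r - f s = -1 *: f s + f r by rewrite scaleN1r addrC.
    rewrite (pairing_linear_r _ _ _ K0 (wph _ ar ar')) scaleN1r.
    by rewrite addrA [- _ + _]addrC subrK.
  rewrite (le_lt_trans (ler_normD _ _))//.
  have b1 := pairing_le (f r - f s) K0 (wph _ ar ar') M00 (fun x => HM0 _).
  have b2 := dif _ _ ar ar' as_ as' (f s).
  have Ers : `|a - r - (a - s)| = `|r - s| by rewrite distrC; congr `|_|; ring.
  rewrite Ers in b2; have := normr_ge0 (r - s); have := normr_ge0 (f r - f s).
  by move: b1 b2 h1 h2; set X1 := `|f r - f s|; set X2 := `|r - s|; lra.
move=> s /andP[s0 sa] e e0.
pose c := a - s; have c0 : 0 < c by rewrite /c; lra.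
have ca : c <= a by rewrite /c; lra.
have e3 : 0 < e / 3 by lra.
have A1 : 0 < M0 * (1 + K) + 1 by have := mulr_ge0 M00 (ltW K1); lra.
have A2 : 0 < L * ((1 + K) * `|f' s|) + 1.
  by have := mulr_ge0 L0 (mulr_ge0 (ltW K1) (normr_ge0 (f' s))); lra.
have A3 : 0 < M2 * ((1 + K) * `|f s|) + 1.
  by have := mulr_ge0 M20 (mulr_ge0 (ltW K1) (normr_ge0 (f s))); lra.
have [d d0 Hd] := df s s0 _ (divr_gt0 e3 A1).
exists (Num.min (Num.min d c) (Num.min (e / 3 / (L * ((1 + K) * `|f' s|) + 1))
    (e / 3 / (M2 * ((1 + K) * `|f s|) + 1)))) => [|h h0].
  by rewrite !lt_min d0 c0 !divr_gt0.
rewrite !lt_min => /andP[/andP[hd hc] /andP[h2 h3]].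
have h1 := Hd h h0 hd.
rewrite ltr_pdivlMr// in h2; rewrite ltr_pdivlMr// in h3.
have cc : 0 <= c - h by lra. have cc' : c - h <= a by lra.
have wc := wph c (ltW c0) ca; have wch := wph _ cc cc'.
have wdc := wdph c (ltW c0) ca.
have zero : pairing (ph c) (f' s) + pairing (derive1 (ph c)) (f s) = 0.
  have al' : 0 < al + c by lra.
  have beK : be + c < K by rewrite /K; lra.
  by rewrite (weak_derivative_pairing al' beK K0 (sph c) (wf s s0)) subrr.
rewrite scaler0 subr0.
pose ps x := - h * derive1 (ph c) x + (-1 * ph c x + ph (c - h) x).
have wps : weight K ps by do 2 apply: weight_linear => //.
have -> : D (s + h) - D s = pairing (ph (c - h)) (f (s + h) - f s - h *: f' s) +
    h *: (pairing (ph (c - h)) (f' s) - pairing (ph c) (f' s)) + pairing ps (f s).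
  have -> : f (s + h) - f s - h *: f' s = - h *: f' s + (-1 *: f s + f (s + h)).
    by rewrite scaleN1r scaleNr addrC (addrC (f _)).
  rewrite !(pairing_linear_r _ _ _ K0 wch).
  rewrite !(pairing_linear_l _ _ K0)//; last by apply: weight_linear.
  rewrite /D (_ : a - (s + h) = c - h); last by rewrite /c; ring.
  rewrite -/c !scaleN1r.
  have -> : pairing (derive1 (ph c)) (f s) = - pairing (ph c) (f' s).
    by apply/eqP; rewrite -addr_eq0 addrC zero.
  by rewrite scalerBr !scaleNr scalerN opprK -telescoping_sum.
have n0 := ltW h0.
have b1 := pairing_le (f (s + h) - f s - h *: f' s) K0 wch M00 (fun x => HM0 _).
have b2 := dif _ _ cc cc' (ltW c0) ca (f' s).
have M2h : 0 <= M2 * h ^+ 2 by rewrite mulr_ge0// sqr_ge0.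
have b3 : `|pairing ps (f s)| <= M2 * h ^+ 2 * ((1 + K) * `|f s|).
  apply: (pairing_le _ K0 wps M2h) => x; rewrite /ps dph /ph.
  apply: le_trans (HM2 (x - c) h n0); rewrite le_eqVlt; apply/orP; left; apply/eqP.
  by congr `|_|; rewrite (_ : x - (c - h) = x - c + h); ring.
rewrite (_ : c - h - c = - h) ?normrN ?(gtr0_norm h0) in b2; last by ring.
rewrite (le_trans (ler_normD _ _))//.
rewrite (_ : e * h = (e / 3 * h + h * (e / 3)) + h * (e / 3)); last by field.
apply: lerD; last first.
  apply: (le_trans b3); rewrite (_ : _ * _ = h * (h * (M2 * ((1 + K) * `|f s|)))); last by ring.
  by rewrite ler_wpM2l// (le_trans _ (ltW h3))// ler_wpM2l// lerDl ler01.
apply: (le_trans (ler_normD _ _)); apply: lerD; last first.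
  rewrite normrZ (gtr0_norm h0) ler_wpM2l// (le_trans b2)//.
  rewrite (_ : _ * _ = h * (L * ((1 + K) * `|f' s|))); last by ring.
  by rewrite (le_trans _ (ltW h2))// ler_wpM2l// lerDl ler01.
apply: (le_trans b1); rewrite mulrA.
have MK0 : 0 <= M0 * (1 + K) by rewrite mulr_ge0// ltW.
apply: (le_trans (ler_wpM2l MK0 h1)); rewrite mulrA ler_wpM2r//.
by rewrite mulrCA ler_piMr ?(ltW e3)// ler_pdivrMr// mul1r lerDl ler01.
Qed.

End pairing.

(** * Paths driven by the weak derivative *)

Section shift.
Context {R : realType} (E : completeNormedModType R) (p : R) (p1 : 1 <= p).
Notation mu := (@lebesgue_measure R).
Notation F := (Lp E p1).

Definition continuous_eps (h : R -> E) := forall D s, continuous_at_in h D s.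

(** Extending to the left by the value at 0 makes the representative continuous
    on the whole line, so that no point needs a one-sided treatment. *)
Lemma continuous_representative (u : F) (e : E) : is_delta0 u e ->
  exists h : R -> E, [/\ continuous_eps h, Lp_repr u = h %[ae mu in Rplus] & h 0 = e].
Proof.
move=> [h [ch uh h0]]; exists (fun x => h (Num.max 0 x)); split; last by rewrite maxxx.
- move=> D s z z0; move/within_continuousP : ch => ch.
  have [|d d0 Hd] := ch (Num.max 0 s) _ z z0.
    by rewrite /Rplus/= in_itv/= le_max lexx.
  exists d => // r _ rs; apply: Hd; first by rewrite /Rplus/= in_itv/= le_max lexx.
  apply: le_lt_trans rs; have [r0|r0] := leP 0 r; have [s0|s0] := leP 0 s => //.
  + by rewrite subr0 !ger0_norm; lra.
  + by rewrite sub0r normrN distrC !ger0_norm; lra.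
  + by rewrite subrr normr0.
- apply: filterS uh => x xh Rx; rewrite xh//; congr h; apply/esym/max_idPr.
  by move: Rx; rewrite /Rplus/= in_itv/= andbT.
Qed.

Lemma continuous_eps_norm_measurable (h : R -> E) : continuous_eps h ->
  measurable_fun setT (fun x => `|h x|).
Proof.
move=> ch; apply: continuous_measurable_fun => x.
apply/(@cvgrPdist_lt _ R^o) => e e0; have [d d0 Hd] := ch setT x e e0.
apply/nbhs_ballP; exists d => // r; rewrite /ball/= distrC => rx.
by rewrite distrC; apply: le_lt_trans (ler_dist_dist _ _) _; exact: Hd.
Qed.

Lemma int_norm_full (X : normedModType R) (f : R -> X) : (forall x, x < 0 -> f x = 0) ->
  int_norm f = (\int[mu]_x (`|f x|)%:E)%E.
Proof.
move=> f0; rewrite /int_norm integral_mkcond; apply: eq_integral => x _.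
rewrite /patch; case: ifPn => // xR; rewrite f0 ?normr0//.
by move: xR; rewrite notin_setE /Rplus/= in_itv/= andbT => /negP; rewrite -ltNge.
Qed.

Lemma int_norm_translate al be (phi : R -> R) a : 0 < al -> 0 <= a ->
  smooth_supported al be phi ->
  int_norm (fun x => phi (x - a) : R^o) = int_norm (phi : R -> R^o).
Proof.
move=> al0 a0 sphi.
have off x : x < 0 -> phi x = 0.
  by move=> x0; apply: sphi.2; rewrite in_itv/= negb_and -!ltNge; apply/orP; left; lra.
rewrite !int_norm_full//; last by move=> x x0; apply: off; lra.
have wphi : weight (Num.max 0 be + 1) phi.
  by apply: smooth_weight sphi; [exact: ltW|rewrite ltr_pwDr// le_max lexx orbT].
apply: (@integral_translate R (- a) (fun x => (`|phi x|)%:E)) => [|x]; last by rewrite lee_fin.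
by apply: (@measurable_EFin_norm R R^o phi setT); exact: weight_measurable wphi.
Qed.

Lemma weight_int_norm_lty K phi : weight K phi -> (int_norm (phi : R -> R^o) < +oo)%E.
Proof.
move=> [cphi sphi].
have -> : phi = window 0 K (phi : R -> R^o).
  by apply/funext => x; rewrite /window; case: asboolP => // /negP/sphi.
apply: int_norm_window_lty => // s _.
exact: continuous_at_inS (@subsetT _ _) (cphi s).
Qed.

(** Applied to narrow bumps: pairings then determine a continuous representative
    pointwise. *)
Lemma pairing_local K (phi : R -> R) (u : F) (h : R -> E) (e : E) (z : R) :
  0 <= K -> weight K phi -> (forall x, 0 <= phi x) -> 0 <= z ->
  Lp_repr u = h %[ae mu in Rplus] ->
  (forall x, 0 <= x -> phi x != 0 -> `|h x - e| <= z) ->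
  `|pairing phi u - fine (int_norm (phi : R -> R^o)) *: e| <=
    z * fine (int_norm (phi : R -> R^o)).
Proof.
move=> K0 wphi phi0 z0 uh he.
have phy := weight_int_norm_lty wphi.
have mphi := weight_measurable wphi.
have B1 := bochner_scalar e (fun x _ => phi0 x) mphi phy.
have B2 := pairingP u K0 wphi.
have B3 := bochner_linear (-1) B1 B2.
have E1 : -1 *: (fine (int_norm (phi : R -> R^o)) *: e) + pairing phi u =
    pairing phi u - fine (int_norm (phi : R -> R^o)) *: e by rewrite scaleN1r addrC.
rewrite E1 in B3; rewrite -lee_fin (le_trans (bochner_norm_le B3))//.
rewrite EFinM fineK ?ge0_fin_numE ?int_norm_ge0// -{1}(ger0_norm z0) -int_normZ//.
apply: int_norm_ae_le; first by case: B3.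
  exact: strongly_measurableZ.
apply: filterS uh => x h1 Rx.
rewrite [X in `|X| <= _](_ : _ = -1 *: (phi x *: e) + phi x *: Lp_repr u x)//.
rewrite scaleN1r addrC -scalerBr.
rewrite [X in _ <= `|X|](_ : _ = z * phi x)// normrZ normrM mulrC (ger0_norm z0).
have [->|px] := eqVneq (phi x) 0; first by rewrite normr0 !mulr0.
rewrite h1// ler_wpM2r// he//.
by move: Rx; rewrite /Rplus/= in_itv/= andbT.
Qed.

Lemma bump_weight (m r : R) : 0 < r -> r < m -> weight (m + r + 1) (bump m r).
Proof.
move=> r0 rm; apply: smooth_weight (bump_smooth m r0); first by rewrite subr_ge0 ltW.
by rewrite ltrDl.
Qed.

Lemma bump_int_norm_gt0 (m r : R) : 0 < r -> r < m ->
  0 < fine (int_norm (bump m r : R -> R^o)).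
Proof.
move=> r0 rm; have m0 := lt_trans r0 rm; pose k := bump m r m.
have k0 : 0 < k by apply: bump_gt0; rewrite subrr normr0.
have k2 : 0 < k / 2 by lra.
have [d d0 Hd] := smooth_supported_continuous setT m (bump_smooth m r0) k2.
have md : m <= m + d / 2 by lra.
have m1 := measurable_window1 m (m + d / 2).
have : (((k / 2) * (d / 2))%:E <= int_norm (bump m r : R -> R^o))%E.
  have -> : d / 2 = m + d / 2 - m by ring.
  rewrite EFinM -(int_norm_window1 (ltW m0) md) -{1}(gtr0_norm k2) -int_normZ//.
  apply: le_int_norm; first exact: strongly_measurableZ.
    exact: weight_measurable (bump_weight r0 rm).
  move=> x _.
  rewrite [X in `|X| <= _](_ : _ = (k / 2) * window m (m + d / 2) (cst (1 : R) : R -> R^o) x)//.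
  rewrite (ger0_norm (bump_ge0 _ _ _)) /window; case: asboolP => [/andP[mx xd]|_]; last first.
    by rewrite mulr0 normr0 bump_ge0.
  rewrite mulr1 (gtr0_norm k2).
  have : `|bump m r x - bump m r m| < k / 2.
    by apply: Hd => //; rewrite ger0_norm; lra.
  by rewrite -/k ltr_norml => /andP[]; lra.
have fy := weight_int_norm_lty (bump_weight r0 rm).
rewrite -(fineK (_ : int_norm (bump m r : R -> R^o) \is a fin_num)) ?ge0_fin_numE//;
  last exact: int_norm_ge0.
rewrite lee_fin.
by apply: lt_le_trans; rewrite mulr_gt0//; lra.
Qed.

Section path.
Variables (f f' : R -> F).
Hypotheses (cf : forall s, 0 <= s -> continuous_at_in f Rplus s)
  (df : forall s, 0 <= s -> right_derivative f s (f' s))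
  (wf : forall s, 0 <= s -> weak_derivative (f s) (f' s)).

(** Such a path consists of the left translates of its initial value: otherwise
    a narrow bump would separate the two continuous representatives. *)
Lemma path_is_shift (a : R) (h0 ha : R -> E) : 0 <= a ->
  continuous_eps h0 -> continuous_eps ha ->
  Lp_repr (f 0) = h0 %[ae mu in Rplus] -> Lp_repr (f a) = ha %[ae mu in Rplus] ->
  forall s, 0 <= s -> ha s = h0 (s + a).
Proof.
move=> a0 ch0 cha rh0 rha.
have pos s : 0 < s -> ha s = h0 (s + a).
  move=> s0; apply/eqP; rewrite -subr_eq0 -normr_le0; apply/ler_addgt0Pr => z z0.
  rewrite add0r; have z2 : 0 < z / 2 by lra.
  have [d1 d10 H1] := cha setT s _ z2; have [d2 d20 H2] := ch0 setT (s + a) _ z2.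
  pose r := Num.min (s / 2) (Num.min d1 d2 / 2).
  have dd : 0 < Num.min d1 d2 by rewrite lt_min d10.
  have r0 : 0 < r by rewrite lt_min !divr_gt0.
  have rs : r < s by rewrite gt_min; apply/orP; left; lra.
  have rd : r < Num.min d1 d2 by rewrite gt_min; apply/orP; right; lra.
  move: rd; rewrite lt_min => /andP[rd1 rd2].
  have sphi := bump_smooth s r0; set phi := bump s r in sphi.
  have sr0 : 0 < s - r by rewrite subr_gt0.
  have off x : phi x != 0 -> `|x - s| <= r.
    apply: contraNT; rewrite -ltNge => h; apply/eqP; apply: sphi.2.
    rewrite in_itv/= negb_and -!ltNge; move: h; rewrite ltr_normr.
    by case/orP => h; apply/orP; [right|left]; lra.
  have K0 : 0 <= s + r + 1 by lra.
  have w1 : weight (s + r + 1) phi by exact: bump_weight.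
  have Ka0 : 0 <= s + r + a + 1 by lra.
  have spa := smooth_supported_shift a sphi.
  have w2 : weight (s + r + a + 1) (fun x => phi (x - a)).
    by apply: smooth_weight spa; lra.
  have tr := transported_pairing sr0 (ltac:(lra) : 0 <= s + r) a0 sphi cf df wf.
  have c0 := bump_int_norm_gt0 r0 rs; rewrite -/phi in c0.
  set c := fine _ in c0.
  have P1 : `|pairing phi (f a) - c *: ha s| <= z / 2 * c.
    apply: (pairing_local K0 w1 _ (ltW z2) rha) => [x|x _ /off xs]; first exact: bump_ge0.
    by apply/ltW/(H1 _ Logic.I); exact: le_lt_trans rd1.
  have ce : fine (int_norm (fun x => phi (x - a) : R^o)) = c.
    by rewrite (int_norm_translate sr0 a0 sphi).
  have P2 : `|pairing (fun x => phi (x - a)) (f 0) - c *: h0 (s + a)| <= z / 2 * c.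
    rewrite -ce; apply: (pairing_local Ka0 w2 _ (ltW z2) rh0) => [x|x _ /off xs].
      exact: bump_ge0.
    apply/ltW/(H2 _ Logic.I); apply: le_lt_trans rd2.
    by rewrite (_ : x - (s + a) = x - a - s); [exact: xs|ring].
  rewrite tr in P1.
  have : `|c *: (ha s - h0 (s + a))| <= z * c.
    have -> : c *: (ha s - h0 (s + a)) =
      (pairing (fun x => phi (x - a)) (f 0) - c *: h0 (s + a)) -
      (pairing (fun x => phi (x - a)) (f 0) - c *: ha s).
      by rewrite opprB [RHS]addrC addrA subrK scalerBr.
    by apply: (le_trans (ler_normB _ _)); lra.
  by rewrite normrZ (gtr0_norm c0) mulrC ler_pM2r.
move=> s; rewrite le_eqVlt => /predU1P[<-|]; last exact: pos.
rewrite add0r; apply/eqP; rewrite -subr_eq0 -normr_le0; apply/ler_addgt0Pr => z z0.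
have z2 : 0 < z / 2 by lra.
have [d1 d10 H1] := cha setT 0 _ z2; have [d2 d20 H2] := ch0 setT a _ z2.
pose r := Num.min d1 d2 / 2.
have dd : 0 < Num.min d1 d2 by rewrite lt_min d10.
have r0 : 0 < r by rewrite divr_gt0.
have rd : r < Num.min d1 d2 by rewrite /r; lra.
move: rd; rewrite lt_min => /andP[rd1 rd2].
have h1 : `|ha r - ha 0| < z / 2 by apply: H1 => //; rewrite subr0 gtr0_norm.
have h2 : `|h0 (r + a) - h0 a| < z / 2.
  by apply: H2 => //; rewrite addrK gtr0_norm.
rewrite -(pos r r0) in h2; rewrite add0r.
have -> : ha 0 - h0 a = (ha r - h0 a) - (ha r - ha 0) by rewrite opprB [RHS]addrC addrA subrK.
by apply: (le_trans (ler_normB _ _)); lra.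
Qed.

End path.

Lemma head_norm_rep (u : F) (h : R -> E) b : continuous_eps h ->
  Lp_repr u = h %[ae mu in Rplus] ->
  (head_norm b u)%:E = (\int[mu]_x (`|window 0 b h x|)%:E)%E.
Proof.
move=> ch uh; rewrite -head_norm_fin.
have mw : strongly_measurable (window 0 b h).
  by apply: strongly_measurable_window => // s _; exact: ch.
rewrite -int_norm_full; last first.
  by move=> x x0; rewrite /window; case: asboolP => // /andP[]; rewrite leNgt x0.
apply/eqP; rewrite eq_le; apply/andP; split; apply: int_norm_ae_le => //;
  try exact: measurable_head.
  by apply: filterS uh => x xh Rx; rewrite /window xh.
by apply: filterS uh => x xh Rx; rewrite /window xh.
Qed.

Lemma head_norm_shift (u v : F) (h k : R -> E) a b : 0 <= a -> 0 <= b ->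
  continuous_eps h -> continuous_eps k ->
  Lp_repr u = h %[ae mu in Rplus] -> Lp_repr v = k %[ae mu in Rplus] ->
  (forall s, 0 <= s -> k s = h (s + a)) ->
  head_norm a u + head_norm b v = head_norm (a + b) u.
Proof.
move=> a0 b0 ch ck uh vk kh; apply: EFin_inj.
rewrite EFinD (head_norm_rep _ ch uh) (head_norm_rep _ ck vk) (head_norm_rep _ ch uh).
have mw x y : 0 <= x -> measurable_fun setT (fun z => (`|window x y h z|)%:E).
  by move=> x0; apply: measurable_EFin_norm; apply: strongly_measurable_window => // s _; exact: ch.
have -> : (\int[mu]_x (`|window 0 b k x|)%:E = \int[mu]_x (`|window a (a + b) h x|)%:E)%E.
  rewrite -[RHS](integral_translate a); [|exact: mw|by move=> x; rewrite lee_fin].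
  apply: eq_integral => x _; rewrite /window (_ : (a <= x + a < a + b) = (0 <= x < b)).
    by case: asboolP => // /andP[x0 _]; rewrite kh.
  by rewrite lerDr (addrC x) ltrD2l.
rewrite -ge0_integralD//; [|exact: mw|exact: mw].
apply: eq_integral => x _; rewrite -EFinD; congr (_%:E); rewrite /window !asboolb.
have [xa|ax] := ltP x a; last by rewrite andbF normr0 add0r (le_trans a0 ax).
by rewrite /= (lt_le_trans xa) ?lerDl// normr0 addr0.
Qed.

Lemma norm_shift (u v : F) (h k : R -> E) a : 0 <= a ->
  continuous_eps h -> continuous_eps k ->
  Lp_repr u = h %[ae mu in Rplus] -> Lp_repr v = k %[ae mu in Rplus] ->
  (forall s, 0 <= s -> k s = h (s + a)) -> `|v| <= `|u|.
Proof.
move=> a0 ch ck uh vk kh; have p0 : 0 < p by move: p1; lra.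
pose G (g : R -> E) (x : R) : \bar R := (`|(if 0 <= x then g x else 0)| `^ p)%:E.
have mG g : continuous_eps g -> measurable_fun setT (G g).
  move=> cg; apply/measurable_EFinP.
  apply: (@measurableT_comp _ _ _ _ _ _ (@powR R ^~ p)) => //.
  rewrite (_ : (fun x => _) = (fun x => `|g x|) \_ Rplus); last first.
    apply/funext => x; rewrite /patch; case: ifPn => x0.
      by rewrite mem_set// /Rplus/= in_itv/= x0.
    by rewrite memNset ?normr0// /Rplus/= in_itv/= andbT; apply/negP.
  apply/(measurable_restrictT _ measurable_Rplus).
  apply: (measurable_funS measurableT) => //.
  exact: continuous_eps_norm_measurable.
have rep (w : F) (g : R -> E) : continuous_eps g -> Lp_repr w = g %[ae mu in Rplus] ->
    (`|w| `^ p)%:E = (\int[mu]_x G g x)%E.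
  move=> cg wg; rewrite -(Lp_repr_integral w) unlock.
  transitivity (\int[mu]_(x in Rplus) (`|g x| `^ p)%:E)%E.
    apply: ae_eq_integral.
    - exact: measurable_Rplus.
    - by apply: Lp_integrand_measurable; exact: Lp_repr_measurable.
    - apply/measurable_EFinP; apply: (measurable_funS measurableT) => //.
      apply: (@measurableT_comp _ _ _ _ _ _ (@powR R ^~ p)) => //.
      exact: continuous_eps_norm_measurable.
    - by apply: filterS wg => x xg Rx; rewrite xg.
  rewrite integral_mkcond; apply: eq_integral => x _; rewrite /patch /G.
  case: ifPn => xR.
    have x0 : 0 <= x by have := set_mem xR; rewrite /Rplus/= in_itv/= andbT.
    by rewrite x0.
  have x0 : (0 <= x) = false.
    apply/negbTE/negP => x0; move/negP: xR; apply; apply/mem_set.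
    by rewrite /Rplus/= in_itv/= x0.
  by rewrite x0 normr0 powR0// gt_eqF.
have H : (\int[mu]_x G k x <= \int[mu]_x G h x)%E.
  have <- := integral_translate a (mG h ch)
    (fun x => (ltac:(by rewrite lee_fin powR_ge0) : (0 <= G h x)%E)).
  apply: ge0_le_integral.
  - exact: measurableT.
  - by move=> x _; rewrite lee_fin powR_ge0.
  - exact: mG.
  - by apply: (measurableT_comp (mG h ch)); exact: measurable_funD.
  move=> x _; rewrite lee_fin /G; case: ifPn => [x0|_]; last first.
    by rewrite normr0 powR0 ?powR_ge0// gt_eqF.
  by rewrite kh// addr_ge0.
rewrite -(rep v k ck vk) -(rep u h ch uh) in H.
rewrite leNgt; apply/negP => uv; move: H; rewrite lee_fin leNgt => /negP; apply.
by rewrite gt0_ltr_powR ?nnegrE.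
Qed.

End shift.

(** * Inhomogeneous Cauchy problems *)

Lemma subr_defect (V : zmodType) (x y c d : V) :
  (x - (c + d)) - (y - c) + d = x - y.
Proof. by rewrite opprD addrA (addrAC x) subrKB addrAC subrK. Qed.

Section variation_of_constants.
Context {R : realType} (E : completeNormedModType R) (p : R) (p1 : 1 <= p).
Notation mu := (@lebesgue_measure R).
Notation F := (Lp E p1).

(** The bound that the variation of constants formula would give for a solution
    of [x' = A x + h]; differentiating [s |-> T (t - s) (x s)] avoids the
    vector integral. *)
Lemma inhomogeneous_bound (T : R -> E -> E) (x a : R -> E) (h : R -> E) (u : F) (K t : R) :
  C0_semigroup T -> 0 <= t -> 0 <= K ->
  (forall s y, 0 <= s <= t -> `|T s y| <= K * `|y|) ->
  (forall s, 0 <= s -> continuous_at_in x Rplus s) ->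
  (forall s, 0 <= s -> generator T (x s, a s)) ->
  (forall s, 0 <= s -> right_derivative x s (a s + h s)) ->
  continuous_eps h -> Lp_repr u = h %[ae mu in Rplus] ->
  `|x t - T t (x 0)| <= K * head_norm t u.
Proof.
move=> hT t0 K0 HK cx gx dx ch uh.
have cRo : @seq_complete R R^o by exact: (@seq_complete_completeNormed R R^o).
have cnh s D : @continuous_at_in R R^o (fun s => `|h s|) D s.
  by apply: (continuous_at_in_le (u := h)) => [r|//]; exact: ler_dist_dist.
have [U [U0 LU UI HU]] := primitive_exists cRo (fun s _ => cnh s Rplus).
have Uhead : U t <= head_norm t u.
  apply: (le_trans (ler_norm _)); rewrite -lee_fin (le_trans (UI t))//.
  rewrite (head_norm_rep _ ch uh) -int_norm_full; last first.
    by move=> y y0; rewrite /window; case: asboolP => // /andP[]; rewrite leNgt y0.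
  apply: le_int_norm.
  - by apply: strongly_measurable_window => // s _; exact: cnh.
  - by apply: strongly_measurable_window => // s _; exact: ch.
  - by move=> y _; rewrite /window; case: asboolP => _; [rewrite [leLHS]ger0_norm|rewrite !normr0].
pose w s := T (t - s) (x s).
have -> : x t - T t (x 0) = w t - w 0 by rewrite /w subrr subr0 (C0_id hT).
apply: (@le_trans _ _ (K * U t - K * U 0)); last by rewrite U0 mulr0 subr0 ler_wpM2l.
have dT s : 0 <= s <= t -> linear (T s).
  by move=> /andP[s0 _]; exact: C0_linear.
apply: (@mean_value_right _ _ w (fun s => K * U s) 0 t t0).
- move=> s /andP[s0 st] e e0; have e2 : 0 < e / 2 by lra.
  have K1 : 0 < K + 1 by lra.
  have [d1 d10 H1] := cx s s0 _ (divr_gt0 e2 K1).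
  have [|d2 d20 H2] := @orbit_continuous _ _ T hT (x s) (t - s) _ _ e2.
    by rewrite /Rplus/= in_itv/= andbT subr_ge0.
  exists (Num.min d1 d2) => [|r]; first by rewrite lt_min d10.
  rewrite /= in_itv/= => /andP[r0 rt]; rewrite lt_min => /andP[rd1 rd2].
  have Rr : Rplus r by rewrite /Rplus/= in_itv/= r0.
  have tr : 0 <= t - r <= t by apply/andP; split; lra.
  have -> : w r - w s = T (t - r) (x r - x s) + (T (t - r) (x s) - T (t - s) (x s)).
    by rewrite /w (linear_funB (dT _ tr)) addrA subrK.
  have h1 := HK _ (x r - x s) tr; have := H1 r Rr rd1.
  rewrite ltr_pdivlMr// => h2.
  have h3 : `|T (t - r) (x s) - T (t - s) (x s)| < e / 2.
    apply: H2; first by rewrite /Rplus/= in_itv/= andbT subr_ge0.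
    by rewrite (_ : t - r - (t - s) = - (r - s)) ?normrN//; ring.
  rewrite (le_lt_trans (ler_normD _ _))//; have := normr_ge0 (x r - x s).
  by move: h1 h2 h3; clear; lra.
- have [C C0 HC] := LU t.
  move=> s /andP[s0 st] e e0.
  have KC : 0 < K * C + 1 by have := mulr_ge0 K0 C0; lra.
  exists (e / (K * C + 1)) => [|r]; first exact: divr_gt0.
  rewrite /= in_itv/= => /andP[r0 rt]; rewrite ltr_pdivlMr// => hr.
  rewrite -mulrBr normrM (ger0_norm K0).
  have hU : `|U r - U s| <= C * `|r - s| by apply: HC; rewrite ?r0 ?s0.
  have := ler_wpM2l K0 hU; have := normr_ge0 (r - s).
  by move: hr; clear; lra.
move=> s /andP[s0 st] e e0.
pose e1 := e / (3 * K + 1); have K31 : 0 < 3 * K + 1 by lra.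
have e10 : 0 < e1 by exact: divr_gt0.
have [d1 d10 H1] := dx s s0 _ e10.
have [d2 d20 H2] := @generator_right_derivative _ _ T hT _ _ 0 (lexx 0) (gx s s0) _ e10.
have [d3 d30 H3] := cnh s setT _ e10.
exists (Num.min (Num.min d1 d2) (Num.min d3 (t - s))) => [|r r0].
  by rewrite !lt_min d10 d20 d30 subr_gt0.
rewrite !lt_min => /andP[/andP[rd1 rd2] /andP[rd3 rts]].
have h1 := H1 r r0 rd1.
have := H2 r r0 rd2; rewrite add0r (C0_id hT) => h2.
have h3 : `|U (s + r) - U s - r *: (`|h s| : R^o)| <= e1 * r.
  have := HU s (s + r) e1 `|h s| s0; rewrite (_ : s + r - s = r); last by ring.
  apply; first by rewrite lerDl ltW.
  move=> q /andP[sq qr]; apply/ltW/H3 => //; rewrite ger0_norm ?subr_ge0//.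
  by rewrite ltrBlDl (lt_le_trans qr)// lerD2l ltW.
have tsr : 0 <= t - (s + r) <= t.
  by apply/andP; split; [rewrite opprD addrA subr_ge0 ltW|rewrite gerBl addr_ge0// ltW].
have -> : w (s + r) - w s = T (t - (s + r)) (x (s + r) - T r (x s)).
  rewrite (linear_funB (dT _ tsr)) /w; congr (_ - _).
  have -> : t - s = (t - (s + r)) + r by ring.
  by rewrite (C0_add hT) ?(ltW r0)//; case/andP: tsr.
apply: (le_trans (HK _ _ tsr)); rewrite -mulrBr.
have h4 : `|x (s + r) - T r (x s)| <= 2 * (e1 * r) + r * `|h s|.
  have -> : x (s + r) - T r (x s) =
    (x (s + r) - x s - r *: (a s + h s)) - (T r (x s) - x s - r *: a s) + r *: h s.
    by rewrite scalerDr subr_defect subrKB.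
  apply: (le_trans (ler_normD _ _)); rewrite normrZ (gtr0_norm r0) lerD2r.
  by apply: (le_trans (ler_normB _ _)); rewrite mulr2n mulrDl mul1r; exact: lerD.
have h5 : r * `|h s| <= U (s + r) - U s + e1 * r.
  by move: h3; rewrite ler_norml => /andP[h3 _]; move: h3; rewrite /GRing.scale/=; clear; lra.
have e1E : (3 * K + 1) * e1 = e by rewrite /e1 mulrC divfK// gt_eqF.
apply: (le_trans (ler_wpM2l K0 h4)).
have := ler_wpM2l K0 h5; rewrite -[X in _ -> _ <= _ + X * _]e1E.
have : 0 <= e1 * r by rewrite mulr_ge0// ltW.
by clear; lra.
Qed.

End variation_of_constants.

(** * One step of a matrix semigroup *)

Section boundary_semigroup.
Context {R : realType} (E : completeNormedModType R) (p : R) (p1 : 1 <= p).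
Notation F := (Lp E p1).
Notation X := (E * F * F)%type.
Implicit Types u v : X.

Lemma norm_prod_fst (V W : normedModType R) (x : (V * W)%type) : `|x.1| <= `|x|.
Proof. by rewrite prod_normE le_max lexx. Qed.

Lemma norm_prod_snd (V W : normedModType R) (x : (V * W)%type) : `|x.2| <= `|x|.
Proof. by rewrite prod_normE le_max lexx orbT. Qed.

Lemma norm_component1 u : `|u.1.1| <= `|u|.
Proof. exact: le_trans (norm_prod_fst _) (norm_prod_fst _). Qed.

Lemma norm_component2 u : `|u.1.2| <= `|u|.
Proof. exact: le_trans (norm_prod_snd _) (norm_prod_fst _). Qed.

Lemma norm_component3 u : `|u.2| <= `|u|.
Proof. exact: norm_prod_snd. Qed.

Lemma norm_componentB1 u v : `|u.1.1 - v.1.1| <= `|u - v|.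
Proof. exact: (norm_component1 (u - v)). Qed.

Lemma norm_componentB2 u v : `|u.1.2 - v.1.2| <= `|u - v|.
Proof. exact: (norm_component2 (u - v)). Qed.

Lemma norm_componentB3 u v : `|u.2 - v.2| <= `|u - v|.
Proof. exact: (norm_component3 (u - v)). Qed.

Lemma calA1E (A : operator E) u v : calA1 p1 A (u, v) ->
  exists ae : E * E, [/\ A (u.1.1, ae.1), is_delta0 u.1.2 ae.2, v.1.1 = ae.1 + ae.2,
    weak_derivative u.1.2 v.1.2 & v.2 = 0].
Proof.
case: u => [[x f] g]; case: v => [[y f'] g'] [a [e [h1 h2 h3 h4 h5]]].
by exists (a, e).
Qed.

(** What one step [S] of length [t] does to [(x, f, g)]: the first component is
    driven by [T] up to a term controlled by [f] on [0, t), the second is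
    shifted, the third stays.  Only inequalities between continuous functions
    of the state occur, so it suffices to know them on a dense set. *)
Definition boundary_step (T : R -> E -> E) (K t : R) (S : X -> X) :=
  forall u, [/\ `|(S u).1.1 - T t u.1.1| <= K * head_norm t u.1.2,
    forall b, 0 <= b ->
      head_norm t u.1.2 + head_norm b (S u).1.2 <= head_norm (t + b) u.1.2,
    `|(S u).1.2| <= `|u.1.2| & (S u).2 = u.2].

Lemma head_norm_lipschitz b (f g : F) : 0 <= b ->
  head_norm b f <= head_norm b g + (1 + b) * `|f - g|.
Proof.
move=> b0; have -> : f = 1 *: g + (f - g) by rewrite scale1r addrC subrK.
apply: (le_trans (head_norm_linear _ _ _ _)); rewrite normr1 mul1r lerD2l.
by rewrite scale1r addrAC subrr add0r; exact: head_norm_le.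
Qed.

Lemma le0_dense (D : X -> Prop) (Phi : X -> R) (L : R) : 0 <= L ->
  (forall u e, 0 < e -> exists v, D v /\ `|v - u| <= e) ->
  (forall u v, Phi u <= Phi v + L * `|u - v|) ->
  (forall v, D v -> Phi v <= 0) -> forall u, Phi u <= 0.
Proof.
move=> L0 dD PL PD u; apply/ler_addgt0Pr => e e0.
have L1 : 0 < L + 1 by lra.
have [v [Dv vu]] := dD u _ (divr_gt0 e0 L1).
have := PL u v; have := PD v Dv.
rewrite ler_pdivlMr// distrC in vu; have := normr_ge0 (u - v); lra.
Qed.

Lemma state_space_complete : seq_complete X.
Proof.
have cE : seq_complete E by exact: seq_complete_completeNormed.
have cF : seq_complete F by exact: Lp_seq_complete.
by apply: seq_complete_prod => //; exact: seq_complete_prod.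
Qed.

Section one_semigroup.
Variables (A : operator E) (T : R -> E -> E) (calT : R -> X -> X).
Hypotheses (gT : generates A T) (gcalT : generates (calA1 p1 A) calT).

Let hT : C0_semigroup T := gT.1.
Let hcalT : C0_semigroup calT := gcalT.1.

Lemma domain_orbit u v t : generator calT (u, v) -> 0 <= t ->
  calA1 p1 A (calT t u, calT t v).
Proof. by move=> guv t0; rewrite gcalT.2; exact: generator_invariant. Qed.

(** The orbit of a point of the domain stays in the domain, where the matrix
    decouples: the second component is a path driven by the weak derivative,
    hence a shift; the third is constant; the first solves an equation with
    generator [A] and the boundary values of the second as inhomogeneity. *)
Lemma boundary_step_domain K t : 0 <= t -> 0 <= K ->
  (forall s y, 0 <= s <= t -> `|T s y| <= K * `|y|) ->
  forall u v, generator calT (u, v) ->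
  [/\ `|(calT t u).1.1 - T t u.1.1| <= K * head_norm t u.1.2,
    forall b, 0 <= b ->
      head_norm t u.1.2 + head_norm b (calT t u).1.2 <= head_norm (t + b) u.1.2,
    `|(calT t u).1.2| <= `|u.1.2| & (calT t u).2 = u.2].
Proof.
move=> t0 K0 HK u v guv.
have dom s : 0 <= s -> exists ae : E * E, [/\ A ((calT s u).1.1, ae.1),
    is_delta0 (calT s u).1.2 ae.2, (calT s v).1.1 = ae.1 + ae.2,
    weak_derivative (calT s u).1.2 (calT s v).1.2 & (calT s v).2 = 0].
  by move=> s0; apply: calA1E; exact: domain_orbit.
have /choice[ae Hae] : forall s, exists ae : E * E, 0 <= s -> [/\ A ((calT s u).1.1, ae.1),
    is_delta0 (calT s u).1.2 ae.2, (calT s v).1.1 = ae.1 + ae.2,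
    weak_derivative (calT s u).1.2 (calT s v).1.2 & (calT s v).2 = 0].
  move=> s; have [/dom[ae Hae]|s0] := leP 0 s; first by exists ae.
  by exists 0.
pose x s := (calT s u).1.1; pose f s := (calT s u).1.2; pose g s := (calT s u).2.
have T0u : calT 0 u = u by rewrite (C0_id hcalT).
have cu s : 0 <= s -> continuous_at_in (calT^~ u) Rplus s.
  by move=> s0; apply: orbit_continuous => //; rewrite /Rplus/= in_itv/= s0.
have du s : 0 <= s -> right_derivative (calT^~ u) s (calT s v).
  by move=> s0; exact: generator_right_derivative.
have cx s : 0 <= s -> continuous_at_in x Rplus s.
  by move=> /cu; apply: continuous_at_in_le => r; exact: norm_componentB1.
have cf s : 0 <= s -> continuous_at_in f Rplus s.
  by move=> /cu; apply: continuous_at_in_le => r; exact: norm_componentB2.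
have cg s : 0 <= s -> continuous_at_in g Rplus s.
  by move=> /cu; apply: continuous_at_in_le => r; exact: norm_componentB3.
have dx s : 0 <= s -> right_derivative x s (calT s v).1.1.
  move=> /du; apply: right_derivative_le => r.
  exact: (norm_component1 (calT (s + r) u - calT s u - r *: calT s v)).
have df s : 0 <= s -> right_derivative f s (calT s v).1.2.
  move=> /du; apply: right_derivative_le => r.
  exact: (norm_component2 (calT (s + r) u - calT s u - r *: calT s v)).
have dg s : 0 <= s -> right_derivative g s 0.
  move=> s0; have [_ _ _ _ <-] := Hae s s0; apply: right_derivative_le (du s s0) => r.
  exact: (norm_component3 (calT (s + r) u - calT s u - r *: calT s v)).
have wf s : 0 <= s -> weak_derivative (f s) (calT s v).1.2.
  by move=> s0; have [_ _ _] := Hae s s0.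
have repr_ s : 0 <= s -> exists k : R -> E, [/\ continuous_eps k,
    Lp_repr (f s) = k %[ae (@lebesgue_measure R) in Rplus] & k 0 = (ae s).2].
  by move=> s0; have [_ d _ _ _] := Hae s s0; exact: continuous_representative.
have [h [ch fh h0]] := repr_ 0 (lexx 0).
have shift s k : 0 <= s -> continuous_eps k ->
    Lp_repr (f s) = k %[ae (@lebesgue_measure R) in Rplus] ->
    forall q, 0 <= q -> k q = h (q + s).
  by move=> s0 ck fk; exact: (path_is_shift cf df wf s0 ch ck fh fk).
have delta s : 0 <= s -> (ae s).2 = h s.
  move=> s0; have [k [ck fk <-]] := repr_ s s0.
  by rewrite (shift s k s0 ck fk 0 (lexx 0)) add0r.
have [kt [ckt fkt _]] := repr_ t t0.
rewrite -[in u.1.1]T0u -[in u.1.2]T0u -[in u.2]T0u; split.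
- apply: (@inhomogeneous_bound _ _ _ _ T x (fun s => (ae s).1) h (f 0) K t) => //.
  + by move=> s s0; rewrite -gT.2; have [] := Hae s s0.
  + move=> s s0; have [_ _ E1 _ _] := Hae s s0; rewrite -delta// -E1; exact: dx.
- move=> b b0; rewrite le_eqVlt; apply/orP; left; apply/eqP.
  by apply: (head_norm_shift t0 b0 ch ckt fh fkt); exact: shift.
- by apply: (norm_shift t0 ch ckt fh fkt); exact: shift.
- apply: (@right_derivative0_cst _ _ g 0 t t0) => s /andP[s0 st]; last exact: dg.
  exact: continuous_at_inS (@segment_Rplus _ t) (cg s s0).
Qed.

Lemma boundary_step_semigroup K t : 0 <= t -> 0 <= K ->
  (forall s y, 0 <= s <= t -> `|T s y| <= K * `|y|) ->
  boundary_step T K t (calT t).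
Proof.
move=> t0 K0 HK u.
pose D w := exists v, generator calT (w, v).
have dD w e : 0 < e -> exists v, D v /\ `|v - w| <= e.
  move=> e0; have [y [z [g yw]]] := generator_dense hcalT state_space_complete w e0.
  by exists y; split => //; exists z.
have [KS KS0 HS] := linear_bounded (C0_linear hcalT t0) (C0_bounded hcalT t0).
have lip w v : `|calT t w - calT t v| <= KS * `|w - v|.
  by rewrite -(linear_funB (C0_linear hcalT t0)).
have key w : D w -> _ := fun h => let: ex_intro v g := h in boundary_step_domain t0 K0 HK g.
split.
- rewrite -subr_le0; move: u; apply: (@le0_dense D _ (KS + K + K * (1 + t))) => //.
  + by rewrite !addr_ge0 ?mulr_ge0 ?addr_ge0// ltW.
  + move=> w v.
    have h1 := head_norm_lipschitz v.1.2 w.1.2 t0.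
    have h2 := norm_componentB2 v w; have h3 := norm_componentB1 w v.
    have h4 := norm_componentB1 (calT t w) (calT t v); have h5 := lip w v.
    have h6 : `|T t (w.1.1 - v.1.1)| <= K * `|w.1.1 - v.1.1|.
      by apply: HK; rewrite t0 lexx.
    rewrite (linear_funB (C0_linear hT t0)) in h6.
    rewrite [ `|v - w|]distrC in h2.
    have h7 : `|(calT t w).1.1 - T t w.1.1| <= `|(calT t v).1.1 - T t v.1.1| +
      `|(calT t w).1.1 - (calT t v).1.1| + `|T t w.1.1 - T t v.1.1|.
      have -> : (calT t w).1.1 - T t w.1.1 = ((calT t v).1.1 - T t v.1.1) +
         ((calT t w).1.1 - (calT t v).1.1) - (T t w.1.1 - T t v.1.1).
        by rewrite [X in _ = X - _]addrC addrA subrK subrKB.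
      by apply: (le_trans (ler_normB _ _)); rewrite lerD2r; exact: ler_normD.
    have t1 : 0 <= 1 + t by lra.
    have h8 := ler_wpM2l K0 h1.
    have h9 := ler_wpM2l K0 (ler_wpM2l t1 h2).
    have h10 := ler_wpM2l K0 h3.
    by move: h4 h5 h6 h7 h8 h9 h10; clear -hT hcalT; lra.
  + by move=> w /key[h _ _ _]; rewrite subr_le0.
- move=> b b0; rewrite -subr_le0; move: u.
  apply: (@le0_dense D _ ((1 + t) + (1 + b) * KS + (1 + (t + b)))) => //.
  + by rewrite !addr_ge0 ?mulr_ge0 ?addr_ge0// ltW.
  + move=> w v.
    have tb : 0 <= t + b by exact: addr_ge0.
    have h1 := head_norm_lipschitz w.1.2 v.1.2 t0.
    have h2 := head_norm_lipschitz v.1.2 w.1.2 tb.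
    have h3 := head_norm_lipschitz (calT t w).1.2 (calT t v).1.2 b0.
    have h4 := norm_componentB2 w v.
    have h5 := norm_componentB2 v w; rewrite [ `|v - w|]distrC in h5.
    have h6 := le_trans (norm_componentB2 (calT t w) (calT t v)) (lip w v).
    have t1 : 0 <= 1 + t by lra. have b1 : 0 <= 1 + b by lra.
    have tb1 : 0 <= 1 + (t + b) by lra.
    have h7 := ler_wpM2l t1 h4; have h8 := ler_wpM2l tb1 h5; have h9 := ler_wpM2l b1 h6.
    by move: h1 h2 h3 h7 h8 h9; clear -hT hcalT; lra.
  + by move=> w /key[_ h _ _]; rewrite subr_le0; exact: h.
- rewrite -subr_le0; move: u; apply: (@le0_dense D _ (KS + 1)) => //.
  + by rewrite addr_ge0// ltW.
  + move=> w v; have h1 := le_trans (norm_componentB2 (calT t w) (calT t v)) (lip w v).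
    have h2 := norm_componentB2 v w; rewrite [ `|v - w|]distrC in h2.
    have h3 := ler_normD ((calT t w).1.2 - (calT t v).1.2) (calT t v).1.2.
    have h4 := ler_normD (v.1.2 - w.1.2) w.1.2.
    rewrite subrK in h3; rewrite subrK in h4.
    by move: h1 h2 h3 h4; clear -hT hcalT; lra.
  + by move=> w /key[_ _ h _]; rewrite subr_le0.
- apply/eqP; rewrite -subr_eq0 -normr_le0; move: u.
  apply: (@le0_dense D _ (KS + 1)) => //.
  + by rewrite addr_ge0// ltW.
  + move=> w v; have h1 := le_trans (norm_componentB3 (calT t w) (calT t v)) (lip w v).
    have h2 := norm_componentB3 v w; rewrite [ `|v - w|]distrC in h2.
    have -> : (calT t w).2 - w.2 =
        ((calT t w).2 - (calT t v).2) + ((calT t v).2 - v.2) + (v.2 - w.2).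
      by rewrite !addrA !subrK.
    apply: (le_trans (ler_normD _ _)).
    have := ler_normD ((calT t w).2 - (calT t v).2) ((calT t v).2 - v.2).
    by move: h1 h2; clear -hT hcalT; lra.
  + by move=> w /key[_ _ _ ->]; rewrite subrr normr0.
Qed.

End one_semigroup.
End boundary_semigroup.

Lemma bounded_linear_continuous (R : realType) (X Y : normedModType R) (f : X -> Y) K :
  linear f -> 0 < K -> (forall x, `|f x| <= K * `|x|) -> continuous f.
Proof.
move=> lf K0 HK.
pose g : {linear X -> Y} := HB.pack f (GRing.isLinear.Build _ _ _ _ _ lf).
suff /linear_bounded_continuous : bounded_near g (nbhs 0) by [].
apply/linear_boundedP; exists K; split; first exact: gtr0_real.
move=> r Kr x; apply: (le_trans (HK x)).
by rewrite ler_wpM2r// ltW.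
Qed.

Section swap.
Context {R : realType} (E : completeNormedModType R) (p : R) (p1 : 1 <= p).
Notation F := (Lp E p1).
Notation X := (E * F * F)%type.
Implicit Types u v : X.

(** Exchanging the two functions turns [calA2] into [calA1], so that one analysis
    covers both matrix semigroups. *)
Definition swap u : X := (u.1.1, u.2, u.1.2).

Lemma swapK : involutive swap. Proof. by case => [[x f] g]. Qed.

Lemma swapD u v : swap (u + v) = swap u + swap v. Proof. by []. Qed.

Lemma swapB u v : swap (u - v) = swap u - swap v. Proof. by []. Qed.

Lemma swapZ a u : swap (a *: u) = a *: swap u. Proof. by []. Qed.

Lemma norm_swap u : `|swap u| = `|u|.
Proof. by rewrite !prod_normE/= maxAC. Qed.

Lemma calA2_swap (A : operator E) u v : calA1 p1 A (u, v) <-> calA2 p1 A (swap u, swap v).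
Proof.
case: u => [[x f] g]; case: v => [[y f'] g'].
by split => -[a [e [h1 h2 h3 h4 h5]]]; exists a, e.
Qed.

Lemma swap_generates (A : operator E) (calT : R -> X -> X) :
  generates (calA2 p1 A) calT ->
  generates (calA1 p1 A) (fun t u => swap (calT t (swap u))).
Proof.
move=> [hT gT]; split.
  split.
  - by move=> t t0 a u v; rewrite swapD swapZ (C0_linear hT t0) swapD swapZ.
  - move=> t t0; have [K K0 HK] := linear_bounded (C0_linear hT t0) (C0_bounded hT t0).
    apply: (bounded_linear_continuous _ K0) => [a u v|u].
      by rewrite swapD swapZ (C0_linear hT t0) swapD swapZ.
    by rewrite norm_swap; apply: le_trans (HK _) _; rewrite norm_swap.
  - by apply/funext => u; rewrite (C0_id hT)/= swapK.
  - by move=> s t s0 t0; apply/funext => u /=; rewrite (C0_add hT)//= swapK.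
  - move=> u; apply/within_continuousP => s Rs e e0.
    have [d d0 Hd] := @orbit_continuous _ _ calT hT (swap u) s Rs e e0.
    by exists d => // r Rr rs; rewrite -swapB norm_swap; exact: Hd.
have E1 h u v : h^-1 *: (swap (calT h (swap u)) - u) - v =
    swap (h^-1 *: (calT h (swap u) - swap u) - swap v).
  by rewrite swapB swapZ swapB !swapK.
apply/seteqP; split=> [[u v]|[u v]].
  move=> /calA2_swap; rewrite gT => /cvg_at_right0P H; apply/cvg_at_right0P => e e0.
  have [d d0 Hd] := H e e0; exists d => // h h0 hd.
  by rewrite [X in `|X|]E1 norm_swap; exact: Hd.
move=> /cvg_at_right0P H; apply/calA2_swap; rewrite gT; apply/cvg_at_right0P => e e0.
have [d d0 Hd] := H e e0; exists d => // h h0 hd.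
by rewrite -norm_swap -[X in `|X|]E1; exact: Hd.
Qed.

End swap.

(** * Stability of splitting schemes *)

Section stability.
Context {R : realType} (E : completeNormedModType R) (p : R) (p1 : 1 <= p).
Notation F := (Lp E p1).
Notation X := (E * F * F)%type.
Implicit Types (u v : X) (f g : F).

(** One step of length [h] of a splitting scheme, compared with the scheme [Q]
    on [E]: both boundary functions are consumed by translation. *)
Definition split_step (Q : E -> E) (C h : R) (V : X -> X) :=
  forall u, [/\ `|(V u).1.1 - Q u.1.1| <= C * (head_norm h u.1.2 + head_norm h u.2),
    forall b, 0 <= b -> head_norm h u.1.2 + head_norm b (V u).1.2 <= head_norm (h + b) u.1.2,
    forall b, 0 <= b -> head_norm h u.2 + head_norm b (V u).2 <= head_norm (h + b) u.2,
    `|(V u).1.2| <= `|u.1.2| & `|(V u).2| <= `|u.2|].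

(** Telescoping the first component against [Q]: the defects add up to the
    L^1 norms of the boundary functions over the whole time interval. *)
Lemma split_step_iter Q C h V n K : linear Q -> 0 <= h -> 0 <= C -> 0 <= K ->
  split_step Q C h V -> (forall i y, (i <= n)%N -> `|iter i Q y| <= K * `|y|) ->
  forall u, `|iter n V u| <= (K * (1 + 2 * C * (1 + n%:R * h)) + 1) * `|u|.
Proof.
move=> lQ h0 C0 K0 HV HK u.
pose w j := iter j V u.
have nh m : 0 <= m%:R * h by rewrite mulr_ge0.
have H2 m : forall b, 0 <= b -> \sum_(j < m) head_norm h (w j).1.2 + head_norm b (w m).1.2 <=
    head_norm (m%:R * h + b) u.1.2.
  elim: m => [|m IH] b b0; first by rewrite big_ord0 add0r mul0r add0r.
  rewrite big_ord_recr/=; have [_ S _ _ _] := HV (w m); have := S b b0.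
  have hb : 0 <= h + b by exact: addr_ge0.
  have := IH (h + b) hb; rewrite addrA -[m.+1%:R]natr1 mulrDl mul1r -/(w m).
  by lra.
have H3 m : forall b, 0 <= b -> \sum_(j < m) head_norm h (w j).2 + head_norm b (w m).2 <=
    head_norm (m%:R * h + b) u.2.
  elim: m => [|m IH] b b0; first by rewrite big_ord0 add0r mul0r add0r.
  rewrite big_ord_recr/=; have [_ _ S _ _] := HV (w m); have := S b b0.
  have hb : 0 <= h + b by exact: addr_ge0.
  have := IH (h + b) hb; rewrite addrA -[m.+1%:R]natr1 mulrDl mul1r -/(w m).
  by lra.
have N2 m : `|(w m).1.2| <= `|u.1.2|.
  by elim: m => // m IH; have [_ _ _ S _] := HV (w m); exact: le_trans S IH.
have N3 m : `|(w m).2| <= `|u.2|.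
  by elim: m => // m IH; have [_ _ _ _ S] := HV (w m); exact: le_trans S IH.
have tel := @telescope_le _ E Q K id (fun j => (w j).1.1) n lQ (fun _ _ => id) erefl HK.
have D : `|iter n Q u.1.1 - (w n).1.1| <= K * (C * (2 * ((1 + n%:R * h) * `|u|))).
  apply: (le_trans tel); rewrite ler_wpM2l//.
  apply: (@le_trans _ _ (\sum_(j < n) C * (head_norm h (w j).1.2 + head_norm h (w j).2))).
    apply: ler_sum => j _; rewrite subSnn /= distrC.
    by have [] := HV (w j).
  rewrite -mulr_sumr ler_wpM2l// big_split/=.
  have := H2 n 0 (lexx 0); have := H3 n 0 (lexx 0); rewrite addr0.
  have := head_norm_le u.1.2 (nh n); have := head_norm_le u.2 (nh n).
  have := head_norm_ge0 0 (w n).1.2; have := head_norm_ge0 0 (w n).2.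
  have n1 : 0 <= 1 + n%:R * h by rewrite addr_ge0.
  have := ler_wpM2l n1 (norm_component2 u); have := ler_wpM2l n1 (norm_component3 u).
  lra.
have B1 : `|(w n).1.1| <= K * (1 + 2 * C * (1 + n%:R * h)) * `|u|.
  have := ler_normB (iter n Q u.1.1) (iter n Q u.1.1 - (w n).1.1).
  rewrite opprB addrC subrK => h1.
  have h2 := HK n u.1.1 (leqnn n); have h3 := ler_wpM2l K0 (norm_component1 u).
  lra.
have big : 0 <= K * (1 + 2 * C * (1 + n%:R * h)).
  by rewrite mulr_ge0// addr_ge0// mulr_ge0 ?mulr_ge0// addr_ge0.
have le1 : `|u| <= (K * (1 + 2 * C * (1 + n%:R * h)) + 1) * `|u|.
  by rewrite mulrDl mul1r lerDr mulr_ge0.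
rewrite prod_normE ge_max prod_normE ge_max -andbA; apply/and3P; split.
- by apply: (le_trans B1); rewrite ler_wpM2r// lerDl.
- exact: le_trans (N2 n) (le_trans (norm_component2 u) le1).
- exact: le_trans (N3 n) (le_trans (norm_component3 u) le1).
Qed.

Definition boundary_step2 (T : R -> E -> E) (K t : R) (S : X -> X) :=
  boundary_step T K t (fun u => swap (S (swap u))).

Lemma boundary_step2P T K t S : boundary_step2 T K t S -> forall u,
  [/\ `|(S u).1.1 - T t u.1.1| <= K * head_norm t u.2,
    forall b, 0 <= b -> head_norm t u.2 + head_norm b (S u).2 <= head_norm (t + b) u.2,
    `|(S u).2| <= `|u.2| & (S u).1.2 = u.1.2].
Proof. by move=> H u; have [] := H (swap u); rewrite swapK. Qed.

Section two_steps.
Variables (T1 T2 : R -> E -> E) (K1 K2 h C : R) (S1 S2 : X -> X).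
Hypotheses (h0 : 0 <= h) (K10 : 0 <= K1) (K20 : 0 <= K2)
  (CK : K1 + K2 + K1 * K2 <= C)
  (B1 : boundary_step T1 K1 h S1) (B2 : boundary_step2 T2 K2 h S2)
  (l1 : linear (T1 h)) (l2 : linear (T2 h))
  (b1 : forall y, `|T1 h y| <= K1 * `|y|) (b2 : forall y, `|T2 h y| <= K2 * `|y|).

Lemma split_step21 : split_step (T2 h \o T1 h) C h (S2 \o S1).
Proof.
move=> u /=; have [X1 Y1 Z1 W1] := B1 u.
have [X2 Y2 Z2 W2] := boundary_step2P B2 (S1 u).
rewrite W1 in X2 Y2 Z2; split => //; [|by rewrite W2|by rewrite W2].
have -> : (S2 (S1 u)).1.1 - T2 h (T1 h u.1.1) = ((S2 (S1 u)).1.1 - T2 h (S1 u).1.1) +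
   T2 h ((S1 u).1.1 - T1 h u.1.1) by rewrite (linear_funB l2) addrA subrK.
apply: (le_trans (ler_normD _ _)).
have h1 := b2 ((S1 u).1.1 - T1 h u.1.1); have h2 := ler_wpM2l K20 X1.
have f0 := head_norm_ge0 h u.1.2; have g0 := head_norm_ge0 h u.2.
have := ler_wpM2r (addr_ge0 f0 g0) CK.
have := mulr_ge0 K10 f0; have := mulr_ge0 K20 f0; have := mulr_ge0 K10 g0.
have := mulr_ge0 (mulr_ge0 K10 K20) g0.
by move: X2 h1 h2; set a := head_norm h u.1.2; set b := head_norm h u.2; lra.
Qed.

Lemma split_step12 : split_step (T1 h \o T2 h) C h (S1 \o S2).
Proof.
move=> u /=; have [X2 Y2 Z2 W2] := boundary_step2P B2 u.
have [X1 Y1 Z1 W1] := B1 (S2 u).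
rewrite W2 in X1 Y1 Z1; split => //; [|by rewrite W1|by rewrite W1].
have -> : (S1 (S2 u)).1.1 - T1 h (T2 h u.1.1) = ((S1 (S2 u)).1.1 - T1 h (S2 u).1.1) +
   T1 h ((S2 u).1.1 - T2 h u.1.1) by rewrite (linear_funB l1) addrA subrK.
apply: (le_trans (ler_normD _ _)).
have h1 := b1 ((S2 u).1.1 - T2 h u.1.1); have h2 := ler_wpM2l K10 X2.
have f0 := head_norm_ge0 h u.1.2; have g0 := head_norm_ge0 h u.2.
have := ler_wpM2r (addr_ge0 f0 g0) CK.
have := mulr_ge0 K10 g0; have := mulr_ge0 K20 f0; have := mulr_ge0 K20 g0.
have := mulr_ge0 (mulr_ge0 K10 K20) f0.
by move: X1 h1 h2; set a := head_norm h u.1.2; set b := head_norm h u.2; lra.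
Qed.

End two_steps.

Lemma split_step_average Q1 Q2 C h V1 V2 :
  split_step Q1 C h V1 -> split_step Q2 C h V2 ->
  split_step (fun x => 2^-1 *: (Q1 x + Q2 x)) C h (fun u => 2^-1 *: (V1 u + V2 u)).
Proof.
move=> H1 H2 u; have [a1 a2 a3 a4 a5] := H1 u; have [c1 c2 c3 c4 c5] := H2 u.
have n2 : `|2^-1 : R| = 2^-1 by rewrite ger0_norm.
have hn b f g : head_norm b (2^-1 *: (f + g)) <= 2^-1 * head_norm b f + 2^-1 * head_norm b g.
  rewrite scalerDr; apply: (le_trans (head_norm_linear _ _ _ _)); rewrite n2 lerD2l.
  have z : head_norm b (0 : F) <= 0 by rewrite -(head_norm0 E p1 b).
  by have := head_norm_linear b 2^-1 g 0; rewrite addr0 n2; move: z; lra.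
have nn (W : normedModType R) (f g : W) : `|2^-1 *: (f + g)| <= 2^-1 * (`|f| + `|g|).
  by rewrite normrZ n2 ler_wpM2l// ler_normD.
split.
- have -> : (2^-1 *: (V1 u + V2 u)).1.1 - 2^-1 *: (Q1 u.1.1 + Q2 u.1.1) =
    2^-1 *: (((V1 u).1.1 - Q1 u.1.1) + ((V2 u).1.1 - Q2 u.1.1)).
    by rewrite -scalerBr /= opprD addrACA.
  by apply: (le_trans (nn _ _ _)); lra.
- move=> b b0; have := a2 b b0; have := c2 b b0; have := hn b (V1 u).1.2 (V2 u).1.2.
  by rewrite -[(2^-1 *: (V1 u + V2 u)).1.2]/(2^-1 *: ((V1 u).1.2 + (V2 u).1.2)); lra.
- move=> b b0; have := a3 b b0; have := c3 b b0; have := hn b (V1 u).2 (V2 u).2.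
  by rewrite -[(2^-1 *: (V1 u + V2 u)).2]/(2^-1 *: ((V1 u).2 + (V2 u).2)); lra.
- by have := nn _ (V1 u).1.2 (V2 u).1.2; rewrite /=; lra.
- by have := nn _ (V1 u).2 (V2 u).2; rewrite /=; lra.
Qed.

End stability.

(** * Operator norms and consistency *)

Section operator_norm.
Context {R : realType}.

Lemma opnorm_le (X Y : normedModType R) (S : X -> Y) (c : R) : 0 <= c ->
  (forall x, `|S x| <= c * `|x|) -> (opnorm S <= c%:E)%E.
Proof.
move=> c0 H; apply: ge_ereal_sup => _ [x /= x1 <-].
by rewrite lee_fin (le_trans (H x))// ler_piMr.
Qed.

Lemma le_opnorm (X Y : normedModType R) (S : X -> Y) (c : R) : linear S ->
  (opnorm S <= c%:E)%E -> forall x, `|S x| <= c * `|x|.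
Proof.
move=> lS H x; have [->|x0] := eqVneq x 0.
  by rewrite (linear_fun0 lS) !normr0 mulr0.
have nx : 0 < `|x| by rewrite normr_gt0.
have : ((`|S (`|x|^-1 *: x)|)%:E <= c%:E)%E.
  apply: le_trans H; apply: ereal_sup_ubound; exists (`|x|^-1 *: x) => //=.
  by rewrite normrZ ger0_norm ?invr_ge0// mulVf ?gt_eqF.
rewrite lee_fin (linear_funZ lS) normrZ ger0_norm ?invr_ge0//.
by rewrite ler_pdivrMl// mulrC.
Qed.

End operator_norm.

Lemma subr_comp_defect (V : zmodType) (wv wx wa x a b : V) :
  wv - x - (a + b) = (wv - wx - wa) + (wx - x - b) + (wa - a).
Proof.
rewrite [RHS]addrAC [_ - wa + _]addrA subrK [RHS]addrAC !addrA subrK opprD addrA.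
by rewrite [RHS]addrAC.
Qed.

Section consistency.
Context {R : realType} (X : normedModType R).
Implicit Types V W : R -> X -> X.

Definition consistent V (x y : X) := forall e, 0 < e -> exists2 d : R, 0 < d &
  forall h, 0 < h -> h < d -> `|V h x - x - h *: y| <= e * h.

Definition strongly_continuous0 V := forall x e, 0 < e -> exists2 d : R, 0 < d &
  forall h, 0 < h -> h < d -> `|V h x - x| <= e.

Definition locally_bounded V (K : R) := forall h x, 0 <= h <= 1 -> `|V h x| <= K * `|x|.

(** The defect of the composition is [W h] applied to the defect of [V], plus the
    defect of [W], plus [h *: (W h a - a)]. *)
Lemma consistent_comp V W K x a b : 0 <= K -> (forall h, 0 <= h -> linear (W h)) ->
  locally_bounded W K -> strongly_continuous0 W ->
  consistent V x a -> consistent W x b ->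
  consistent (fun h => W h \o V h) x (a + b).
Proof.
move=> K0 lW bW cW cVa cWb e e0.
have e3 : 0 < e / 3 by lra.
have K1 : 0 < K + 1 by lra.
have [d1 d10 H1] := cVa _ (divr_gt0 e3 K1); have [d2 d20 H2] := cWb _ e3.
have [d3 d30 H3] := cW a _ e3.
exists (Num.min (Num.min d1 d2) (Num.min d3 1)) => [|h h0].
  by rewrite !lt_min d10 d20 d30 ltr01.
rewrite !lt_min => /andP[/andP[hd1 hd2] /andP[hd3 h1]].
have lh := lW h (ltW h0).
have -> : (W h \o V h) x - x - h *: (a + b) =
   W h (V h x - x - h *: a) + (W h x - x - h *: b) + h *: (W h a - a).
  rewrite /= !(linear_funB lh) (linear_funZ lh) scalerBr scalerDr.
  exact: subr_comp_defect.
apply: (le_trans (ler_normD _ _)); rewrite normrZ (gtr0_norm h0).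
have h01 : 0 <= h <= 1 by rewrite (ltW h0) (ltW h1).
have b1 := bW h (V h x - x - h *: a) h01.
have b2 := ler_wpM2l K0 (H1 h h0 hd1).
have b3 := ler_wpM2l (ltW h0) (H3 h h0 hd3).
have b4 := H2 h h0 hd2.
have b5 := ler_normD (W h (V h x - x - h *: a)) (W h x - x - h *: b).
have b6 : K * (e / 3 / (K + 1) * h) <= e / 3 * h.
  have -> : K * (e / 3 / (K + 1) * h) = e / 3 * h * (K / (K + 1)) by ring.
  have K1' : K / (K + 1) <= 1 by rewrite ler_pdivrMr// mul1r lerDl.
  by have := ler_wpM2l (mulr_ge0 (ltW e3) (ltW h0)) K1'; rewrite mulr1.
by lra.
Qed.

Lemma consistent_average V W x a b : consistent V x a -> consistent W x b ->
  consistent (fun h u => 2^-1 *: (V h u + W h u)) x (2^-1 *: (a + b)).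
Proof.
move=> cV cW e e0; have [d1 d10 H1] := cV e e0; have [d2 d20 H2] := cW e e0.
exists (Num.min d1 d2) => [|h h0]; first by rewrite lt_min d10.
rewrite lt_min => /andP[/(H1 h h0) h1 /(H2 h h0) h2].
have -> : 2^-1 *: (V h x + W h x) - x - h *: (2^-1 *: (a + b)) =
    2^-1 *: ((V h x - x - h *: a) + (W h x - x - h *: b)).
  have xx : 2^-1 *: (x + x) = x.
    by rewrite scalerDr -scalerDl (_ : 2^-1 + 2^-1 = 1) ?scale1r//; field.
  rewrite [in RHS]addrACA (addrACA (V h x)) -!opprD -scalerDr !scalerBr xx.
  by rewrite !scalerA mulrC.
rewrite normrZ ger0_norm//.
have := ler_normD (V h x - x - h *: a) (W h x - x - h *: b); lra.
Qed.

Lemma consistent_half V x a : consistent V x a ->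
  consistent (fun h => V (h / 2)) x (2^-1 *: a).
Proof.
move=> cV e e0; have [d d0 H] := cV e e0; exists d => // h h0 hd.
rewrite scalerA; apply: (@le_trans _ _ (e * (h / 2))); first by apply: H; lra.
by rewrite ler_wpM2l ?(ltW e0)//; lra.
Qed.

Lemma iter_conj (f g k : X -> X) n u :
  iter n.+1 (f \o g \o k) u = f (iter n (g \o k \o f) (g (k u))).
Proof. by elim: n => // n IH; rewrite iterS IH. Qed.

End consistency.

Section splitting_steps.
Context {R : realType} (X : normedModType R) (S1 S2 : R -> X -> X).
Hypotheses (l1 : forall h, 0 <= h -> linear (S1 h))
  (l2 : forall h, 0 <= h -> linear (S2 h)).

Definition sequential_step (h : R) : X -> X := S2 h \o S1 h.

Definition strang_step (h : R) : X -> X := S1 (h / 2) \o S2 h \o S1 (h / 2).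

Definition weighted_step (h : R) : X -> X :=
  fun x => 2^-1 *: (S1 h (S2 h x) + S2 h (S1 h x)).

Lemma half_double (x : X) : 2^-1 *: x + 2^-1 *: x = x.
Proof. by rewrite -scalerDl (_ : 2^-1 + 2^-1 = 1) ?scale1r//; field. Qed.

Lemma linear_sequential_step h : 0 <= h -> linear (sequential_step h).
Proof. by move=> h0 a u v; rewrite /sequential_step/= l1// l2. Qed.

Lemma linear_strang_step h : 0 <= h -> linear (strang_step h).
Proof.
move=> h0 a u v; have h2 : 0 <= h / 2 by rewrite divr_ge0.
by rewrite /strang_step/= (l1 h2) (l2 h0) (l1 h2).
Qed.

Let linear_double_step h : 0 <= h -> linear (fun x => S1 h (S2 h x) + S2 h (S1 h x)).
Proof.
by move=> h0 a u v; rewrite (l1 h0) !(l2 h0) (l1 h0) addrACA -scalerDr.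
Qed.

Lemma linear_weighted_step h : 0 <= h -> linear (weighted_step h).
Proof.
move=> h0 a u v; rewrite /weighted_step (linear_double_step h0) scalerDr.
by rewrite !scalerA mulrC.
Qed.

Lemma weighted_splittingE t n : 0 <= t ->
  weighted_splitting S1 S2 t n = iter n (weighted_step (t / n%:R)).
Proof.
move=> t0; apply/funext => x; rewrite /weighted_splitting /weighted_step.
have := linear_double_step (divr_ge0 t0 (ler0n R n)); set f := (fun y => _) => lf.
have H k : (2 ^+ k)^-1 *: iter k f x = iter k (fun y => 2^-1 *: f y) x.
  elim: k => [|k IH]; first by rewrite expr0 invr1 scale1r.
  by rewrite [RHS]iterS -IH /= (linear_funZ lf) scalerA exprS invfM.
exact: H.
Qed.

Lemma strang_splittingE t n :
  strang_splitting S1 S2 t n = iter n (strang_step (t / n%:R)).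
Proof.
rewrite /strang_splitting /strang_step.
by rewrite (_ : t / (2 * n)%:R = t / n%:R / 2)// natrM invfM mulrA mulrAC.
Qed.

End splitting_steps.

(** * Power bounds *)

Section power_bounds.
Context {R : realType} (X : normedModType R).
Implicit Types V S : R -> X -> X.

Definition power_bounded V M omega :=
  forall h n x, 0 <= h -> `|iter n (V h) x| <= M * expR (omega * (n%:R * h)) * `|x|.

Lemma opnorm_power_bounded V M omega : 1 <= M -> (forall h, 0 <= h -> linear (V h)) ->
  (forall t n, 0 <= t -> (0 < n)%N ->
     (opnorm (iter n (V (t / n%:R)%R)) <= (M * expR (t * omega))%:E)%E) ->
  power_bounded V M omega.
Proof.
move=> M1 lV H h [|n] x h0; first by rewrite /= mul0r mulr0 expR0 mulr1 ler_peMl.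
have n0 : (n.+1%:R : R) != 0 by rewrite pnatr_eq0.
have := H (n.+1%:R * h) n.+1 (mulr_ge0 (ler0n _ _) h0) isT.
have -> : n.+1%:R * h / n.+1%:R = h by rewrite mulrC mulKf.
rewrite (mulrC _ omega) => Hn.
exact: (le_opnorm (iter_linear _ (lV h h0)) Hn).
Qed.

Lemma power_bounded_opnorm V M omega : 1 <= M -> power_bounded V M omega ->
  forall t n, 0 <= t -> (0 < n)%N ->
    (opnorm (iter n (V (t / n%:R)%R)) <= (M * expR (t * omega))%:E)%E.
Proof.
move=> M1 HV t n t0 n0; have M0 : 0 <= M := le_trans ler01 M1.
apply: opnorm_le => [|x]; first by rewrite mulr_ge0// expR_ge0.
have nn : (n%:R : R) != 0 by rewrite pnatr_eq0 -lt0n.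
have := HV (t / n%:R) n x (divr_ge0 t0 (ler0n _ _)).
have -> : n%:R * (t / n%:R) = t by rewrite mulrC divfK.
by rewrite (mulrC omega).
Qed.

(** Conjugating by half a step of [S1] costs only two bounded factors:
    the symmetric scheme has the same iterates as the sequential one, apart
    from the first and the last step. *)
Lemma strang_power_bounded S1 S2 M omega C1 w1 C2 w2 :
  0 <= M -> 0 <= omega -> 1 <= C1 -> 0 <= w1 -> 1 <= C2 -> 0 <= w2 ->
  (forall h, 0 <= h -> S1 h = S1 (h / 2) \o S1 (h / 2)) ->
  (forall h x, 0 <= h -> `|S1 h x| <= C1 * expR (w1 * h) * `|x|) ->
  (forall h x, 0 <= h -> `|S2 h x| <= C2 * expR (w2 * h) * `|x|) ->
  power_bounded (sequential_step S1 S2) M omega ->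
  power_bounded (strang_step S1 S2) (C1 * C2 * C1 * (M + 1)) (omega + w1 + w2).
Proof.
move=> M0 om0 C11 w10 C21 w20 S1h HS1 HS2 HM h n x h0.
have c1 : 0 <= C1 by exact: le_trans C11.
have c2 : 0 <= C2 by exact: le_trans C21.
have M1 : 0 <= M + 1 by rewrite addr_ge0.
case: n => [|n].
  rewrite /= mul0r mulr0 expR0 mulr1 ler_peMl//.
  have M11 : 1 <= M + 1 by rewrite lerDr.
  by rewrite !mulr_ege1.
have h2 : 0 <= h / 2 by rewrite divr_ge0.
rewrite iter_conj -[S2 h \o _ \o _]/(S2 h \o (S1 (h / 2) \o S1 (h / 2))) -S1h//.
set y := iter n _ _.
have b1 := HS1 (h / 2) y h2.
have b2 := HM h n (S2 h (S1 (h / 2) x)) h0; rewrite -/y in b2.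
have b3 := HS2 h (S1 (h / 2) x) h0.
have b4 := HS1 (h / 2) x h2.
set e1 := expR _ in b1 b4; set em := expR _ in b2; set e2 := expR _ in b3.
have ee : e1 * em * e2 * e1 <= expR ((omega + w1 + w2) * (n.+1%:R * h)).
  rewrite -!expRD ler_expR -[n.+1%:R]natr1.
  have := mulr_ge0 om0 h0; have := mulr_ge0 w10 (mulr_ge0 (ler0n R n) h0).
  by have := mulr_ge0 w20 (mulr_ge0 (ler0n R n) h0); lra.
have [e10 em0 e20] : [/\ 0 <= e1, 0 <= em & 0 <= e2] by rewrite !expR_ge0.
apply: (le_trans b1).
apply: (le_trans (ler_wpM2l (mulr_ge0 c1 e10) b2)).
apply: (le_trans (ler_wpM2l (mulr_ge0 c1 e10)
  (ler_wpM2l (mulr_ge0 M0 em0) b3))).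
apply: (le_trans (ler_wpM2l (mulr_ge0 c1 e10) (ler_wpM2l (mulr_ge0 M0 em0)
  (ler_wpM2l (mulr_ge0 c2 e20) b4)))).
have -> : C1 * e1 * (M * em * (C2 * e2 * (C1 * e1 * `|x|))) =
  (C1 * C2 * C1 * M) * (e1 * em * e2 * e1) * `|x| by ring.
rewrite ler_wpM2r// ler_pM ?mulr_ge0//.
by rewrite ler_wpM2l ?mulr_ge0// lerDl.
Qed.

End power_bounds.

Section splitting_bounds.
Context {R : realType} (E : completeNormedModType R) (p : R) (p1 : 1 <= p).
Notation F := (Lp E p1).
Notation X := (E * F * F)%type.

(** The boundary term contributes only the factor [1 + 2 C (1 + n h)] of
    [split_step_iter], which is absorbed by enlarging the exponential rate. *)
Lemma split_step_power_bounded (Q : R -> E -> E) (V : R -> X -> X) M0 w0 M w :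
  0 <= M0 -> 0 <= w0 -> 0 <= M -> 0 <= w -> (forall h, 0 <= h -> linear (Q h)) ->
  (forall h, 0 <= h -> split_step (Q h) (M0 * expR (w0 * h)) h (V h)) ->
  power_bounded Q M w -> power_bounded V (M * (1 + 2 * M0) + 1) (w + w0 + 1).
Proof.
move=> M00 w00 M0' w0' lQ HV HQ h n x h0.
have MM : 1 <= M * (1 + 2 * M0) + 1.
  by rewrite lerDr mulr_ge0// addr_ge0// mulr_ge0.
case: n => [|n]; first by rewrite /= mul0r mulr0 expR0 mulr1 ler_peMl.
have nh : 0 <= n.+1%:R * h by rewrite mulr_ge0.
have C0 : 0 <= M0 * expR (w0 * h) by rewrite mulr_ge0// expR_ge0.
have K0 : 0 <= M * expR (w * (n.+1%:R * h)) by rewrite mulr_ge0// expR_ge0.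
have HK i y : (i <= n.+1)%N ->
    `|iter i (Q h) y| <= M * expR (w * (n.+1%:R * h)) * `|y|.
  move=> ni; apply: (le_trans (HQ h i y h0)); rewrite ler_wpM2r// ler_wpM2l//.
  by rewrite ler_expR ler_wpM2l// ler_wpM2r// ler_nat.
apply: (le_trans (split_step_iter (lQ h h0) h0 C0 K0 (HV h h0) HK x)).
rewrite ler_wpM2r//.
set s := n.+1%:R * h in nh *.
have -> : (w + w0 + 1) * s = w * s + w0 * s + s by ring.
rewrite !expRD; set a := expR (w * s); set b := expR (w0 * s); set c := expR s.
have a1 : 1 <= a by rewrite -expR0 ler_expR mulr_ge0.
have b1 : 1 <= b by rewrite -expR0 ler_expR mulr_ge0.
have sc : 1 + s <= c by exact: expR_ge1Dx.
have c1 : 1 <= c by apply: le_trans sc; rewrite lerDl.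
have hb : expR (w0 * h) <= b.
  by rewrite ler_expR ler_wpM2l// ler_peMl// ler1n.
have bc1 : 1 <= b * c by rewrite mulr_ege1.
have bc : expR (w0 * h) * (1 + s) <= b * c.
  by rewrite ler_pM ?expR_ge0// addr_ge0.
have abc1 : 1 <= a * b * c by rewrite -mulrA mulr_ege1.
have Ma : 0 <= M * a by rewrite mulr_ge0// (le_trans ler01).
have := ler_wpM2l Ma bc1; have := ler_wpM2l (mulr_ge0 Ma M00) bc.
clear -abc1; lra.
Qed.

(** A single matrix semigroup inherits a growth bound from the semigroup on
    [E], by one application of the step estimate on [[0, t]]. *)
Lemma matrix_semigroup_growth (A : operator E) T calT :
  generates A T -> generates (calA1 p1 A) calT ->
  exists M w : R, [/\ 1 <= M, 0 <= w,
    forall t y, 0 <= t -> `|T t y| <= M * expR (w * t) * `|y|,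
    forall t, 0 <= t -> boundary_step T (M * expR (w * t)) t (calT t) &
    forall t u, 0 <= t -> `|calT t u| <= 2 * M * expR ((w + 1) * t) * `|u|].
Proof.
move=> gT gcalT; have [M [w [M1 w0 HT]]] := semigroup_growth gT.1.
have M0 : 0 <= M := le_trans ler01 M1.
have bs t : 0 <= t -> boundary_step T (M * expR (w * t)) t (calT t).
  move=> t0; apply: (boundary_step_semigroup gT gcalT t0).
    by rewrite mulr_ge0// expR_ge0.
  move=> s y /andP[s0 st]; apply: (le_trans (HT s y s0)).
  by rewrite ler_wpM2r// ler_wpM2l// ler_expR ler_wpM2l.
exists M, w; split => // t u t0; have [H1 _ H2 H3] := bs t t0 u.
set K := M * expR (w * t) in H1.
have e1 : 1 <= expR (w * t) by rewrite -expR0 ler_expR mulr_ge0.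
have K1 : 1 <= K by rewrite mulr_ege1.
have K0 : 0 <= K := le_trans ler01 K1.
have t1 : 0 <= 1 + t by rewrite addr_ge0.
have L : K * (2 + t) <= 2 * M * expR ((w + 1) * t).
  rewrite (_ : (w + 1) * t = w * t + t); last by ring.
  rewrite expRD; have := ler_wpM2l K0 (expR_ge1Dx t).
  have := mulr_ge0 K0 t0; have -> : 2 * M * (expR (w * t) * expR t) =
    2 * (K * expR t) by rewrite /K; ring.
  by lra.
apply: (@le_trans _ _ (K * (2 + t) * `|u|)); last by rewrite ler_wpM2r.
have one : `|u| <= K * (2 + t) * `|u|.
  by rewrite ler_peMl// mulr_ege1//; lra.
rewrite prod_normE ge_max prod_normE ge_max -andbA; apply/and3P; split.
- have b1 := HT t u.1.1 t0; rewrite -/K in b1.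
  have b2 := ler_wpM2l K0 (norm_component1 u).
  have b3 := ler_wpM2l K0 (head_norm_le u.1.2 t0).
  have b4 := ler_wpM2l K0 (ler_wpM2l t1 (norm_component2 u)).
  have := ler_normD ((calT t u).1.1 - T t u.1.1) (T t u.1.1); rewrite subrK.
  lra.
- exact: le_trans H2 (le_trans (norm_component2 u) one).
- by rewrite H3; exact: le_trans (norm_component3 u) one.
Qed.

End splitting_bounds.

Section generator_consistency.
Context {R : realType} (X : normedModType R) (T : R -> X -> X).
Hypothesis hT : C0_semigroup T.

Lemma generator_consistent x y : generator T (x, y) -> consistent T x y.
Proof.
move=> g e e0; have [d d0 H] := generator_right_derivative hT (lexx 0) g e0.
exists d => // h h0 hd; have := H h h0 hd.
by rewrite add0r !(C0_id hT).
Qed.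

Lemma semigroup_strongly_continuous0 : strongly_continuous0 T.
Proof.
move=> x e e0; have [|d d0 H] := @orbit_continuous _ _ _ hT x 0 _ e e0.
  by rewrite /Rplus/= in_itv/= lexx.
exists d => // h h0 hd; rewrite ltW//; have := H h; rewrite (C0_id hT) subr0.
by apply; rewrite ?gtr0_norm// /Rplus/= in_itv/= andbT ltW.
Qed.

Lemma growth_locally_bounded C w : 0 <= C -> 0 <= w ->
  (forall h x, 0 <= h -> `|T h x| <= C * expR (w * h) * `|x|) ->
  locally_bounded T (C * expR w).
Proof.
move=> C0 w0 H h x /andP[h0 h1]; apply: (le_trans (H h x h0)).
by rewrite ler_wpM2r// ler_wpM2l// ler_expR ler_piMr.
Qed.

End generator_consistency.

(** * Convergence of the splittings *)

Section splittings_converge.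
Context {R : realType} (E : completeNormedModType R) (p : R) (p1 : 1 <= p).
Notation F := (Lp E p1).
Notation X := (E * F * F)%type.
Variables (A1 A2 : operator E) (T1 T2 : R -> E -> E) (calT1 calT2 : R -> X -> X).
Hypotheses (gT1 : generates A1 T1) (gT2 : generates A2 T2)
  (gcalT1 : generates (calA1 p1 A1) calT1) (gcalT2 : generates (calA2 p1 A2) calT2).

Let lT1 (t : R) : 0 <= t -> linear (T1 t). Proof. exact: C0_linear gT1.1 t. Qed.
Let lT2 (t : R) : 0 <= t -> linear (T2 t). Proof. exact: C0_linear gT2.1 t. Qed.
Let lcalT1 (t : R) : 0 <= t -> linear (calT1 t). Proof. exact: C0_linear gcalT1.1 t. Qed.
Let lcalT2 (t : R) : 0 <= t -> linear (calT2 t). Proof. exact: C0_linear gcalT2.1 t. Qed.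

Let growth1 : exists C w : R, [/\ 1 <= C, 0 <= w &
  forall h u, 0 <= h -> `|calT1 h u| <= C * expR (w * h) * `|u|].
Proof.
have [M [w [M1 w0 _ _ H]]] := matrix_semigroup_growth gT1 gcalT1.
by exists (2 * M), (w + 1); split; [lra|lra|].
Qed.

Let growth2 : exists C w : R, [/\ 1 <= C, 0 <= w &
  forall h u, 0 <= h -> `|calT2 h u| <= C * expR (w * h) * `|u|].
Proof.
have [M [w [M1 w0 _ _ H]]] := matrix_semigroup_growth gT2 (swap_generates gcalT2).
exists (2 * M), (w + 1); split; [lra|lra|] => h u h0.
by have := H h (swap u) h0; rewrite !norm_swap swapK.
Qed.

Let split_steps : exists M0 w0 : R, [/\ 0 <= M0, 0 <= w0 & forall h, 0 <= h ->
  split_step (sequential_step T1 T2 h) (M0 * expR (w0 * h)) h (sequential_step calT1 calT2 h) /\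
  split_step (weighted_step T1 T2 h) (M0 * expR (w0 * h)) h (weighted_step calT1 calT2 h)].
Proof.
have [M1 [w1 [M11 w10 H1 S1 _]]] := matrix_semigroup_growth gT1 gcalT1.
have [M2 [w2 [M21 w20 H2 S2 _]]] :=
  matrix_semigroup_growth gT2 (swap_generates gcalT2).
exists (3 * (M1 * M2)), (w1 + w2); split => [||h h0].
- by rewrite !mulr_ge0//; lra.
- exact: addr_ge0.
set K1 := M1 * expR (w1 * h); set K2 := M2 * expR (w2 * h).
have K11 : 1 <= K1.
  by rewrite mulr_ege1// -expR0 ler_expR mulr_ge0.
have K21 : 1 <= K2.
  by rewrite mulr_ege1// -expR0 ler_expR mulr_ge0.
have K10 : 0 <= K1 := le_trans ler01 K11.
have K20 : 0 <= K2 := le_trans ler01 K21.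
have CK : K1 + K2 + K1 * K2 <= 3 * (M1 * M2) * expR ((w1 + w2) * h).
  rewrite (mulrDl w1) expRD.
  have -> : 3 * (M1 * M2) * (expR (w1 * h) * expR (w2 * h)) = 3 * (K1 * K2).
    by rewrite /K1 /K2; ring.
  have := ler_wpM2l K10 K21; have := ler_wpM2r K20 K11.
  rewrite mulr1 mul1r; lra.
have b1 y : `|T1 h y| <= K1 * `|y| by exact: H1.
have b2 y : `|T2 h y| <= K2 * `|y| by exact: H2.
have s21 := split_step21 K10 K20 CK (S1 h h0) (S2 h h0) (lT2 h0) b2.
have s12 := split_step12 K10 K20 CK (S1 h h0) (S2 h h0) (lT1 h0) b1.
by split => //; exact: split_step_average s12 s21.
Qed.

Lemma sequential_power_bounded M w : 0 <= M -> 0 <= w ->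
  power_bounded (sequential_step T1 T2) M w -> exists M' w', [/\ 1 <= M', 0 <= w' &
    power_bounded (sequential_step calT1 calT2) M' w'].
Proof.
move=> M0 w0 H; have [C [c [C0 c0 S]]] := split_steps.
exists (M * (1 + 2 * C) + 1), (w + c + 1); split; last first.
- apply: (split_step_power_bounded C0 c0 M0 w0 _ _ H) => h h0; last exact: (S h h0).1.
  exact: linear_sequential_step lT1 lT2 _ h0.
- by rewrite !addr_ge0.
- by rewrite lerDr mulr_ge0// addr_ge0// mulr_ge0.
Qed.

Lemma weighted_power_bounded M w : 0 <= M -> 0 <= w ->
  power_bounded (weighted_step T1 T2) M w -> exists M' w', [/\ 1 <= M', 0 <= w' &
    power_bounded (weighted_step calT1 calT2) M' w'].
Proof.
move=> M0 w0 H; have [C [c [C0 c0 S]]] := split_steps.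
exists (M * (1 + 2 * C) + 1), (w + c + 1); split; last first.
- apply: (split_step_power_bounded C0 c0 M0 w0 _ _ H) => h h0; last exact: (S h h0).2.
  exact: linear_weighted_step lT1 lT2 _ h0.
- by rewrite !addr_ge0.
- by rewrite lerDr mulr_ge0// addr_ge0// mulr_ge0.
Qed.

Let sc1 := semigroup_strongly_continuous0 gcalT1.1.
Let sc2 := semigroup_strongly_continuous0 gcalT2.1.

(** On the intersection of the two domains every scheme has derivative
    [calA1 x + calA2 x] at 0. *)
Let consistent_schemes x y : operator_add (calA1 p1 A1) (calA2 p1 A2) (x, y) ->
  [/\ consistent (sequential_step calT1 calT2) x y, consistent (strang_step calT1 calT2) x y &
    consistent (weighted_step calT1 calT2) x y].
Proof.
move=> [a [b []]]; rewrite gcalT1.2 gcalT2.2 => ga gb; rewrite -[(x, y).2]/y => ->.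
have ca := generator_consistent gcalT1.1 ga.
have cb := generator_consistent gcalT2.1 gb.
have [C1 [w1 [C11 w10 H1]]] := growth1; have [C2 [w2 [C21 w20 H2]]] := growth2.
have lb1 := growth_locally_bounded (le_trans ler01 C11) w10 H1.
have lb2 := growth_locally_bounded (le_trans ler01 C21) w20 H2.
have k1 : 0 <= C1 * expR w1 by rewrite mulr_ge0 ?expR_ge0//; lra.
have k2 : 0 <= C2 * expR w2 by rewrite mulr_ge0 ?expR_ge0//; lra.
have s21 : consistent (sequential_step calT1 calT2) x (a + b).
  exact: consistent_comp k2 lcalT2 lb2 sc2 ca cb.
have s12 : consistent (fun h => calT1 h \o calT2 h) x (b + a).
  exact: consistent_comp k1 lcalT1 lb1 sc1 cb ca.
split; [exact: s21| |].
- have ch := consistent_half ca.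
  have -> : a + b = (2^-1 *: a + b) + 2^-1 *: a by rewrite addrAC half_double.
  apply: (consistent_comp (V := fun h => calT2 h \o calT1 (h / 2))
    (W := fun h => calT1 (h / 2)) k1 _ _ _ _ ch) => [h h0|h u /andP[h0 h1]|u e e0|].
  + by apply: lcalT1; rewrite divr_ge0.
  + by apply: lb1; lra.
  + by have [d d0 H] := sc1 u e0; exists d => // h h0 hd; apply: H; lra.
  + exact: consistent_comp k2 lcalT2 lb2 sc2 ch cb.
- have := consistent_average s12 s21; rewrite (addrC b).
  by rewrite scalerDr half_double.
Qed.

Variable calT : R -> X -> X.
Hypothesis gcalT :
  generates (operator_closure (operator_add (calA1 p1 A1) (calA2 p1 A2))) calT.

Let chernoff_scheme (V : R -> X -> X) M w : 1 <= M -> 0 <= w ->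
  (forall h, 0 <= h -> linear (V h)) -> V 0 = id -> power_bounded V M w ->
  (forall x y, operator_add (calA1 p1 A1) (calA2 p1 A2) (x, y) -> consistent V x y) ->
  forall x t, 0 <= t -> iter n (V (t / n%:R)) x @[n --> \oo] --> calT t x.
Proof.
move=> M1 w0 lV V0 bV cV.
exact: (chernoff (@state_space_complete _ E p p1) gcalT.1 (esym gcalT.2) w0
  (le_trans ler01 M1) lV V0 bV cV).
Qed.

Lemma sequential_splitting_cvg M w : 1 <= M -> 0 <= w ->
  power_bounded (sequential_step calT1 calT2) M w ->
  forall x t, 0 <= t -> sequential_splitting calT1 calT2 t n x @[n --> \oo] --> calT t x.
Proof.
move=> M1 w0 H; apply: (chernoff_scheme M1 w0 _ _ H) => [h h0||x y /consistent_schemes[S _ _]];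
  last exact: S.
  exact: linear_sequential_step lcalT1 lcalT2 _ h0.
by rewrite /sequential_step (C0_id gcalT1.1) (C0_id gcalT2.1).
Qed.

Lemma strang_splitting_cvg M w : 1 <= M -> 0 <= w ->
  power_bounded (sequential_step calT1 calT2) M w ->
  forall x t, 0 <= t -> strang_splitting calT1 calT2 t n x @[n --> \oo] --> calT t x.
Proof.
move=> M1 w0 H x t t0.
have [C1 [w1 [C11 w10 H1]]] := growth1; have [C2 [w2 [C21 w20 H2]]] := growth2.
have T1h h : 0 <= h -> calT1 h = calT1 (h / 2) \o calT1 (h / 2).
  move=> h0; have h2 : 0 <= h / 2 by rewrite divr_ge0.
  by rewrite -(C0_add gcalT1.1)//; congr calT1; field.
have M0 : 0 <= M := le_trans ler01 M1.
have B := strang_power_bounded M0 w0 C11 w10 C21 w20 T1h H1 H2 H.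
under eq_fun do rewrite strang_splittingE.
apply: (chernoff_scheme _ _ _ _ B _ t0) => [|||| y z /consistent_schemes[_ S _]];
  last exact: S.
- by rewrite !mulr_ege1 ?lerDr.
- by rewrite !addr_ge0.
- exact: linear_strang_step.
- by rewrite /strang_step mul0r (C0_id gcalT1.1) (C0_id gcalT2.1).
Qed.

Lemma weighted_splitting_cvg M w : 1 <= M -> 0 <= w ->
  power_bounded (weighted_step calT1 calT2) M w ->
  forall x t, 0 <= t -> weighted_splitting calT1 calT2 t n x @[n --> \oo] --> calT t x.
Proof.
move=> M1 w0 H x t t0; under eq_fun do rewrite (weighted_splittingE lcalT1 lcalT2)//.
apply: (chernoff_scheme M1 w0 _ _ H _ t0) => [h h0||y z /consistent_schemes[_ _ S]]; last exact: S.
  exact: linear_weighted_step lcalT1 lcalT2 _ h0.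
apply/funext => y /=; rewrite /weighted_step (C0_id gcalT1.1) (C0_id gcalT2.1)/=.
by rewrite scalerDr half_double.
Qed.

End splittings_converge.

Theorem proposition3p4 (R : realType) (E : completeNormedModType R)
  (p : R) (p1 : 1 <= p) (A1 A2 : operator E) (T1 T2 : R -> E -> E)
  (calT1 calT2 : R -> E * Lp E p1 * Lp E p1 -> E * Lp E p1 * Lp E p1) :
  generates A1 T1 -> generates A2 T2 ->
  generates (calA1 p1 A1) calT1 -> generates (calA2 p1 A2) calT2 ->
  (forall M' omega' : R, 1 <= M' -> 0 <= omega' ->
    (forall (t : R) (n : nat), 0 <= t -> (0 < n)%N ->
      (opnorm (sequential_splitting T1 T2 t n)
        <= (M' * expR (t * omega'))%:E)%E) ->
    (exists M omega : R, 1 <= M /\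
      forall (t : R) (n : nat), 0 <= t -> (0 < n)%N ->
        (opnorm (sequential_splitting calT1 calT2 t n)
          <= (M * expR (t * omega))%:E)%E) /\
    (forall calT : R -> E * Lp E p1 * Lp E p1 -> E * Lp E p1 * Lp E p1,
      generates (operator_closure (operator_add (calA1 p1 A1) (calA2 p1 A2)))
        calT ->
      forall (x : E * Lp E p1 * Lp E p1) (t : R), 0 <= t ->
        (sequential_splitting calT1 calT2 t n x @[n --> \oo] --> calT t x) /\
        (strang_splitting calT1 calT2 t n x @[n --> \oo] --> calT t x))) /\
  (forall M' omega' : R, 1 <= M' -> 0 <= omega' ->
    (forall (t : R) (n : nat), 0 <= t -> (0 < n)%N ->
      (opnorm (weighted_splitting T1 T2 t n)
        <= (M' * expR (t * omega'))%:E)%E) ->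
    (exists M omega : R, 1 <= M /\
      forall (t : R) (n : nat), 0 <= t -> (0 < n)%N ->
        (opnorm (weighted_splitting calT1 calT2 t n)
          <= (M * expR (t * omega))%:E)%E) /\
    (forall calT : R -> E * Lp E p1 * Lp E p1 -> E * Lp E p1 * Lp E p1,
      generates (operator_closure (operator_add (calA1 p1 A1) (calA2 p1 A2)))
        calT ->
      forall (x : E * Lp E p1 * Lp E p1) (t : R), 0 <= t ->
        weighted_splitting calT1 calT2 t n x @[n --> \oo] --> calT t x)).
Proof.
move=> gT1 gT2 gcalT1 gcalT2.
have lT1 := C0_linear gT1.1; have lT2 := C0_linear gT2.1.
split=> M' omega' M'1 omega'0 H.
- have bE := opnorm_power_bounded M'1 (linear_sequential_step lT1 lT2) H.
  have [M [omega [M1 omega0 bX]]] := sequential_power_bounded gT1 gT2 gcalT1 gcalT2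
    (le_trans ler01 M'1) omega'0 bE.
  split; first by exists M, omega; split => //; exact: power_bounded_opnorm bX.
  move=> calT gcalT x t t0; split.
    exact: (sequential_splitting_cvg gT1 gT2 gcalT1 gcalT2 gcalT M1 omega0 bX).
  exact: (strang_splitting_cvg gT1 gT2 gcalT1 gcalT2 gcalT M1 omega0 bX).
- have bE : power_bounded (weighted_step T1 T2) M' omega'.
    apply: (opnorm_power_bounded M'1 (linear_weighted_step lT1 lT2)) => t n t0 n0.
    by rewrite -(weighted_splittingE lT1 lT2)//; exact: H.
  have [M [omega [M1 omega0 bX]]] := weighted_power_bounded gT1 gT2 gcalT1 gcalT2
    (le_trans ler01 M'1) omega'0 bE.
  split; last first.
    move=> calT gcalT x t t0.
    exact: (weighted_splitting_cvg gT1 gT2 gcalT1 gcalT2 gcalT M1 omega0 bX).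
  exists M, omega; split => // t n t0 n0.
  rewrite (weighted_splittingE (C0_linear gcalT1.1) (C0_linear gcalT2.1))//.
  exact: power_bounded_opnorm bX _ _ t0 n0.
Qed.
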